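(* Assume conditions (C1), (C2) and (C4) below hold. Then for every $x$ satisfying (C3), \[ \mathrm{Law}_x(\hat S_n\mid \tau>n)\Rightarrow \mathrm{Law}\big(\rho W_++(1-\rho)W_-\big),\qquad n\to\infty, \] where $\rho$ is a $\{0,1\}$-valued random variable independent of $W_+$ and $W_-$ with \[ \mathbb{P}(\rho=1)=V(x)^{-1}\sum_{k=0}^\infty\mathbb{E}_x\big[u(S_{T_k});\,\tau\ge T_k,\ S_{T_k}\ge0\big]\in[0,1] \] and $V(x)=\sum_{k=0}^\infty\mathbb{E}_x[u(S_{T_k});\tau\ge T_k]$.
   Context: Let $X_1,X_2,\dots$ be i.i.d. real random variables with $\mathbb{E}[X_1]=0$ and $\sigma^2:=\mathrm{Var}(X_1)\in(0,\infty)$. Let $S_n=x+X_1+\dots+X_n$, and write $\mathbb{P}_x$ and $\mathbb{E}_x$ for probability and expectation when $S_0=x$. For an event $A$, $\mathbb{E}[X;A]:=\mathbb{E}[X\mathbf 1_A]$. Zero-crossing times: $T_0:=0$ and \[ T_{k+1}:=\inf\{n>T_k:\ S_n<0 \text{ if } S_{T_k}\ge0,\ \text{or } S_n\ge0 \text{ if } S_{T_k}<0\}. \] Absorption: let $U$ be either a real random variable or a sequence of real random variables. Let $U_0,U_1,\dots$ be independent copies of $U$, also independent of the walk. For each $i\in\mathbb{N}_0$ let $K_i$ be a measurable $\{0,1\}$-valued function of $(U\text{-value},\,\text{position})$. Define \[ \tau:=\inf\{n:\ \exists k\ge0 \text{ with } T_k\le n<T_{k+1} \text{ and } K_{n-T_k}(U_k,S_n)=1\}.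 \] Rescaled process: $\hat S_n$ is the continuous process on $[0,1]$ with $\hat S_n(m/n)=S_m/(\sigma n^{1/2})$ for $m=0,\dots,n$, linearly interpolated in between. For an event $A$, $\mathrm{Law}_y(\hat S_n\mid A)$ is the law on $(C([0,1]),\|\cdot\|_\infty)$ of $\hat S_n$ under $\mathbb{P}_y(\cdot\mid A)$. $\mathrm{Law}(W)$ is the law of a continuous process $W$, and $\Rightarrow$ denotes weak convergence. Conditions: - (C1): there are constants $c>0$ and $\gamma\in(0,1)$ with $\mathbb{P}_x(\tau\ge T_k)\le c\gamma^k$ for all $x\in\mathbb{R}$ and all $k\in\mathbb{N}_0$. - (C2): there is a function $u:\mathbb{R}\to\mathbb{R}$ with $n^{1/2}\,\mathbb{P}_y(\tau>n,T_1>n)\to u(y)$ for every $y\in\mathbb{R}$. - (C3) for a point $x$: there is a constant $c>0$ with $\mathbb{P}_x(\tau>n)\ge c^{-1}n^{-1/2}$ for all $n\in\mathbb{N}$. - (C4): there are continuous processes $W_+$ and $W_-$ on $[0,1]$ such that, for every $y$ with $u(y)>0$, $\mathrm{Law}_y(\hat S_n\mid\tau>n,T_1>n)\Rightarrow\mathrm{Law}(W_+)$ if $y\ge0$, and $\Rightarrow\mathrm{Law}(W_-)$ if $y<0$. *)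

(* Defs.v *)
From HB Require Import structures.
From mathcomp Require Import all_boot all_order all_algebra.
From mathcomp Require Import all_classical all_reals all_analysis.
Set Implicit Arguments. Unset Strict Implicit. Unset Printing Implicit Defensive.
Import Order.TTheory GRing.Theory Num.Theory.
Import numFieldNormedType.Exports.
Local Open Scope classical_set_scope.
Local Open Scope ring_scope.

(* ---------- times in N u {+oo}: [None] stands for +oo ---------- *)

Definition first_time (Q : nat -> Prop) : option nat :=
  match pselect (exists n, `[< Q n >]) with
  | left h => Some (@ex_minn (fun n => `[< Q n >]) h)
  | right _ => None
  end.

Definition olt (n : nat) (o : option nat) : Prop :=
  if o is Some m then (n < m)%N else True.

Definition ole (a b : option nat) : Prop :=
  match a, b with
  | _, None => True
  | None, Some _ => False
  | Some m, Some n => (m <= n)%N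
  end.

Section Walk.
Context {R : realType}.

Fixpoint cross (s : nat -> R) (k : nat) : option nat :=
  match k with
  | 0 => Some 0%N
  | k'.+1 =>
      match cross s k' with
      | None => None
      | Some t => first_time (fun n => (t < n)%N /\
                    (if 0 <= s t then s n < 0 else 0 <= s n))
      end
  end.

Definition absorb {T : Type} (K : nat -> T -> R -> bool) (Uv : nat -> T)
  (s : nat -> R) : option nat :=
  first_time (fun n => exists k t, cross s k = Some t /\ (t <= n)%N /\
                 olt n (cross s k.+1) /\ K (n - t)%N (Uv k) (s n)).

Definition cont01 (g : R -> R) : Prop := {within `[0, 1], continuous g}.

Definition bounded_cont_functional (f : (R -> R) -> R) : Prop :=
  (exists M : R, forall g, `|f g| <= M) /\
  forall g, cont01 g -> forall e : R, 0 < e ->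
    exists2 delta : R, 0 < delta &
      forall h, cont01 h -> (forall t, 0 <= t <= 1 -> `|g t - h t| <= delta) ->
        `|f g - f h| < e.

Definition weak_conv (En : nat -> ((R -> R) -> R) -> R)
  (E : ((R -> R) -> R) -> R) : Prop :=
  forall f, bounded_cont_functional f -> (fun n => En n f) @ \oo --> E f.

Section Prob.
Context {d : measure_display} {Omega : measurableType d}.
Variable P : probability Omega R.

Definition preimg_sets {dT} {T : measurableType dT} (Y : Omega -> T)
  : set (set Omega) :=
  [set A | exists2 B, measurable B & A = Y @^-1` B].

Definition mutual_indep (I : eqType) (F : I -> set (set Omega)) : Prop :=
  forall (J : seq I) (A : I -> set Omega), uniq J ->
    (forall i, i \in J -> F i (A i)) ->
    P (\bigcap_(i in [set i | i \in J]) A i) = (\prod_(i <- J) P (A i))%E.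

Definition indep2 (F G : set (set Omega)) : Prop :=
  forall A B, F A -> G B -> P (A `&` B) = (P A * P B)%E.

Definition expect (Y : Omega -> R) : R := fine (\int[P]_w (Y w)%:E).

Definition cond_expect (Y : Omega -> R) (A : set Omega) : R :=
  fine (\int[P]_(w in A) (Y w)%:E) / fine (P A).

Definition cont_process (W : Omega -> R -> R) : Prop :=
  (forall t, 0 <= t <= 1 -> measurable_fun setT (fun w => W w t)) /\
  (forall w, cont01 (W w)).

Definition process_sigma (W1 W2 : Omega -> R -> R) : set (set Omega) :=
  <<s [set A | exists t, 0 <= t <= 1 /\
        (preimg_sets (fun w => W1 w t) A \/ preimg_sets (fun w => W2 w t) A)] >>.

(* the random walk: increments X 0, X 1, ... are X_1, X_2, ... *)
Variable X : nat -> Omega -> R.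

Definition walk (x : R) (w : Omega) (n : nat) : R := x + \sum_(i < n) X i w.

(* \hat S_n : linear interpolation of m/n |-> S_m / (sigma sqrt n) *)
Definition hat_walk (sigma x : R) (n : nat) (w : Omega) : R -> R :=
  fun t => let m := `|Num.floor (t * n%:R)|%N in
    (walk x w m + (t * n%:R - m%:R) * (walk x w m.+1 - walk x w m))
      / (sigma * Num.sqrt n%:R).

Definition Tk (x : R) (k : nat) (w : Omega) : option nat := cross (walk x w) k.

Context {dT : measure_display} {T : measurableType dT}.
Variables (U : nat -> Omega -> T) (K : nat -> T -> R -> bool).

Definition tau (x : R) (w : Omega) : option nat :=
  absorb K (fun k => U k w) (walk x w).

Definition Vterm (u : R -> R) (pos : bool) (x : R) (k : nat) : \bar R :=
  \int[P]_(w in [set w | exists t, Tk x k w = Some t /\ ole (Some t) (tau x w)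
                          /\ (pos -> 0 <= walk x w t)])
     (u (walk x w (odflt 0%N (Tk x k w))))%:E.

Definition Vfun (u : R -> R) (x : R) : \bar R :=
  (\sum_(0 <= k <oo) Vterm u false x k)%E.

Definition rho_prob (u : R -> R) (x : R) : \bar R :=
  ((\sum_(0 <= k <oo) Vterm u true x k) / Vfun u x)%E.

Definition cond_C1 : Prop :=
  exists c gamma : R, 0 < c /\ 0 < gamma < 1 /\
    forall y k, (P [set w | ole (Tk y k w) (tau y w)] <= (c * gamma ^+ k)%:E)%E.

Definition cond_C2 (u : R -> R) : Prop :=
  forall y, (fun n : nat => Num.sqrt n%:R *
              fine (P [set w | olt n (tau y w) /\ olt n (Tk y 1 w)]))
            @ \oo --> u y.

Definition cond_C3 (x : R) : Prop :=
  exists c : R, 0 < c /\ forall n : nat, (0 < n)%N ->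
    ((c^-1 * (Num.sqrt n%:R)^-1)%:E <= P [set w | olt n (tau x w)])%E.

End Prob.
End Walk.

(* Main.v *)
(* Cut the walk at its crossing times: on [tau > n] there is exactly one [k] with
   [T_k <= n < T_{k+1}]. By the Markov property at [T_k] the last stretch is an
   excursion from [S_{T_k}]; by (C2) and (C4) it survives up to time [n] with
   probability about [u(S_{T_k}) n^{-1/2}], and its rescaled law tends to that of
   [W_+] or [W_-] according to the sign of [S_{T_k}], the first [T_k] steps being
   invisible after rescaling. Dominated convergence in [k] then gives
   [n^{1/2} E_x[f(\hat S_n); tau > n] -> sum_k E_x[u(S_{T_k}) E f(W_{+-}); tau >= T_k]]
   for [f >= 0], and dividing by the case [f = 1] yields the mixture.

   Domination: Lyapunov functions for the walk on a half-line give
   [P_y(T_1 > n) <= C (1 + |y|) n^{-1/2}] and [E_y |S_{T_1}| <= eps |y| + C_eps], so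
   that [E_x[1 + |S_{T_k}|; tau >= T_k] = O(gamma^k)] by (C1). If [T_k > n / 2], one of
   the first [k] excursions is longer than [n / (2k)], hence
   [P_x(tau >= T_k > n / 2) = O(k^2 gamma^k n^{-1/2})]. For fixed [k] the contribution
   of [n / 2 < T_k <= n] is even [o(n^{-1/2})]: a last excursion of length at least
   [n / D] is rare after such a [T_k], and [T_k] falls in [(n - n / D, n]] with
   probability [O(D^{-1}) n^{-1/2}] since, by induction,
   [n^{1/2} P_x(tau > n, T_k > n)] converges.

   Everything takes place on the space of pairs of sequences, where the Markov
   property says that splicing two independent points preserves the law. *)
Require Import Defs.
From HB Require Import structures.
From mathcomp Require Import all_boot all_order all_algebra.
From mathcomp Require Import all_classical all_reals all_analysis.
From mathcomp Require Import measurable_realfun lra ring zify.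
Import Order.TTheory GRing.Theory Num.Theory.
Import numFieldNormedType.Exports.
Local Open Scope classical_set_scope.
Local Open Scope ring_scope.

(** * Crossing times and absorption along a fixed path *)

(** (C2) and (C4) hold for each starting point separately, whereas they are applied at the random
    point [S_{T_k}]. All uniformity therefore comes from the finite variance, through bounds linear
    in [|y|], and these are useful only if the first moment of [S_{T_k}] on survival is under
    control. It decays like [gam ^ k] because the slope [eps] of the overshoot bound is free: with
    [eps = gam / 2] the recursion for the moments contracts faster than (C1) does.

    The Lyapunov functions are concave and piecewise linear in the position, apart from a bounded
    correction near zero. A downward jump of size [2 * a] has probability at least [q > 0], so every
    kink on the grid [a * k] buys negative drift; the price is the mean undershoot [psi], which
    finite variance makes summable over the grid.

    The uniform survival bound explodes for a last excursion that starts shortly before [n]. Such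
    paths are caught by an increment in time of a survival probability with fewer crossings, whose
    asymptotics are known by induction. *)

Lemma first_timeP (Q : nat -> Prop) n :
  first_time Q = Some n <-> Q n /\ forall j, (j < n)%N -> ~ Q j.
Proof.
rewrite /first_time; case: pselect => [h|h]; last first.
  by split=> // -[Qn _]; exfalso; apply: h; exists n; apply/asboolP.
case: ex_minnP => m /asboolP Qm minm; split=> [[<-]|[Qn ltn]].
  by split=> // j jm /asboolP/minm; rewrite leqNgt jm.
congr Some; apply/eqP; rewrite eqn_leq minm /=; last exact/asboolP.
by rewrite leqNgt; apply/negP => /ltn.
Qed.

Lemma first_time_None (Q : nat -> Prop) :
  first_time Q = None <-> forall j, ~ Q j.
Proof.
rewrite /first_time; case: pselect => [h|h]; split => //.
  by have [n /asboolP Qn] := h; move=> /(_ n).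
by move=> _ j Qj; apply: h; exists j; apply/asboolP.
Qed.

Lemma olt_first_time (Q : nat -> Prop) n :
  olt n (first_time Q) <-> forall j, (j <= n)%N -> ~ Q j.
Proof.
case E : (first_time Q) => [m|] /=; last first.
  by move/first_time_None : E.
move/first_timeP : E => [Qm ltm]; split=> [nm j jn|/(_ m) h].
  by apply: ltm; exact: leq_ltn_trans nm.
by rewrite ltnNge; apply/negP => /h.
Qed.

Lemma ole_first_time (Q : nat -> Prop) n :
  ole (Some n) (first_time Q) <-> forall j, (j < n)%N -> ~ Q j.
Proof.
case: n => [|n]; first by case: first_time.
have -> : ole (Some n.+1) (first_time Q) = olt n (first_time Q).
  by case: first_time.
by rewrite olt_first_time.
Qed.

Section Paths.
Context {R : realType}.
Implicit Types (s : nat -> R) (k m n t : nat).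

(** Zero counts as nonnegative, as in the definition of the crossing times, which depend on the path
    only through this boolean sequence. *)
Definition side s n : bool := 0 <= s n.

Lemma crossSP s k n : cross s k.+1 = Some n <->
  exists t, [/\ cross s k = Some t, (t < n)%N, side s n != side s t
     & forall j, (t < j < n)%N -> side s j = side s t].
Proof.
have optE t j : (if 0 <= s t then s j < 0 else 0 <= s j) =
    (side s j != side s t).
  by rewrite /side ltNge; case: (0 <= s t); case: (0 <= s j).
rewrite /=; case: (cross s k) => [t|]; last by split=> // -[t []].
rewrite first_timeP; split=> [[[tn]]|[_ [[<-] tn]]]; rewrite optE.
  move=> snt h; exists t; split=> // j /andP[tj jn].
  by apply/eqP; apply: contra_notT (h j jn); rewrite optE.
move=> snt h; split=> // j jn [tj]; rewrite optE.
by rewrite h ?tj ?jn// eqxx.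
Qed.

Lemma olt_crossS s k t n : cross s k = Some t ->
  olt n (cross s k.+1) <-> forall j, (t < j <= n)%N -> side s j = side s t.
Proof.
move=> /= ->; rewrite olt_first_time.
have optE j : (if 0 <= s t then s j < 0 else 0 <= s j) =
    (side s j != side s t).
  by rewrite /side ltNge; case: (0 <= s t); case: (0 <= s j).
split=> [h j /andP[tj jn]|h j jn [tj]]; last by rewrite optE h ?tj ?jn// eqxx.
by apply/eqP; apply: contra_notT (h j jn); rewrite optE.
Qed.

Lemma cross_mono s k k' t' : (k <= k')%N -> cross s k' = Some t' ->
  exists2 t, cross s k = Some t & (t + (k' - k) <= t')%N.
Proof.
move=> kk'; rewrite -{1}(subnKC kk').
elim: (k' - k)%N t' => [|l IH] t'.
  by rewrite addn0 => ->; exists t'; rewrite ?addn0.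
rewrite addnS => /crossSP[t [/IH[t0 -> t0t] tt' _ _]]; exists t0 => //; lia.
Qed.

Lemma cross_ge s k t : cross s k = Some t -> (k <= t)%N.
Proof. by move=> /(cross_mono _ _ _ _ (leq0n k))[t0 [<-]]; rewrite subn0. Qed.

Lemma cross_eq_upto s s' k n : (forall i, (i <= n)%N -> s i = s' i) ->
  cross s k = Some n -> cross s' k = Some n.
Proof.
elim: k n => [//|k IH] n ss' /crossSP[t [ct tn snt h]]; apply/crossSP.
have sideE i : (i <= n)%N -> side s i = side s' i by move=> /ss'; rewrite /side => ->.
exists t; split=> //.
- by apply: IH => // i it; apply: ss'; lia.
- by rewrite -!sideE//; lia.
- by move=> j jn; rewrite -!sideE ?h//; lia.
Qed.

(** A crossing is defined relative to the side at the previous crossing, and for the path restarted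
    at [T_k] this is its side at time [0]. *)
Lemma cross_shift s k m l : cross s k = Some m ->
  cross s (k + l) = omap (addn m) (cross (fun j => s (m + j)%N) l).
Proof.
move=> ckm; set s' := fun j => _.
have sideE j : side s (m + j) = side s' j by [].
have H n : cross s (k + l) = Some n <->
    (m <= n)%N /\ cross s' l = Some (n - m)%N.
  elim: l n => [|l IH] n.
    rewrite addn0 ckm /=; split=> [[<-]|[mn [nm]]]; first by rewrite subnn.
    by congr Some; lia.
  rewrite addnS !crossSP; split=> [[t [/IH[mt ct] tn snt h]]|[mn [t [ct tn snt h]]]].
    split; first by lia.
    exists (t - m)%N; split=> //.
    - by lia.
    - by rewrite -!sideE !subnKC//; lia.
    - move=> j jb; rewrite -!sideE subnKC//; apply: h; lia.
  exists (m + t)%N; split.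
  - by apply/IH; split; [lia | rewrite addKn].
  - by lia.
  - by rewrite sideE -[in side s n](subnKC mn) sideE.
  - move=> j jb; rewrite -[in side s j](@subnKC m j) ?sideE; last by lia.
    by apply: h; lia.
case E : (cross s' l) => [n|] /=.
  by apply/H; rewrite addKn leq_addr.
case E' : (cross s (k + l)) => [n|//].
by move/H : E' => []; rewrite E.
Qed.

Lemma olt_omap m n o : olt (m + n) (omap (addn m) o) <-> olt n o.
Proof. by case: o => [t|] //=; rewrite ltn_add2l. Qed.

(** * Absorption, and its restart at a crossing time *)

Section Absorption.
Context {T : Type}.
Variable K : nat -> T -> R -> bool.
Implicit Types Uv : nat -> T.

Definition absorbed_at Uv s n := exists k t, cross s k = Some t /\
  (t <= n)%N /\ olt n (cross s k.+1) /\ K (n - t)%N (Uv k) (s n).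

(** The inequality between [T_k] and [tau] is weak, as in [V(x)], so the mark of the excursion that
    begins at [T_k] is not yet consulted. *)
Definition alive Uv s k m :=
  cross s k = Some m /\ ole (Some m) (absorb K Uv s).

Lemma aliveP Uv s k m : alive Uv s k m <->
  cross s k = Some m /\ forall j, (j < m)%N -> ~ absorbed_at Uv s j.
Proof. by rewrite /alive ole_first_time. Qed.

(** Here [k'] is the index of the excursion covering time [n], so comparing crossing times with [n]
    amounts to comparing indices with [k']. *)
Lemma cross_last s k m k' t n : cross s k = Some m -> cross s k' = Some t ->
  (t <= n)%N -> olt n (cross s k'.+1) -> ((k <= k') = (m <= n))%N.
Proof.
move=> ckm ck' tn on; case: leqP => [kk'|k'k].
  have [t0] := cross_mono _ _ _ _ kk' ck'; rewrite ckm => -[<-]; lia.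
have [t1 ck1 ?] := cross_mono _ _ _ _ k'k ckm.
by move: on; rewrite ck1/=; lia.
Qed.

Lemma absorbed_at_shift Uv s k m j : cross s k = Some m ->
  absorbed_at Uv s (m + j) <->
  absorbed_at (fun i => Uv (k + i)%N) (fun i => s (m + i)%N) j.
Proof.
move=> ckm; split=> [[k' [t [ck' [tm [om Km]]]]]|[l [t [cl [tj [oj Kj]]]]]].
  have kk' : (k <= k')%N by rewrite (cross_last _ _ _ _ _ _ ckm ck' tm om) leq_addr.
  move: ck' om Km; rewrite -(subnKC kk') -addnS !(cross_shift _ _ _ _ ckm).
  case cl : cross => [t'|//] /= [tE] om Km; exists (k' - k)%N, t'.
  rewrite cl; split=> //; split; first by lia.
  split; first by move/olt_omap : om.
  by move: Km; rewrite -tE subnDl.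
exists (k + l)%N, (m + t)%N; rewrite -addnS !(cross_shift _ _ _ _ ckm) cl/=.
split=> //; split; first by rewrite leq_add2l.
split; first exact/olt_omap.
by rewrite subnDl.
Qed.

Lemma absorb_shift_olt Uv s k m j : alive Uv s k m ->
  olt (m + j) (absorb K Uv s) <->
  olt j (absorb K (fun i => Uv (k + i)%N) (fun i => s (m + i)%N)).
Proof.
move=> /aliveP[ckm hm]; rewrite !olt_first_time; split=> h i ij.
  by move=> /(absorbed_at_shift _ _ _ _ _ ckm); apply: h; lia.
have [im|mi] := ltnP i m; first exact: hm.
by rewrite -(subnKC mi) => /(absorbed_at_shift _ _ _ _ _ ckm); apply: h; lia.
Qed.

Lemma alive_shift Uv s k m l j : alive Uv s k m ->
  alive Uv s (k + l) (m + j) <->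
  alive (fun i => Uv (k + i)%N) (fun i => s (m + i)%N) l j.
Proof.
move=> /aliveP[ckm hm]; rewrite !aliveP (cross_shift _ _ _ _ ckm).
split=> -[cl h]; split.
- by case: cross cl => [t|//] [] /= /addnI ->.
- by move=> i ij /(absorbed_at_shift _ _ _ _ _ ckm); apply: h; lia.
- by rewrite cl.
- move=> i ij; have [im|mi] := ltnP i m; first exact: hm.
  by rewrite -(subnKC mi) => /(absorbed_at_shift _ _ _ _ _ ckm); apply: h; lia.
Qed.

(** Absorption before [T_k] happens in an excursion of index less than [k], which uses only earlier
    marks. This makes survival up to [T_k] an event of the past in the splicing arguments below. *)
Lemma alive_local Uv Uv' s s' k m : (forall i, (i <= m)%N -> s i = s' i) ->
  (forall i, (i < k)%N -> Uv i = Uv' i) -> alive Uv s k m -> alive Uv' s' k m.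
Proof.
move=> ss' UU' /aliveP[ckm hm]; apply/aliveP.
have ckm' : cross s' k = Some m by exact: cross_eq_upto ckm.
split=> // j jm [k' [t [ck' [tj [oj Kj]]]]]; apply: (hm j jm).
have k'k : (k' < k)%N.
  by rewrite ltnNge (cross_last _ _ _ _ _ _ ckm' ck' tj oj) -ltnNge.
have ck : cross s k' = Some t.
  by apply: cross_eq_upto ck' => i it; rewrite ss'//; lia.
exists k', t; split=> //; split=> //; split; last by rewrite ss' ?UU'//; lia.
apply/(olt_crossS _ _ _ _ ck) => i ib.
rewrite /side !ss'; try lia.
by move/(olt_crossS _ _ _ _ ck') : oj; apply.
Qed.

Lemma alive_mono Uv s k k' m' : (k <= k')%N -> alive Uv s k' m' ->
  exists2 m, alive Uv s k m & (m <= m')%N.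
Proof.
move=> kk' /aliveP[ck' h]; have [t ck tm'] := cross_mono _ _ _ _ kk' ck'.
exists t; last by lia.
by apply/aliveP; split=> // j jt; apply: h; lia.
Qed.

(** A last crossing up to time [n] exists because [T_k >= k] leaves only the indices [k <= n]. *)
Lemma absorb_last_cross Uv s n : olt n (absorb K Uv s) ->
  exists k m, [/\ (k <= m)%N, (m <= n)%N, alive Uv s k m & olt n (cross s k.+1)].
Proof.
move=> on.
pose Pk k := `[< exists2 m, cross s k = Some m & (m <= n)%N >].
have P0 : exists k, Pk k by exists 0%N; apply/asboolP; exists 0%N.
have Pn k : Pk k -> (k <= n)%N.
  by move=> /asboolP[m /cross_ge km mn]; exact: leq_trans mn.
case: (ex_maxnP P0 Pn) => k /asboolP[m ckm mn] hmax.
exists k, m; split=> //; first exact: cross_ge ckm.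
  apply/aliveP; split=> // j jm; move/olt_first_time : on; apply.
  by rewrite ltnW// (leq_trans jm).
case E : (cross s k.+1) => [m'|//] /=; rewrite ltnNge; apply/negP => m'n.
by have := hmax k.+1; rewrite ltnn => h; apply/notF/h/asboolP; exists m'.
Qed.

End Absorption.

End Paths.

(** * The canonical space of i.i.d. sequences *)

Set Implicit Arguments.
Unset Strict Implicit.

Section CanonicalSpace.
Context {R : realType} {dT : measure_display} {T : measurableType dT}.

Definition coord_sets : set (set ((nat -> R) * (nat -> T))) :=
  [set A | (exists i (B : set R), measurable B /\ A = [set e | B (e.1 i)]) \/
           (exists i (B : set T), measurable B /\ A = [set e | B (e.2 i)])].

Definition canon : measurableType _ := g_sigma_algebraType coord_sets.

Lemma measurable_coord1 i : measurable_fun setT (fun e : canon => e.1 i).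
Proof.
by move=> _ B mB; rewrite setTI; apply: sub_sigma_algebra; left; exists i, B.
Qed.

Lemma measurable_coord2 i : measurable_fun setT (fun e : canon => e.2 i).
Proof.
by move=> _ B mB; rewrite setTI; apply: sub_sigma_algebra; right; exists i, B.
Qed.

Lemma measurable_to_canon d (Z : measurableType d) (f : Z -> canon) :
  (forall i, measurable_fun setT (fun z => (f z).1 i)) ->
  (forall i, measurable_fun setT (fun z => (f z).2 i)) ->
  measurable_fun setT f.
Proof.
move=> m1 m2; apply: (@measurability _ _ Z canon setT f coord_sets erefl).
move=> _ [_ [[i [B [mB ->]]]|[i [B [mB ->]]]] <-].
- exact: m1.
- exact: m2.
Qed.

Definition cyl (A : nat -> set R) (B : nat -> set T) : set canon :=
  [set e | (forall i, A i (e.1 i)) /\ (forall i, B i (e.2 i))].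

(** A pi-system that generates the sigma-algebra. Full sequences of sets with a tail of [setT] make
    intersections coordinatewise. *)
Definition cyl_sets : set (set canon) := [set C | exists N M A B,
  [/\ (forall i, measurable (A i)), (forall i, measurable (B i)),
      (forall i, (N <= i)%N -> A i = setT), (forall i, (M <= i)%N -> B i = setT)
    & C = cyl A B]].

Lemma cylE A B :
  cyl A B = (\bigcap_i [set e : canon | A i (e.1 i)]) `&`
            (\bigcap_i [set e : canon | B i (e.2 i)]).
Proof. by apply/seteqP; split=> e [h1 h2]; split=> i; [move=> _; exact: h1|move=> _; exact: h2|exact: h1|exact: h2]. Qed.

Lemma measurable_cyl A B : (forall i, measurable (A i)) ->
  (forall i, measurable (B i)) -> measurable (cyl A B).
Proof.
move=> mA mB; rewrite cylE; apply: measurableI; apply: bigcapT_measurable => i.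
  by rewrite -[X in measurable X]setTI; exact: measurable_coord1.
by rewrite -[X in measurable X]setTI; exact: measurable_coord2.
Qed.

Lemma cyl_sets_generate : (@measurable _ canon) = <<s cyl_sets >>.
Proof.
apply/seteqP; split=> [A|A].
  apply: smallest_sub; first exact: smallest_sigma_algebra.
  move=> _ [[i [B [mB ->]]]|[i [B [mB ->]]]]; apply: sub_sigma_algebra.
    exists i.+1, 0%N, (fun j => if j == i then B else setT), (fun _ => setT).
    split=> [j|//|j ij|//|]; first by case: eqP.
      by case: eqP ij => // ->; rewrite ltnn.
    apply/seteqP; split=> e /=; first by move=> Be; split=> // j; case: eqP => // ->.
    by move=> [/(_ i)]; rewrite eqxx.
  exists 0%N, i.+1, (fun _ => setT), (fun j => if j == i then B else setT).
  split=> [//|j|//|j ij|]; first by case: eqP.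
    by case: eqP ij => // ->; rewrite ltnn.
  apply/seteqP; split=> e /=; first by move=> Be; split=> // j; case: eqP => // ->.
  by move=> [_ /(_ i)]; rewrite eqxx.
apply: smallest_sub; first exact: sigma_algebra_measurable.
by move=> _ [N [M [A1 [B1 [mA mB _ _ ->]]]]]; exact: measurable_cyl.
Qed.

Lemma cyl_setsI : setI_closed cyl_sets.
Proof.
move=> _ _ [N [M [A [B [mA mB AN BM ->]]]]] [N' [M' [A' [B' [mA' mB' AN' BM' ->]]]]].
exists (maxn N N'), (maxn M M'), (fun i => A i `&` A' i), (fun i => B i `&` B' i).
split=> [i|i|i|i|]; [exact: measurableI|exact: measurableI| | |].
- by rewrite geq_max => /andP[? ?]; rewrite AN// AN'// setIT.
- by rewrite geq_max => /andP[? ?]; rewrite BM// BM'// setIT.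
- apply/seteqP; split=> e /=.
    by move=> [[h1 h2] [h3 h4]]; split=> i; split.
  by move=> [h1 h2]; split; split=> i; have [] := h1 i; have [] := h2 i.
Qed.

(** Steps and marks are cut at separate indices: at [T_k = m] the walk has used [m] steps but only
    [k] marks. *)
Definition splice m k (p : canon * canon) : canon :=
  ((fun i => if (i < m)%N then p.1.1 i else p.2.1 (i - m)%N),
   (fun i => if (i < k)%N then p.1.2 i else p.2.2 (i - k)%N)).

Lemma measurable_splice m k : measurable_fun setT (splice m k).
Proof.
apply: measurable_to_canon => i /=; case: ltnP => _.
- exact: (measurableT_comp (measurable_coord1 i) measurable_fst).
- exact: (measurableT_comp (measurable_coord1 _) measurable_snd).
- exact: (measurableT_comp (measurable_coord2 i) measurable_fst).
- exact: (measurableT_comp (measurable_coord2 _) measurable_snd).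
Qed.

HB.instance Definition _ m k :=
  isMeasurableFun.Build _ _ _ _ (splice m k) (measurable_splice m k).

Local Open Scope ereal_scope.

Definition iid_law (lam : probability canon R) := forall N M A B,
  (forall i, measurable (A i)) -> (forall i, measurable (B i)) ->
  (forall i, (N <= i)%N -> A i = setT) -> (forall i, (M <= i)%N -> B i = setT) ->
  lam (cyl A B) = (\prod_(i < N) lam [set e | A i (e.1 0%N)]) *
                  (\prod_(i < M) lam [set e | B i (e.2 0%N)]).

Variable lam : probability canon R.
Hypothesis lam_iid : iid_law lam.

(** It suffices to compare both measures on cylinders, where the preimage under [splice] is a
    rectangle of cylinders and the products over coordinates regroup at [m] and [k]. *)
Lemma splice_law m k (D : set canon) : measurable D ->
  lam D = pushforward (lam \x lam) (splice m k) D.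
Proof.
apply: (@measure_unique _ _ _ cyl_sets (fun=> setT) cyl_sets_generate cyl_setsI).
- move=> _; exists 0%N, 0%N, (fun=> setT), (fun=> setT); split=> //.
  by apply/seteqP; split.
- by rewrite bigcup_const//; exists 0%N.
- move=> _ [N [M [A [B [mA mB AN BM ->]]]]].
  pose A1 i := if (i < m)%N then A i else setT.
  pose B1 i := if (i < k)%N then B i else setT.
  have mA1 i : measurable (A1 i) by rewrite /A1; case: ifP.
  have mB1 i : measurable (B1 i) by rewrite /B1; case: ifP.
  pose A2 i := A (m + i)%N; pose B2 i := B (k + i)%N.
  rewrite /= /pushforward.
  have -> : splice m k @^-1` cyl A B = cyl A1 B1 `*` cyl A2 B2.
    apply/seteqP; split=> -[e e'] /=; rewrite /cyl/= /A1 /B1 /A2 /B2.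
      move=> [h1 h2]; split; split=> i.
      - by case: ifP => // im; have := h1 i; rewrite im.
      - by case: ifP => // im; have := h2 i; rewrite im.
      - by have := h1 (m + i)%N; rewrite ltnNge leq_addr /= addKn.
      - by have := h2 (k + i)%N; rewrite ltnNge leq_addr /= addKn.
    move=> [[h1 h2] [h3 h4]]; split=> i; case: ltnP => im.
    - by have := h1 i; rewrite im.
    - by have := h3 (i - m)%N; rewrite subnKC.
    - by have := h2 i; rewrite im.
    - by have := h4 (i - k)%N; rewrite subnKC.
  rewrite product_measure1E; [|exact: measurable_cyl|].
    2: by apply: measurable_cyl => i; [exact: mA|exact: mB].
  suff : lam (cyl A B) = lam (cyl A1 B1) * lam (cyl A2 B2) by [].
  rewrite (@lam_iid (m + N)%N (k + M)%N A B mA mB); last 2 first.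
  - by move=> i mi; apply: AN; lia.
  - by move=> i mi; apply: BM; lia.
  rewrite (@lam_iid m k A1 B1 mA1 mB1); last 2 first.
  - by move=> i mi; rewrite /A1 ltnNge mi.
  - by move=> i mi; rewrite /B1 ltnNge mi.
  rewrite (@lam_iid N M A2 B2); last 4 first.
  - by move=> i; exact: mA.
  - by move=> i; exact: mB.
  - by move=> i mi; apply: AN; lia.
  - by move=> i mi; apply: BM; lia.
  rewrite !big_split_ord/= muleACA; congr ((_ * _) * (_ * _)).
  + by apply: eq_bigr => i _; rewrite /A1 ltn_ord.
  + by apply: eq_bigr => i _; rewrite /B1 ltn_ord.
- by move=> _; suff : lam setT < +oo by []; rewrite probability_setT ltry.
Qed.

(* The Markov property at a deterministic pair of indices: the first [m] steps
   and [k] marks are independent of the remaining ones, which have law [lam]. *)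
Lemma integral_splice m k (F : canon -> \bar R) : measurable_fun setT F ->
  (forall e, 0 <= F e) ->
  \int[lam]_e F e = \int[lam]_e \int[lam]_e' F (splice m k (e, e')).
Proof.
move=> mF F0.
rewrite (eq_measure_integral (pushforward (lam \x lam) (splice m k))); last first.
  by move=> A mA _; exact: splice_law.
rewrite ge0_integral_pushforward//.
rewrite preimage_setT fubini_tonelli1//; last by move=> x; exact: F0.
exact: (measurableT_comp mF (measurable_splice m k)).
Qed.

End CanonicalSpace.
Arguments canon : clear implicits.
Arguments canon R {dT} T.

(** * Lyapunov functions for a centred step with finite variance *)

Section Lyapunov.
Context {R : realType} {d : measure_display} {Om : measurableType d}.
Variables (P : probability Om R) (Y : Om -> R).
Hypothesis mY : measurable_fun setT Y.
Implicit Types x y z b s : R.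

Local Open Scope ereal_scope.

Definition nnmeas (f : R -> \bar R) :=
  measurable_fun setT f /\ forall z, 0 <= f z.

Definition step (f : R -> \bar R) (z : R) : \bar R := \int[P]_w f (z + Y w)%R.

Lemma nnmeas_step_fun f z : nnmeas f -> measurable_fun setT (fun w => f (z + Y w)%R).
Proof.
move=> [mf _]; apply: (measurableT_comp mf).
exact: measurable_funD.
Qed.

Lemma nnmeasD f g : nnmeas f -> nnmeas g -> nnmeas (fun z => f z + g z).
Proof.
move=> [mf f0] [mg g0]; split=> [|z]; first exact: emeasurable_funD.
by rewrite adde_ge0.
Qed.

Lemma nnmeasZ (c : R) f : (0 <= c)%R -> nnmeas f -> nnmeas (fun z => c%:E * f z).
Proof.
move=> c0 [mf f0]; split=> [|z]; first exact: measurable_funeM.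
by rewrite mule_ge0// lee_fin.
Qed.

Lemma nnmeas_EFin (f : R -> R) : measurable_fun setT f -> (forall z, 0 <= f z)%R ->
  nnmeas (fun z => (f z)%:E).
Proof. by move=> mf f0; split=> [|z]; [exact/measurable_EFinP|rewrite lee_fin]. Qed.

Lemma nnmeas_sum (I : Type) (r : seq I) (f : I -> R -> \bar R) :
  (forall i, nnmeas (f i)) -> nnmeas (fun z => \sum_(i <- r) f i z).
Proof.
move=> hf; elim: r => [|i r IH].
  by under eq_fun do rewrite big_nil; split.
under eq_fun do rewrite big_cons; exact: nnmeasD.
Qed.

Lemma nnmeas_if (b : pred R) f : measurable_fun setT b -> nnmeas f ->
  nnmeas (fun z => if b z then f z else 0).
Proof.
move=> mb [mf f0]; split=> [|z]; last by case: ifP.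
by apply: measurable_fun_ifT.
Qed.

Lemma step_ge0 f z : nnmeas f -> 0 <= step f z.
Proof. by move=> [_ f0]; apply: integral_ge0. Qed.

Lemma stepD f g z : nnmeas f -> nnmeas g ->
  step (fun y => f y + g y) z = step f z + step g z.
Proof.
move=> hf hg; rewrite /step ge0_integralD//; try exact: nnmeas_step_fun.
  by move=> w _; apply: hf.2.
by move=> w _; apply: hg.2.
Qed.

Lemma stepZ (c : R) f z : (0 <= c)%R -> nnmeas f ->
  step (fun y => c%:E * f y) z = c%:E * step f z.
Proof.
move=> c0 hf; rewrite /step ge0_integralZl//; first exact: nnmeas_step_fun.
by move=> w _; apply: hf.2.
Qed.

Lemma step_le f g z : nnmeas f -> nnmeas g -> (forall y, f y <= g y) ->
  step f z <= step g z.
Proof.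
move=> hf hg fg; apply: ge0_le_integral => //; try exact: nnmeas_step_fun.
by move=> w _; apply: hf.2.
Qed.

Lemma step_sum (I : Type) (r : seq I) (f : I -> R -> \bar R) z :
  (forall i, nnmeas (f i)) ->
  step (fun y => \sum_(i <- r) f i y) z = \sum_(i <- r) step (f i) z.
Proof.
move=> hf; rewrite /step ge0_integral_sum// => i; first exact: nnmeas_step_fun.
by move=> w _; apply: (hf i).2.
Qed.

Lemma step_cst (c : R) z : step (fun=> c%:E) z = c%:E.
Proof. by rewrite /step integral_cst//= probability_setT mule1. Qed.

Definition pospart (z : R) : R := Num.max 0%R z.
Definition negpart (z : R) : R := Num.max 0%R (- z)%R.

Lemma measurable_pospart : measurable_fun setT pospart.
Proof. exact: measurable_maxr. Qed.

Lemma measurable_negpart : measurable_fun setT negpart.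
Proof. exact: measurable_maxr. Qed.

Lemma pospart_ge0 z : (0 <= pospart z)%R.
Proof. by rewrite le_max lexx. Qed.

Lemma negpart_ge0 z : (0 <= negpart z)%R.
Proof. by rewrite le_max lexx. Qed.

Lemma nnmeas_negpart : nnmeas (fun z => (negpart z)%:E).
Proof. by apply: nnmeas_EFin; [exact: measurable_negpart|exact: negpart_ge0]. Qed.

Lemma nnmeas_pospart : nnmeas (fun z => (pospart z)%:E).
Proof. by apply: nnmeas_EFin; [exact: measurable_pospart|exact: pospart_ge0]. Qed.

(** The mean undershoot of one step: it is the drift of the positive part and the only error term in
    the drift estimates below. *)
Definition psi := step (fun z => (negpart z)%:E).

Hypothesis iY : P.-integrable setT (EFin \o Y).
Hypothesis EY0 : \int[P]_w (Y w)%:E = 0.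

Lemma psi_fin z : psi z \is a fin_num.
Proof.
have iz : P.-integrable setT (fun w => (z + Y w)%:E).
  under eq_fun do rewrite EFinD.
  by apply: integrableD => //; apply: finite_measure_integrable_cst.
have /fin_numPlt/andP[] : psi z \is a fin_num; last by move=> ? ?; exact/fin_numPlt/andP.
rewrite ge0_fin_numE; last exact: step_ge0 nnmeas_negpart.
move/integrableP : iz => [miz]; apply: le_lt_trans.
apply: ge0_le_integral => //.
- by move=> w _; rewrite lee_fin negpart_ge0.
- exact: nnmeas_step_fun nnmeas_negpart.
- exact: measurableT_comp.
- move=> w _ /=; rewrite lee_fin /negpart ge_max normr_ge0/= -normrN.
  exact: ler_norm.
Qed.

Lemma psi_ge0 z : 0 <= psi z.
Proof. exact: step_ge0 nnmeas_negpart. Qed.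

Lemma psi_le (z z' : R) : (z <= z')%R -> psi z' <= psi z.
Proof.
move=> zz'; apply: ge0_le_integral => //; try exact: nnmeas_step_fun nnmeas_negpart.
  by move=> w _; rewrite lee_fin negpart_ge0.
move=> w _; rewrite lee_fin /negpart ge_max !le_max lexx/=.
by rewrite (_ : - (z' + Y w) <= - (z + Y w))%R ?orbT//; lra.
Qed.

(** The positive part of a number is the number plus its negative part, and [Y] has mean zero. *)
Lemma step_pospart z : step (fun y => (pospart y)%:E) z = z%:E + psi z.
Proof.
have iz : P.-integrable setT (fun w => (z + Y w)%:E).
  under eq_fun do rewrite EFinD.
  by apply: integrableD => //; apply: finite_measure_integrable_cst.
have ip : P.-integrable setT (fun w => (negpart (z + Y w))%:E).
  apply/integrableP; split; first exact: nnmeas_step_fun nnmeas_negpart.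
  rewrite (eq_integral (fun w => (negpart (z + Y w))%:E)); last first.
    by move=> w _; rewrite gee0_abs// lee_fin negpart_ge0.
  by have := psi_fin z; rewrite ge0_fin_numE// psi_ge0.
have -> : step (fun y => (pospart y)%:E) z =
    \int[P]_w ((z + Y w)%:E + (negpart (z + Y w))%:E).
  apply: eq_integral => w _; rewrite -EFinD; congr EFin.
  by rewrite /pospart /negpart; case: (lerP 0 (z + Y w)%R) => h; case: (lerP 0 (- (z + Y w))%R); lra.
rewrite integralD//; congr (_ + _).
under eq_integral do rewrite EFinD.
rewrite integralD//; last exact: finite_measure_integrable_cst.
by rewrite integral_cst//= probability_setT mule1 EY0 adde0.
Qed.

Variables (a q : R).
Hypotheses (a0 : (0 < a)%R) (q0 : (0 < q)%R).
Hypothesis Pa : q%:E <= P [set w | (Y w <= - (2 * a))%R].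

Let mdown : measurable [set w | (Y w <= - (2 * a))%R].
Proof.
rewrite -[X in measurable X]setTI.
exact: (mY measurableT (measurable_itv `]-oo, (- (2 * a))%R])).
Qed.

(** Concave on the half-line with a kink at [b]: the drift is at most that of the positive part, and
    just above the kink it is strictly better. *)
Definition cap (b z : R) : R := Num.min b (pospart z).

Lemma nnmeas_cap b : (0 <= b)%R -> nnmeas (fun z => (cap b z)%:E).
Proof.
move=> b0; apply: nnmeas_EFin => [|z].
  by apply: measurable_minr => //; exact: measurable_pospart.
by rewrite le_min b0 pospart_ge0.
Qed.

Lemma step_cap (b z : R) : (0 <= b)%R -> (0 <= z)%R ->
  step (fun y => (cap b y)%:E) z <= (cap b z)%:E + psi z.
Proof.
move=> b0 z0; have zE : pospart z = z by exact/max_idPr.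
rewrite /cap zE; have [bz|zb] := lerP b z.
  apply: (@le_trans _ _ b%:E); last by rewrite leeDl// psi_ge0.
  rewrite -[leRHS](step_cst b z); apply: step_le.
  - exact: nnmeas_cap.
  - exact: nnmeas_EFin.
  - by move=> y; rewrite lee_fin ge_min lexx.
rewrite -step_pospart; apply: step_le.
- exact: nnmeas_cap.
- exact: nnmeas_pospart.
- by move=> y; rewrite lee_fin ge_min lexx orbT.
Qed.

(* At [z] just above the kink [b] a jump of size [2a] downwards brings [cap b]
   down by at least [a]. *)
Lemma step_cap_drop (b z : R) : (a <= b)%R -> (b <= z)%R -> (z < b + a)%R ->
  step (fun y => (cap b y)%:E) z + (a * q)%:E <= (cap b z)%:E.
Proof.
move=> ab bz zb; have b0 : (0 <= b)%R by apply: le_trans ab; exact: ltW.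
have zE : cap b z = b.
  by rewrite /cap /pospart; apply/min_idPl; rewrite le_max bz orbT.
rewrite zE; set D := [set w | (Y w <= - (2 * a))%R].
have h1 : (a * q)%:E <= \int[P]_w (a * \1_D w)%:E.
  under eq_integral do rewrite EFinM.
  rewrite ge0_integralZl//; first last.
  - by rewrite lee_fin ltW.
  - exact/measurable_EFinP/measurable_indic.
  rewrite integral_indic// setIT EFinM lee_pmul2l//; by rewrite lte_fin.
apply: (le_trans (leeD (lexx _) h1)).
rewrite -ge0_integralD//; first last.
- by apply/measurable_EFinP/measurable_funM => //; exact: measurable_indic.
- by move=> w _; rewrite lee_fin mulr_ge0// ltW.
- exact: nnmeas_step_fun (nnmeas_cap b0).
- by move=> w _; apply: (nnmeas_cap b0).2.
rewrite -[leRHS](step_cst b z); apply: ge0_le_integral => //.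
- move=> w _; apply: adde_ge0; first exact: (nnmeas_cap b0).2.
  by rewrite lee_fin mulr_ge0// ltW.
- apply: emeasurable_funD; first exact: nnmeas_step_fun (nnmeas_cap b0).
  by apply/measurable_EFinP/measurable_funM => //; exact: measurable_indic.
- move=> w _; rewrite -EFinD lee_fin /cap indicE.
  have [/set_mem Dw|_] := boolP (w \in D); last by rewrite mulr0 addr0 ge_min lexx.
  rewrite mulr1 -lerBrDr ge_min; apply/orP; right.
  rewrite /D/= in Dw; rewrite /pospart ge_max; apply/andP; split; lra.
Qed.

(** A concave piecewise linear function on the half-line whose slope falls by [c k] at the kink
    [a * k]; its slope is at most the sum of the [c k]. *)
Definition capsum (c : nat -> R) (z : R) : \bar R :=
  \sum_(0 <= k <oo) (c k)%:E * (cap (a * k%:R) z)%:E.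

Section capsum.
Variable c : nat -> R.
Hypothesis c0 : forall k, (0 <= c k)%R.
Let ak0 k : (0 <= a * k%:R)%R. Proof. by rewrite mulr_ge0// ltW. Qed.
Let nnck k : nnmeas (fun z => (c k)%:E * (cap (a * k%:R) z)%:E).
Proof. exact: nnmeasZ (nnmeas_cap _). Qed.

Lemma nnmeas_capsum : nnmeas (capsum c).
Proof.
split=> [|z]; last by apply: nneseries_ge0 => k _ _; exact: (nnck k).2.
rewrite /capsum; under eq_fun do rewrite (eq_eseriesl _ (P := xpredT) (Q := fun i => i \in predT))//.
by apply: ge0_emeasurable_sum => [k z _ _|k _]; [exact: (nnck k).2|exact: (nnck k).1].
Qed.

Lemma capsum_le (s z : R) : \sum_(0 <= k <oo) (c k)%:E <= s%:E ->
  capsum c z <= (s * pospart z)%:E.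
Proof.
move=> cs; rewrite EFinM muleC.
apply: (@le_trans _ _ ((pospart z)%:E * \sum_(0 <= k <oo) (c k)%:E)); last first.
  by apply: lee_wpmul2l => //; rewrite lee_fin pospart_ge0.
rewrite -nneseriesZl; last by move=> k _; rewrite lee_fin.
apply: lee_nneseries => [k _ _|k _]; first exact: (nnck k).2.
rewrite muleC lee_wpmul2r ?lee_fin//.
by rewrite ge_min lexx orbT.
Qed.

Lemma step_capsum (s z : R) : (0 <= z)%R -> \sum_(0 <= k <oo) (c k)%:E <= s%:E ->
  step (capsum c) z <= capsum c z + s%:E * psi z.
Proof.
move=> z0 cs; rewrite /step /capsum integral_nneseries//; first last.
- by move=> k w _; apply: (nnck k).2.
- by move=> k; exact: (nnmeas_step_fun z (nnck k)).
apply: (@le_trans _ _ (\sum_(0 <= k <oo) ((c k)%:E * (cap (a * k%:R) z)%:E +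
    (c k)%:E * psi z))).
  apply: lee_nneseries => [k _ _|k _].
    by apply: integral_ge0 => w _; apply: (nnck k).2.
  rewrite -[X in X <= _]/(step (fun y => (c k)%:E * (cap (a * k%:R) y)%:E) z).
  rewrite stepZ//; last exact: nnmeas_cap.
  rewrite -muleDr ?fin_num_adde_defr//; apply: lee_wpmul2l; first by rewrite lee_fin.
  exact: step_cap.
rewrite nneseriesD; first last.
- by move=> k _ _; rewrite mule_ge0 ?lee_fin// psi_ge0.
- by move=> k _ _; apply: (nnck k).2.
apply: leeD => //; rewrite -(fineK (psi_fin z)).
under eq_eseriesr do rewrite muleC.
rewrite nneseriesZl; last by move=> k _; rewrite lee_fin.
by rewrite muleC lee_wpmul2r// lee_fin fine_ge0// psi_ge0.
Qed.

(** The kink [k0] just below [z] yields the gain, while every term of the sum costs at most [c k]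
    times [psi z]. *)
Lemma step_capsum_drop (s z : R) k0 : (0 <= z)%R -> \sum_(0 <= k <oo) (c k)%:E <= s%:E ->
  (0 < k0)%N -> (a * k0%:R <= z)%R -> (z < a * k0%:R + a)%R ->
  step (capsum c) z + (c k0 * (a * q))%:E <= capsum c z + s%:E * psi z.
Proof.
move=> z0 cs k00 kz zk.
have ak : (a <= a * k0%:R)%R by rewrite ler_peMr ?ler1n// ltW.
rewrite /step /capsum integral_nneseries//; first last.
- by move=> k w _; apply: (nnck k).2.
- by move=> k; exact: (nnmeas_step_fun z (nnck k)).
apply: (@le_trans _ _ (\sum_(0 <= k <oo) ((c k)%:E * (cap (a * k%:R) z)%:E +
    (c k)%:E * psi z))); last first.
  rewrite nneseriesD; first last.
  - by move=> k _ _; rewrite mule_ge0 ?lee_fin// psi_ge0.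
  - by move=> k _ _; apply: (nnck k).2.
  apply: leeD => //; rewrite -(fineK (psi_fin z)).
  under eq_eseriesr do rewrite muleC.
  rewrite nneseriesZl; last by move=> k _; rewrite lee_fin.
  by rewrite muleC lee_wpmul2r// lee_fin fine_ge0// psi_ge0.
rewrite (nneseriesD1 (n := k0))//; last first.
  by move=> k _; apply: integral_ge0 => w _; apply: (nnck k).2.
rewrite [leRHS](nneseriesD1 (n := k0))//; last first.
  move=> k _; apply: adde_ge0; first exact: (nnck k).2.
  by rewrite mule_ge0 ?lee_fin// psi_ge0.
have stepE k : \int[P]_w ((c k)%:E * (cap (a * k%:R) (z + Y w))%:E) =
    (c k)%:E * step (fun y => (cap (a * k%:R) y)%:E) z.
  by rewrite -stepZ//; exact: nnmeas_cap.
rewrite addeAC; apply: leeD; last first.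
  apply: lee_nneseries => [k _ _|k _].
    by apply: integral_ge0 => w _; apply: (nnck k).2.
  rewrite stepE -muleDr ?fin_num_adde_defr//; apply: lee_wpmul2l; first by rewrite lee_fin.
  exact: step_cap.
rewrite stepE EFinM -muleDr ?fin_num_adde_defl//.
apply: (@le_trans _ _ ((c k0)%:E * (cap (a * k0%:R) z)%:E)); last first.
  by rewrite leeDl// mule_ge0 ?lee_fin// psi_ge0.
by apply: lee_wpmul2l; [rewrite lee_fin|exact: step_cap_drop].
Qed.

End capsum.

(** * A bounded function with drift at most -1 on [[0, B)] *)

Section bounded_lyapunov.
Variable B : R.
Hypothesis B0 : (0 <= B)%R.

(** The rate solves [expR (lyap_rate * (2 * a)) = 2 / q]. From [[0, B)] a downward jump of at least
    [2 * a], of probability at least [q], multiplies [lyap_drop] by at least [2 / q]; hence its mean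
    at least doubles, a gain of at least 1 since [lyap_drop >= 1]. *)
Definition lyap_rate : R := (ln (2 / q) / (2 * a))%R.
(** The cut at [- (2 * a)] bounds the function without spoiling the gain, because a jump of exactly
    [2 * a] from [z >= 0] does not land below the cut. *)
Definition lyap_drop (z : R) : R :=
  expR (lyap_rate * Num.max 0 (B - Num.max z (- (2 * a))))%R.
Definition lyap_top : R := expR (lyap_rate * (B + 2 * a))%R.
Definition lyap_near (z : R) : R := (lyap_top - lyap_drop z)%R.

Lemma q_le1 : (q <= 1)%R.
Proof. by rewrite -lee_fin; apply: le_trans Pa _; exact: probability_le1. Qed.

Lemma lyap_rate_ge0 : (0 <= lyap_rate)%R.
Proof.
rewrite divr_ge0 ?ln_ge0//; last by rewrite mulr_ge0// ltW.
by rewrite ler_pdivlMr// mul1r; have := q_le1; lra.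
Qed.

Lemma lyap_drop_ge1 z : (1 <= lyap_drop z)%R.
Proof.
rewrite -expR0 ler_expR mulr_ge0 ?lyap_rate_ge0//.
by rewrite le_max lexx.
Qed.

Lemma lyap_drop_le z : (lyap_drop z <= lyap_top)%R.
Proof.
rewrite ler_expR ler_wpM2l ?lyap_rate_ge0// ge_max.
have := a0; have : (- (2 * a) <= Num.max z (- (2 * a)))%R by rewrite le_max lexx orbT.
by move=> h1 h2; apply/andP; split; have := B0; lra.
Qed.

Lemma measurable_lyap_drop : measurable_fun setT lyap_drop.
Proof.
rewrite /lyap_drop; apply: measurableT_comp => //.
apply: measurable_funM => //; apply: measurable_maxr => //.
by apply: measurable_funB => //; exact: measurable_maxr.
Qed.

Lemma nnmeas_lyap_drop : nnmeas (fun z => (lyap_drop z)%:E).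
Proof. by apply: nnmeas_EFin; [exact: measurable_lyap_drop|move=> z; exact: expR_ge0]. Qed.

Lemma nnmeas_lyap_near : nnmeas (fun z => (lyap_near z)%:E).
Proof.
apply: nnmeas_EFin; last by move=> z; rewrite subr_ge0 lyap_drop_le.
by apply: measurable_funB => //; exact: measurable_lyap_drop.
Qed.

Lemma step_lyap_nearE z :
  step (fun y => (lyap_near y)%:E) z + step (fun y => (lyap_drop y)%:E) z = lyap_top%:E.
Proof.
rewrite -stepD; [|exact: nnmeas_lyap_near|exact: nnmeas_lyap_drop].
rewrite -[RHS](step_cst lyap_top z); apply: eq_integral => w _.
by rewrite -EFinD /lyap_near subrK.
Qed.

Lemma step_lyap_near z : (0 <= z)%R -> (z < B)%R ->
  step (fun y => (lyap_near y)%:E) z + 1 <= (lyap_near z)%:E.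
Proof.
move=> z0 zB; set D := [set w | (Y w <= - (2 * a))%R].
have h : (lyap_drop z + 1)%:E <= step (fun y => (lyap_drop y)%:E) z.
  apply: (@le_trans _ _ (\int[P]_w ((lyap_drop z * (2 / q))%:E * (\1_D w)%:E))).
    rewrite ge0_integralZl//; first last.
    - by rewrite lee_fin !mulr_ge0// ?expR_ge0// invr_ge0 ltW.
    - exact/measurable_EFinP/measurable_indic.
    rewrite integral_indic// setIT.
    apply: (@le_trans _ _ ((lyap_drop z * (2 / q))%:E * q%:E)).
      rewrite -EFinM lee_fin mulrA mulfVK ?gt_eqF//.
      by have := lyap_drop_ge1 z; lra.
    by rewrite lee_wpmul2l// lee_fin !mulr_ge0// ?expR_ge0// invr_ge0 ltW.
  apply: ge0_le_integral => //.
  - by move=> w _; rewrite mule_ge0// lee_fin !mulr_ge0// ?expR_ge0// invr_ge0 ltW.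
  - by apply: measurable_funeM; exact/measurable_EFinP/measurable_indic.
  - exact: nnmeas_step_fun nnmeas_lyap_drop.
  - move=> w _; rewrite -EFinM lee_fin indicE.
    have [/set_mem Dw|_] := boolP (w \in D); last by rewrite mulr0 expR_ge0.
    have e2 : (2 / q = expR (lyap_rate * (2 * a)))%R.
      rewrite /lyap_rate mulfVK ?lnK// ?posrE ?divr_gt0//.
      by rewrite gt_eqF// mulr_gt0.
    rewrite mulr1 e2 -expRD ler_expR -mulrDr ler_wpM2l ?lyap_rate_ge0//.
    rewrite /D/= in Dw; have ha := a0.
    have h1 : (- (2 * a) <= z)%R by lra.
    have h2 : (0 <= B - z)%R by lra.
    rewrite le_max (max_idPl h1) (max_idPr h2); apply/orP; right; rewrite lerBrDr -lerBrDl ge_max; apply/andP; split; lra.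
have := step_lyap_nearE z.
have : 0 <= step (fun y => (lyap_near y)%:E) z by apply: step_ge0 nnmeas_lyap_near.
case: (step (fun y => (lyap_near y)%:E) z) => [s1 _|_|//]; last first.
  by case: (step _ z) h.
move: h; case: (step _ z) => [s2| |]; rewrite ?addey// => h [hE].
by move: h; rewrite -EFinD !lee_fin /lyap_near -hE; lra.
Qed.

(** For [z >= B] the function [lyap_near] is already at its maximum. *)
Lemma step_lyap_near_le z : (0 <= z)%R ->
  step (fun y => (lyap_near y)%:E) z <= (lyap_near z)%:E.
Proof.
move=> z0; have [zB|Bz] := ltP z B.
  by apply: le_trans (step_lyap_near z0 zB); rewrite leeDl.
have d1 : lyap_drop z = 1%R.
  rewrite /lyap_drop -[RHS]expR0; congr expR.
  rewrite (_ : Num.max 0%R _ = 0%R) ?mulr0//; apply/max_idPl.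
  by rewrite subr_le0 le_max Bz.
rewrite -[leRHS](step_cst (lyap_near z) z); apply: step_le.
- exact: nnmeas_lyap_near.
- by apply: nnmeas_EFin => // y; rewrite subr_ge0 lyap_drop_le.
- by move=> y; rewrite lee_fin /lyap_near d1 lerB// lyap_drop_ge1.
Qed.

End bounded_lyapunov.

(** * Mean overshoot and survival probability on the half-line *)

Hypothesis Y2 : \int[P]_w (Y w ^+ 2)%:E < +oo.

(** Summation over the grid integrates the undershoot once: for each value of [Y] the sum is at most
    [((a - Y)^+)^2 / (2 a)], which has finite mean. *)
Lemma psi_summable : \sum_(0 <= k <oo) psi (a * k%:R) < +oo.
Proof.
rewrite /psi /step -integral_nneseries//; first last.
- by move=> n w _; rewrite lee_fin negpart_ge0.
- by move=> n; exact: nnmeas_step_fun nnmeas_negpart.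
pose bnd w := ((a ^+ 2 + Y w ^+ 2) / a)%R.
have bnd0 w : (0 <= bnd w)%R by rewrite divr_ge0 ?addr_ge0 ?sqr_ge0// ltW.
have mY2 : measurable_fun setT (fun w => Y w ^+ 2)%R by exact: measurable_funX.
apply: (@le_lt_trans _ _ (\int[P]_w (bnd w)%:E)).
  apply: ge0_le_integral => //.
  - by move=> w _; apply: nneseries_ge0 => k _ _; rewrite lee_fin negpart_ge0.
  - under eq_fun do rewrite (eq_eseriesl _ (P := xpredT) (Q := fun i => i \in predT))//.
    apply: ge0_emeasurable_sum => [k w _ _|k _]; first by rewrite lee_fin negpart_ge0.
    exact: nnmeas_step_fun nnmeas_negpart.
  - apply/measurable_EFinP/measurable_funM => //; exact: measurable_funD.
  move=> w _; apply: lime_le.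
    by apply: is_cvg_nneseries => k _ _; rewrite lee_fin negpart_ge0.
  apply: nearW => n; rewrite sumEFin lee_fin big_mkord.
  (* Each step is [2 a t^+ <= ((t + a)^+)^2 - (t^+)^2] with [t = - (a n + Y)]. *)
  have telescope : (2 * a * (\sum_(k < n) negpart (a * k%:R + Y w)) <=
      (pospart (a - Y w)) ^+ 2 - (pospart (a - Y w - a * n%:R)) ^+ 2)%R.
    elim: n => [|n IH]; first by rewrite big_ord0 !mulr0 subr0 subrr.
    rewrite big_ord_recr/= mulrDr.
    rewrite (_ : a - Y w - a * n.+1%:R = - (a * n%:R + Y w))%R; last first.
      by rewrite -[n.+1%:R]natr1; ring.
    move: IH; rewrite (_ : a - Y w - a * n%:R = - (a * n%:R + Y w) + a)%R; last by ring.
    set t := (- (_ + _))%R; set S := (\sum_(_ < _) _)%R => IH.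
    rewrite /negpart -/t; have := a0.
    move: IH; rewrite /pospart; set p := Num.max 0%R (a - Y w)%R.
    case: (lerP 0 t) => t0; case: (lerP 0 (t + a)%R) => ta IH ha; nra.
  have [sq1 sq2] : (0 <= (pospart (a - Y w - a * n%:R)) ^+ 2)%R /\
      ((pospart (a - Y w)) ^+ 2 <= 2 * (a ^+ 2 + Y w ^+ 2))%R.
    split; first exact: sqr_ge0.
    have := sqr_ge0 (a + Y w)%R; have := sqr_ge0 a; have := sqr_ge0 (Y w).
    rewrite !expr2 /pospart; move: (Y w) => t h1 h2 h3.
    by case: (lerP 0 (a - t)%R) => _; lra.
  rewrite /bnd ler_pdivlMr//; move: telescope sq1 sq2.
  by set S := (\sum_(_ < _) _)%R; lra.
under eq_integral do rewrite /bnd mulrC EFinM EFinD.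
rewrite ge0_integralZl//; first last.
- by rewrite lee_fin invr_ge0 ltW.
- by move=> w _; rewrite -EFinD lee_fin addr_ge0// sqr_ge0.
- by apply: emeasurable_funD => //; exact/measurable_EFinP.
rewrite ge0_integralD//; first last.
- exact/measurable_EFinP.
- by move=> w _; rewrite lee_fin sqr_ge0.
- by move=> w _; rewrite lee_fin sqr_ge0.
rewrite integral_cst//= probability_setT mule1.
move: Y2; have : 0 <= \int[P]_w (Y w ^+ 2)%:E.
  by apply: integral_ge0 => w _; rewrite lee_fin sqr_ge0.
by case: (\int[P]_w _) => // r _ _; rewrite -EFinD -EFinM ltry.
Qed.

(** The weights of the kinks are proportional to [psi] there, so each kink pays for [2 psi]: one
    [psi] covers the drift error of [capsum], the other is the claimed decrease. Placing the kinks
    far out makes the slope small; on the remaining interval a bounded function takes over. *)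
Lemma lyapunov_overshoot (eps : R) : (0 < eps)%R -> exists (L : R -> \bar R) (C : R),
  [/\ nnmeas L, (0 <= C)%R,
      (forall z, (0 <= z)%R -> L z <= (eps * z + C)%:E)
    & (forall z, (0 <= z)%R -> step L z + psi z <= L z)].
Proof.
(* This makes the gain [c k * (a * q)] equal to [2 * psi (a * k)]. *)
move=> eps0; pose kap := (2 / (q * a))%R.
have kap0 : (0 < kap)%R by rewrite divr_gt0// mulr_gt0.
(* A total weight at most [eps] gives the slope, and at most 1 keeps the error [s * psi] below
   [psi]. *)
pose s := Num.min eps 1%R.
have s0 : (0 < s)%R by rewrite lt_min eps0 ltr01.
have [A A0 hA] : exists2 A, (0 < A)%N &
    \sum_(A <= k <oo) psi (a * k%:R) <= (s / kap)%:E.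
  have /fine_cvgP[] := nneseries_tail_cvg psi_summable (fun k _ => psi_ge0 (a * k%:R)).
  move=> tail_fin /cvgrPdist_lt /(_ _ (divr_gt0 s0 kap0)) tail_lt.
  near \oo => A; exists A; first by near: A; exact: nbhs_infty_gt.
  have tf : \sum_(A <= k <oo) psi (a * k%:R) \is a fin_num by near: A.
  rewrite -(fineK tf) lee_fin; apply: ltW.
  have : (`|0 - fine (\sum_(A <= k <oo) psi (a * k%:R))| < s / kap)%R by near: A.
  by rewrite sub0r normrN; apply: le_lt_trans; exact: ler_norm.
pose c k := if (A <= k)%N then (kap * fine (psi (a * k%:R)))%R else 0%R.
have c0 k : (0 <= c k)%R.
  rewrite /c; case: ifP => // _; rewrite mulr_ge0 ?fine_ge0 ?psi_ge0//.
  exact: ltW.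
have cs : \sum_(0 <= k <oo) (c k)%:E <= s%:E.
  rewrite (nneseries_split 0%N A); last by move=> k _; rewrite lee_fin.
  rewrite big_nat_cond big1 ?add0e ?add0n//; last first.
    by move=> k /andP[/andP[_]]; rewrite /c ltnNge => /negbTE ->.
  apply: (@le_trans _ _ (kap%:E * \sum_(A <= k <oo) psi (a * k%:R))).
    rewrite -nneseriesZl; last by move=> k _; exact: psi_ge0.
    apply: lee_nneseries => [k _ _|k _]; first by rewrite lee_fin.
    rewrite /c; case: ifP => [_|_]; first by rewrite EFinM fineK// psi_fin.
    by rewrite mule_ge0 ?psi_ge0// lee_fin ltW.
  rewrite (_ : s%:E = kap%:E * (s / kap)%:E).
    by rewrite lee_wpmul2l// lee_fin ltW.
  by rewrite -EFinM mulrC mulfVK// gt_eqF.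
pose B := (a * A%:R)%R.
have B0 : (0 <= B)%R by rewrite mulr_ge0// ltW.
pose p0 := fine (psi 0).
have p00 : (0 <= p0)%R by rewrite fine_ge0// psi_ge0.
(* As [psi] is decreasing, [p0] is its maximum on the half-line; [2 * p0] outweighs both the error
   of [capsum] and the required decrease on [[0, B)]. *)
pose L z := capsum c z + (2 * p0)%:E * (lyap_near B z)%:E.
have p02 : (0 <= 2 * p0)%R by rewrite mulr_ge0.
have nH := nnmeas_capsum c0.
have nG : nnmeas (fun z => (2 * p0)%:E * (lyap_near B z)%:E).
  exact: nnmeasZ p02 (nnmeas_lyap_near B0).
exists L, (2 * p0 * lyap_top B)%R; split.
- exact: nnmeasD.
- by rewrite mulr_ge0// expR_ge0.
- move=> z z0; rewrite EFinD; apply: leeD.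
    apply: (le_trans (capsum_le c0 z cs)); rewrite lee_fin /pospart.
    have -> : Num.max 0%R z = z by apply/max_idPr.
    by rewrite ler_wpM2r// ge_min lexx.
  rewrite -EFinM lee_fin ler_wpM2l// lerBlDr lerDl; exact: expR_ge0.
move=> z z0; rewrite /L stepD// stepZ//; last exact: nnmeas_lyap_near.
have s1 : (s <= 1)%R by rewrite ge_min lexx orbT.
have psiz : psi z = (fine (psi z))%:E by rewrite fineK// psi_fin.
have pz0 : (0 <= fine (psi z))%R by rewrite fine_ge0// psi_ge0.
have pzp0 : (fine (psi z) <= p0)%R by rewrite fine_le// ?psi_fin// psi_le.
have Hfin : capsum c z \is a fin_num.
  rewrite ge0_fin_numE; last exact: nH.2.
  by apply: (le_lt_trans (capsum_le c0 z cs)); rewrite ltry.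
have G0 := step_lyap_near_le B0 z0.
have sG0 := step_ge0 z (nnmeas_lyap_near B0).
have sH0 := step_ge0 z nH.
move: Hfin sH0 sG0; rewrite psiz.
have [zB|Bz] := ltP z B.
  have := step_lyap_near B0 z0 zB; have := step_capsum c0 z0 cs; rewrite psiz.
  case: (capsum c z) => [h| |]//; case: (step (capsum c) z) => [sh| |]//.
  case: (step (fun y => (lyap_near B y)%:E) z) => [sg| |]//.
  by rewrite -!EFinM -!EFinD !lee_fin => h1 h2 _ _ _; nra.
pose k0 := Num.truncn (z / a).
have za0 : (0 <= z / a)%R by rewrite divr_ge0// ltW.
have [k0l k0r] : (a * k0%:R <= z)%R /\ (z < a * k0%:R + a)%R.
  have /andP[h1 h2] := truncn_itv za0; split.
    by rewrite mulrC -ler_pdivlMr.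
  by rewrite -[X in (_ + X)%R]mulr1 -mulrDr natr1 mulrC -ltr_pdivrMr.
have Ak0 : (A <= k0)%N.
  by rewrite truncn_ge_nat// ler_pdivlMr// mulrC.
have k00 : (0 < k0)%N by exact: leq_trans Ak0.
have := step_capsum_drop c0 z0 cs k00 k0l k0r; rewrite psiz.
have ck0 : (2 * fine (psi z) <= c k0 * (a * q))%R.
  rewrite /c Ak0 /kap.
  rewrite (_ : 2 / (q * a) * fine (psi (a * k0%:R)) * (a * q) = 2 * fine (psi (a * k0%:R)))%R.
    by rewrite ler_wpM2l// fine_le// ?psi_fin// psi_le.
  by field; rewrite !gt_eqF.
move: G0; case: (capsum c z) => [h| |]//; case: (step (capsum c) z) => [sh| |]//.
case: (step (fun y => (lyap_near B y)%:E) z) => [sg| |]//.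
by rewrite -!EFinM -!EFinD !lee_fin => h1 h2 _ _ _; nra.
Unshelve. all: by end_near.
Qed.

(** [O n] stands for the mean overshoot at an exit within [n] steps, and [L] is a supersolution of
    its recursion. Only an inequality is asked of [O], so that the open half-line is covered as well
    as the closed one. *)
Lemma overshoot_bound (eps : R) : (0 < eps)%R -> exists2 C : R, (0 <= C)%R &
  forall O : nat -> R -> \bar R, (forall n, nnmeas (O n)) ->
    (forall z, O 0%N z = 0) ->
    (forall n z, (0 <= z)%R ->
       O n.+1 z <= psi z + step (fun y => if (0 <= y)%R then O n y else 0) z) ->
  forall n z, (0 <= z)%R -> O n z <= (eps * z + C)%:E.
Proof.
move=> eps0; have [L [C [nL C0 LC sL]]] := lyapunov_overshoot eps0.
exists C => // O nO O0 OS n z z0; apply: le_trans (LC z z0).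
elim: n z z0 => [|n IH] z z0; first by rewrite O0 nL.2.
apply: (le_trans (OS n z z0)); apply: le_trans (sL z z0); rewrite addeC.
apply: leeD => //; apply: step_le => //.
  by apply: nnmeas_if => //; exact: measurable_fun_ler.
by move=> y; case: ifP => [/IH//|_]; exact: nL.2.
Qed.

(** As [D] decreases in [n], [n * D n z] is at most the expected time before exit, truncated at [n].
    Inside [[0, a N)], with [N] about [sqrt n], this time is paid by [fh], of size
    [O(sqrt n (1 + z))]. An escape above [a N] costs at most [n], but its probability is
    [O((1 + z) / sqrt n)] by the supersolution [Z]. *)
Lemma survival_bound : exists2 C : R, (0 <= C)%R &
  forall D : nat -> R -> \bar R, (forall n, nnmeas (D n)) ->
    (forall n z, D n z <= 1) -> (forall n z, D n.+1 z <= D n z) ->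
    (forall n z, (0 <= z)%R ->
       D n.+1 z <= step (fun y => if (0 <= y)%R then D n y else 0) z) ->
  forall n z, (0 < n)%N -> (0 <= z)%R ->
    D n z <= (C * (1 + z) / Num.sqrt n%:R)%:E.
Proof.
have [L [C1 [nL C10 LC sL]]] := lyapunov_overshoot ltr01.
pose kap := ((q * a)^-1)%R.
have kap0 : (0 < kap)%R by rewrite invr_gt0 mulr_gt0.
have a0' := ltW a0.
pose C := ((3 * kap + a^-1) * (2 + C1) + lyap_top a)%R.
have C0 : (0 <= C)%R.
  rewrite addr_ge0 ?expR_ge0// mulr_ge0 ?addr_ge0// ?mulr_ge0 ?invr_ge0//.
  by rewrite ltW// mulr_gt0.
exists C => // D nD D1 Dmono DS n z n0 z0.
pose rn : R := Num.sqrt n%:R.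
have rn1 : (1 <= rn)%R by rewrite -sqrtr1 ler_wsqrtr// ler1n.
have rn0 : (0 < rn)%R by apply: lt_le_trans rn1.
have rn2 : (rn * rn = n%:R)%R by rewrite -expr2 sqr_sqrtr.
pose N := (Num.truncn rn).+1.
have [Nl Nr] : (rn <= N%:R)%R /\ (N%:R <= rn + 1)%R.
  have /andP[h1 h2] := truncn_itv (ltW rn0); split; first exact: ltW.
  by rewrite /N -natr1 lerD2r.
have N0 : (0 < N%:R :> R)%R by rewrite ltr0n.
pose c k := if (k < N)%N then kap else 0%R.
have c0 k : (0 <= c k)%R by rewrite /c; case: ifP => // _; rewrite ltW.
pose s := (kap * N%:R)%R.
have cs : \sum_(0 <= k <oo) (c k)%:E <= s%:E.
  rewrite (nneseries_split 0%N N); last by move=> k _; rewrite lee_fin.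
  rewrite [X in _ + X]eseries0 ?adde0; last first.
    by move=> k; rewrite add0n /c leqNgt => /negbTE ->.
  rewrite add0n sumEFin lee_fin.
  rewrite (eq_big_nat _ _ (F2 := fun=> kap)); last by move=> k /andP[_]; rewrite /c => ->.
  by rewrite sumr_const_nat subn0 /s mulr_natr.
have s0 : (0 <= s)%R by rewrite mulr_ge0// ltW.
(* By the choice of [kap] each kink [0 < k < N] contributes drift -1; [s * L] cancels the error
   [s * psi], and [lyap_near a] serves the cell [[0, a)], where no kink helps. *)
pose fh z := capsum c z + s%:E * L z + (lyap_near a z)%:E.
(* The mean of the positive part grows by [psi], which [L] gives back. *)
pose Z z := (pospart z)%:E + L z.
have nH := nnmeas_capsum c0.
have nG := nnmeas_lyap_near a0'.
have nsL : nnmeas (fun z => s%:E * L z) by exact: nnmeasZ.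
have nfh : nnmeas fh by apply: nnmeasD => //; exact: nnmeasD.
have nZ : nnmeas Z by apply: nnmeasD => //; exact: nnmeas_pospart.
have Lfin y : (0 <= y)%R -> L y \is a fin_num.
  by move=> y0; rewrite ge0_fin_numE ?nL.2//; apply: (le_lt_trans (LC y y0)); rewrite ltry.
have sfh y : (0 <= y)%R -> (y < a * N%:R)%R -> step fh y + 1 <= fh y.
  move=> y0 yN; rewrite /fh stepD//; last exact: nnmeasD.
  rewrite stepD// stepZ//.
  have psiy : psi y = (fine (psi y))%:E by rewrite fineK// psi_fin.
  have Hfin : capsum c y \is a fin_num.
    rewrite ge0_fin_numE; last exact: nH.2.
    by apply: (le_lt_trans (capsum_le c0 y cs)); rewrite ltry.
  have := step_lyap_near_le a0' y0; have := sL y y0.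
  have := step_ge0 y nH; have := step_ge0 y nL; have := step_ge0 y nG.
  move: (Lfin y y0) Hfin; rewrite psiy.
  have [ya|ay] := ltP y a.
    have := step_lyap_near a0' y0 ya; have := step_capsum c0 y0 cs; rewrite psiy.
    case: (capsum c y) => [h| |]//; case: (step (capsum c) y) => [sh| |]//.
    case: (L y) => [l| |]//; case: (step L y) => [sl| |]//.
    case: (step (fun y => (lyap_near a y)%:E) y) => [sg| |]//.
    rewrite -!EFinM -!EFinD !lee_fin => h1 h2 _ _ _ _ _ h3 h4.
    by have := ler_wpM2l s0 h3; rewrite mulrDr; lra.
  pose k0 := Num.truncn (y / a).
  have ya0 : (0 <= y / a)%R by rewrite divr_ge0.
  have [k0l k0r] : (a * k0%:R <= y)%R /\ (y < a * k0%:R + a)%R.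
    have /andP[h1 h2] := truncn_itv ya0; split.
      by rewrite mulrC -ler_pdivlMr.
    by rewrite -[X in (_ + X)%R]mulr1 -mulrDr natr1 mulrC -ltr_pdivrMr.
  have k0N : (k0 < N)%N by rewrite truncn_lt_nat// ltr_pdivrMr// mulrC.
  have k00 : (0 < k0)%N by rewrite truncn_ge_nat// ler_pdivlMr// mul1r.
  have := step_capsum_drop c0 y0 cs k00 k0l k0r; rewrite psiy.
  have -> : (c k0 * (a * q) = 1)%R.
    by rewrite /c k0N /kap; field; rewrite !gt_eqF.
  case: (capsum c y) => [h| |]//; case: (step (capsum c) y) => [sh| |]//.
  case: (L y) => [l| |]//; case: (step L y) => [sl| |]//.
  case: (step (fun y => (lyap_near a y)%:E) y) => [sg| |]//.
  rewrite -!EFinM -!EFinD !lee_fin => h1 _ _ _ _ _ h3 h4.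
  by have := ler_wpM2l s0 h3; rewrite mulrDr; lra.
have sZ y : (0 <= y)%R -> step Z y <= Z y.
  move=> y0; rewrite /Z stepD//; last exact: nnmeas_pospart.
  rewrite step_pospart /pospart -addeA; have -> : Num.max 0%R y = y by apply/max_idPr.
  by apply: leeD => //; rewrite addeC sL.
pose aN := (a * N%:R)%R.
have aN0 : (0 < aN)%R by rewrite mulr_gt0.
(* The second term pays for an escape: above [aN] one has [Z >= aN], so it is at least the whole
   remaining time [m]. *)
have M m y : (0 <= y)%R ->
    \sum_(0 <= j < m) D j y <= fh y + (m%:R / aN)%:E * Z y.
  elim: m y => [|m IH] y y0.
    by rewrite big_nil mul0r mul0e adde0 nfh.2.
  have m0 (k : nat) : (0 <= k%:R / aN)%R by rewrite divr_ge0// ltW.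
  have [yN|Ny] := ltP y aN; last first.
    apply: (@le_trans _ _ (m.+1%:R)%:E).
      rewrite [leRHS](_ : _ = \sum_(0 <= j < m.+1) 1); last first.
        by rewrite big_mkord sumEFin sumr_const card_ord.
      by apply: lee_sum => j _; exact: D1.
    apply: (@le_trans _ _ ((m.+1%:R / aN)%:E * Z y)); last by rewrite leeDr// nfh.2.
    apply: (@le_trans _ _ ((m.+1%:R / aN)%:E * y%:E)).
      by rewrite -EFinM lee_fin mulrAC ler_pdivlMr// ler_wpM2l.
    rewrite lee_wpmul2l ?lee_fin//; apply: (@le_trans _ _ (pospart y)%:E).
      by rewrite lee_fin le_max lexx orbT.
    by rewrite leeDl// nL.2.
  rewrite big_nat_recl//=.
  pose Dp j := (fun x => if (0 <= x)%R then D j x else 0).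
  have nDp j : nnmeas (Dp j) by apply: nnmeas_if => //; exact: measurable_fun_ler.
  apply: (@le_trans _ _ (1 + step (fun x => fh x + (m%:R / aN)%:E * Z x) y)).
    apply: leeD; first exact: D1.
    apply: (@le_trans _ _ (\sum_(0 <= j < m) step (Dp j) y)).
      by apply: lee_sum => j _; exact: DS.
    rewrite -step_sum//; apply: step_le.
    - exact: nnmeas_sum.
    - by apply: nnmeasD => //; exact: nnmeasZ.
    - move=> x; rewrite /Dp; case: (lerP 0 x) => x0; first exact: IH.
      rewrite big1// adde_ge0 ?nfh.2// mule_ge0 ?lee_fin ?m0//; exact: nZ.2.
  rewrite stepD//; last exact: nnmeasZ.
  rewrite stepZ// addeA [1 + _]addeC; apply: leeD; first exact: sfh.
  apply: (@le_trans _ _ ((m%:R / aN)%:E * Z y)).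
    by rewrite lee_wpmul2l ?lee_fin ?m0//; exact: sZ.
  rewrite lee_wpmul2r ?nZ.2// lee_fin ler_pM2r ?invr_gt0//.
  by rewrite ler_nat.
have DnE : D n z = (fine (D n z))%:E.
  rewrite fineK// ge0_fin_numE; last exact: (nD n).2.
  by apply: (le_lt_trans (D1 n z)); rewrite ltry.
have Dle j : (j <= n)%N -> D n z <= D j z.
  move=> jn; rewrite -(subnKC jn); elim: (n - j)%N => [|i IH]; first by rewrite addn0.
  by rewrite addnS; exact: le_trans IH.
have : (n%:R * fine (D n z))%:E <= fh z + (n%:R / aN)%:E * Z z.
  apply: le_trans (M n z z0).
  rewrite [leLHS](_ : _ = \sum_(0 <= j < n) (fine (D n z))%:E); last first.
    by rewrite sumEFin sumr_const_nat subn0 mulr_natl.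
  rewrite -DnE big_nat_cond [leRHS]big_nat_cond; apply: lee_sum => j.
  by rewrite andbT => /andP[_ /ltnW/Dle].
have zE : pospart z = z by apply/max_idPr.
have := capsum_le c0 z cs; rewrite /fh /Z zE DnE.
have := LC z z0; have := Lfin z z0; have := nH.2 z.
case: (capsum c z) => [h| |]//; case: (L z) => [l| |]//.
rewrite -!EFinM -!EFinD !lee_fin => h0 _ h1 h2 h3.
have dn : (lyap_near a z <= lyap_top a)%R by rewrite lerBlDr lerDl; exact: expR_ge0.
have top0 : (0 <= lyap_top a)%R by exact: expR_ge0.
have s3 : (s <= 3 * kap * rn)%R.
  by rewrite /s -mulrA mulrCA ler_wpM2l ?ltW//; lra.
have naN : (n%:R / aN <= a^-1 * rn)%R.
  rewrite ler_pdivrMr// /aN mulrA [(_ * rn * a)%R]mulrAC mulVf ?gt_eqF// mul1r.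
  by rewrite -rn2 ler_wpM2l// ltW.
have naN0 : (0 <= n%:R / aN)%R by rewrite divr_ge0// ltW.
rewrite ler_pdivlMr// -(ler_pM2l rn0) mulrCA rn2 mulrC.
apply: (le_trans h3).
have kr : (0 <= 3 * kap * rn)%R by rewrite !mulr_ge0// ltW.
have ar : (0 <= a^-1 * rn)%R by rewrite mulr_ge0 ?invr_ge0// ltW.
apply: (@le_trans _ _ (3 * kap * rn * (z + (z + C1)) + lyap_top a * rn +
    a^-1 * rn * (z + (z + C1)))%R).
  apply: lerD; first apply: lerD.
  - rewrite mulrDr; apply: lerD.
      by apply: (le_trans h2); rewrite ler_wpM2r.
    apply: (@le_trans _ _ (s * (z + C1))%R); last by rewrite ler_wpM2r ?addr_ge0.
    by rewrite ler_wpM2l//; move: h1; rewrite mul1r.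
  - by apply: (le_trans dn); rewrite ler_peMr.
  - apply: (@le_trans _ _ ((n%:R / aN) * (z + (z + C1)))%R).
      by rewrite ler_wpM2l// lerD2l; move: h1; rewrite mul1r.
    by rewrite ler_wpM2r// !addr_ge0.
rewrite /C.
have -> : (rn * (((3 * kap + a^-1) * (2 + C1) + lyap_top a) * (1 + z)) =
   3 * kap * rn * ((2 + C1) * (1 + z)) + lyap_top a * rn * (1 + z) +
   a^-1 * rn * ((2 + C1) * (1 + z)))%R by ring.
have zc : (z + (z + C1) <= (2 + C1) * (1 + z))%R.
  by have := mulr_ge0 C10 z0; nra.
apply: lerD; first apply: lerD.
- by rewrite ler_wpM2l.
- by rewrite ler_peMr ?mulr_ge0 ?lerDl// ltW.
- by rewrite ler_wpM2l.
Qed.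

End Lyapunov.

Section NegativeJump.
Context {R : realType} {d : measure_display} {Om : measurableType d}.
Variables (P : probability Om R) (Y : Om -> R).
Local Open Scope ereal_scope.

(** Otherwise [Y] would be nonnegative almost surely with mean zero, hence zero almost surely,
    against the second moment. *)
Lemma centred_negative_jump : measurable_fun setT Y ->
  \int[P]_w (Y w)%:E = 0 -> \int[P]_w (Y w ^+ 2)%:E != 0 ->
  exists a q : R, [/\ (0 < a)%R, (0 < q)%R & q%:E <= P [set w | (Y w <= - (2 * a))%R]].
Proof.
move=> mY EY0 Y2; apply: contrapT => H.
have mD (r : R) : measurable [set w | (Y w <= r)%R].
  rewrite (_ : [set w | _] = setT `&` Y @^-1` `]-oo, r]%classic); first exact: mY.
  by rewrite setTI; apply/seteqP; split=> w /=; rewrite in_itv.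
have D0 n : P [set w | (Y w <= - (2 * n.+1%:R^-1))%R] = 0.
  apply/eqP; apply: contra_notT H => Pn.
  have Pgt : 0 < P [set w | (Y w <= - (2 * n.+1%:R^-1))%R] by rewrite lt0e Pn measure_ge0.
  have Pf : P [set w | (Y w <= - (2 * n.+1%:R^-1))%R] \is a fin_num by exact: fin_num_measure.
  exists (n.+1%:R^-1)%R, (fine (P [set w | (Y w <= - (2 * n.+1%:R^-1))%R])).
  split; first by rewrite invr_gt0.
    by rewrite fine_gt0// Pgt/= -ge0_fin_numE.
  by rewrite fineK.
pose N := \bigcup_n [set w | (Y w <= - (2 * n.+1%:R^-1))%R].
have mN : measurable N by apply: bigcupT_measurable => n; exact: mD.
have N0 : P N = 0.
  apply/eqP; rewrite eq_le measure_ge0 andbT.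
  apply: (le_trans (measure_sigma_subadditive P (fun n => mD (- (2 * n.+1%:R^-1))%R) mN (@subset_refl _ N))).
  by rewrite eseries0// => n _ _; exact: D0.
have NY w : (Y w < 0)%R -> N w.
  move=> Yw; near \oo => n; exists n => //=.
  rewrite lerNr mulrC -ler_pdivlMr// ltW//.
  near: n; have pY : (0 < - Y w / 2)%R by rewrite divr_gt0// oppr_gt0.
  exact: (near_infty_natSinv_lt (PosNum pY)).
have mEY : measurable_fun setT (EFin \o Y) by exact/measurable_EFinP.
have absY : \int[P]_w `|(Y w)%:E| = 0.
  rewrite -EY0; apply: ae_eq_integral => //; first exact: measurableT_comp.
  exists N; split=> // w /= /not_implyP[_]; apply: contra_notP => nN.
  by rewrite ger0_norm// leNgt; apply/negP => /NY.
have := proj1 (ae_eq_integral_abs P measurableT mEY) absY => aeY.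
move/negP : Y2; apply; apply/eqP.
rewrite (ae_eq_integral (cst 0)) ?integral0//.
  by apply/measurable_EFinP; exact: measurable_funX.
apply: filterS aeY => w /= /(_ I) [Yw] _; by rewrite Yw expr0n.
Unshelve. all: by end_near.
Qed.

End NegativeJump.

(** * Measurability of crossing and absorption events *)

Section EventMeasurability.
Context {R : realType} {dT : measure_display} {T : measurableType dT}.
Context {d : measure_display} {Z : measurableType d}.
Variables (s : Z -> nat -> R) (Uv : Z -> nat -> T) (K : nat -> T -> R -> bool).
Hypothesis ms : forall n, measurable_fun setT (fun z => s z n).
Hypothesis mU : forall k, measurable_fun setT (fun z => Uv z k).
Hypothesis mK : forall i, measurable [set p : T * R | K i p.1 p.2].

(** Measurability of crossing and absorption events is read off their logical form, with all
    quantifiers over [nat]. *)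
Lemma measurable_andP (A B : Z -> Prop) : measurable [set z | A z] ->
  measurable [set z | B z] -> measurable [set z | A z /\ B z].
Proof. exact: measurableI. Qed.

Lemma measurable_orP (A B : Z -> Prop) : measurable [set z | A z] ->
  measurable [set z | B z] -> measurable [set z | A z \/ B z].
Proof. exact: measurableU. Qed.

Lemma measurable_notP (A : Z -> Prop) : measurable [set z | A z] ->
  measurable [set z | ~ A z].
Proof. exact: measurableC. Qed.

Lemma measurable_implP (A B : Z -> Prop) : measurable [set z | A z] ->
  measurable [set z | B z] -> measurable [set z | A z -> B z].
Proof.
move=> mA mB; rewrite (_ : [set z | _] = [set z | ~ A z \/ B z]); last first.
  apply/seteqP; split=> z /=; last by move=> [nA /nA|].
  by move=> AB; have [/AB|] := pselect (A z); [right|left].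
by apply: measurable_orP => //; exact: measurable_notP.
Qed.

Lemma measurable_allP (A : nat -> Z -> Prop) :
  (forall n, measurable [set z | A n z]) -> measurable [set z | forall n, A n z].
Proof.
move=> mA; rewrite (_ : [set z | _] = \bigcap_n [set z | A n z]); last first.
  by apply/seteqP; split=> z /= h n; [move=> _; exact: h|exact: (h n I)].
exact: bigcapT_measurable.
Qed.

Lemma measurable_exP (A : nat -> Z -> Prop) :
  (forall n, measurable [set z | A n z]) -> measurable [set z | exists n, A n z].
Proof.
move=> mA; rewrite (_ : [set z | _] = \bigcup_n [set z | A n z]); last first.
  by apply/seteqP; split=> z /= [n]; [exists n|move=> _; exists n].
exact: bigcupT_measurable.
Qed.

Lemma measurable_cstP (A : Prop) : measurable [set z : Z | A].
Proof.
have [HA|nA] := pselect A.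
  by rewrite (_ : [set z | _] = setT)//; apply/seteqP; split.
by rewrite (_ : [set z | _] = set0)//; apply/seteqP; split.
Qed.

Lemma measurable_side n : measurable [set z | side (s z) n].
Proof.
rewrite -[X in measurable X]setTI.
rewrite (_ : [set z | _] = (fun z => s z n) @^-1` `[0, +oo[); last first.
  by apply/seteqP; split=> z; rewrite /side/= in_itv/= andbT.
by apply: ms => //.
Qed.

Lemma measurable_side_eq n m : measurable [set z | side (s z) n = side (s z) m].
Proof.
rewrite (_ : [set z | _] = [set z | (side (s z) n -> side (s z) m) /\
    (side (s z) m -> side (s z) n)]); last first.
  apply/seteqP; split=> z /=; first by move=> ->.
  by move=> [h1 h2]; apply/idP/idP.
by apply: measurable_andP; apply: measurable_implP; exact: measurable_side.
Qed.

Lemma measurable_cross k m : measurable [set z | cross (s z) k = Some m].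
Proof.
elim: k m => [|k IH] m; first exact: (measurable_cstP (Some 0%N = Some m)).
rewrite (_ : [set z | _] = [set z | exists t, cross (s z) k = Some t /\
   (t < m)%N /\ ~ (side (s z) m = side (s z) t) /\
   forall j, (t < j < m)%N -> side (s z) j = side (s z) t]); last first.
  apply/seteqP; split=> z /=.
    by move=> /crossSP[t [h1 h2 h3 h4]]; exists t; repeat split => //; exact/eqP.
  by move=> [t [h1 [h2 [h3 h4]]]]; apply/crossSP; exists t; split=> //; exact/eqP.
apply: measurable_exP => t; apply: measurable_andP; first exact: IH.
apply: measurable_andP; first exact: measurable_cstP.
apply: measurable_andP; first by apply: measurable_notP; exact: measurable_side_eq.
apply: measurable_allP => j; apply: measurable_implP; first exact: measurable_cstP.
exact: measurable_side_eq.
Qed.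

Lemma measurable_olt_cross k n : measurable [set z | olt n (cross (s z) k)].
Proof.
rewrite (_ : [set z | _] = [set z | forall m, cross (s z) k = Some m -> (n < m)%N]).
  apply: measurable_allP => m; apply: measurable_implP; first exact: measurable_cross.
  exact: measurable_cstP.
apply/seteqP; split=> z /=.
  by move=> + m E; rewrite E.
by case: (cross (s z) k) => //= m /(_ m); apply.
Qed.

Lemma measurable_absorbed_at n :
  measurable [set z | absorbed_at K (Uv z) (s z) n].
Proof.
apply: measurable_exP => k; apply: measurable_exP => t.
apply: measurable_andP; first exact: measurable_cross.
apply: measurable_andP; first exact: measurable_cstP.
apply: measurable_andP; first exact: measurable_olt_cross.
rewrite -[X in measurable X]setTI.
exact: (measurable_fun_pair (mU k) (ms n) measurableT (mK (n - t))).
Qed.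

Lemma measurable_olt_absorb n :
  measurable [set z | olt n (absorb K (Uv z) (s z))].
Proof.
rewrite (_ : [set z | _] =
    [set z | forall j, (j <= n)%N -> ~ absorbed_at K (Uv z) (s z) j]); last first.
  by apply/seteqP; split=> z /= /olt_first_time.
apply: measurable_allP => j; apply: measurable_implP; first exact: measurable_cstP.
by apply: measurable_notP; exact: measurable_absorbed_at.
Qed.

Lemma measurable_alive k m : measurable [set z | alive K (Uv z) (s z) k m].
Proof.
rewrite (_ : [set z | _] = [set z | cross (s z) k = Some m /\
    forall j, (j < m)%N -> ~ absorbed_at K (Uv z) (s z) j]); last first.
  by apply/seteqP; split=> z /= /aliveP.
apply: measurable_andP; first exact: measurable_cross.
apply: measurable_allP => j; apply: measurable_implP; first exact: measurable_cstP.
by apply: measurable_notP; exact: measurable_absorbed_at.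
Qed.

End EventMeasurability.

(** * The first excursion *)

Section FirstExcursion.
Context {R : realType}.
Implicit Types s : nat -> R.

(** Time [0] is left out, so that one step leads to the same predicate for the shifted path,
    whatever the starting side. *)
Fixpoint stays (b : bool) n s : bool :=
  if n is n'.+1 then (side s 1 == b) && stays b n' (fun j => s j.+1) else true.

(** The value is [0] if no exit occurs within [n] steps; bounds uniform in [n] then pass to the true
    crossing time. *)
Fixpoint overshoot (b : bool) n s : R :=
  if n is n'.+1 then
    if side s 1 == b then overshoot b n' (fun j => s j.+1) else `|s 1%N|
  else 0.

Lemma staysP b n s : reflect (forall j, (0 < j <= n)%N -> side s j = b) (stays b n s).
Proof.
elim: n s => [|n IH] s /=; first by apply: ReflectT => j; lia.
apply: (iffP andP) => [[/eqP s1 /IH h] [|[|j]] jn//|h].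
  by apply: (h j.+1).
split; first by apply/eqP/h.
by apply/IH => j jn; apply: (h j.+1); lia.
Qed.

Lemma olt_cross1 n s : olt n (cross s 1) <-> stays (side s 0) n s.
Proof. by rewrite (olt_crossS s 0 0 n)//; split=> [h|/staysP//]; exact/staysP. Qed.

Lemma overshoot_ge0 b n s : 0 <= overshoot b n s.
Proof. by elim: n s => //= n IH s; case: ifP. Qed.

Lemma overshoot_cross1 n m s : cross s 1 = Some m -> (m <= n)%N ->
  overshoot (side s 0) n s = `|s m|.
Proof.
move=> /crossSP[t [[<-] m0 sm h]].
move: (side s 0) sm h => b.
elim: n m m0 s => [|n IH] [|m] //= _ s sm h mn.
case: m sm h mn => [|m] sm h mn; first by rewrite (negbTE sm).
by rewrite h// eqxx (IH m.+1)// => j jm; apply: (h j.+1); lia.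
Qed.

Context {d : measure_display} {Z : measurableType d}.

Lemma measurable_stays b n (s : Z -> nat -> R) :
  (forall n, measurable_fun setT (fun z => s z n)) ->
  measurable [set z | stays b n (s z)].
Proof.
move=> ms; rewrite (_ : [set z | _] =
    [set z | forall j, (0 < j <= n)%N -> side (s z) j = b]); last first.
  by apply/seteqP; split=> z /= /staysP.
apply: measurable_allP => j; apply: measurable_implP; first exact: measurable_cstP.
case: b; first exact: measurable_side.
rewrite (_ : [set z | _] = [set z | ~ side (s z) j]); last first.
  by apply/seteqP; split=> z /=; [move=> ->|move/negP/negbTE].
by apply: measurable_notP; exact: measurable_side.
Qed.

Lemma measurable_overshoot b n (s : Z -> nat -> R) :
  (forall n, measurable_fun setT (fun z => s z n)) ->
  measurable_fun setT (fun z => overshoot b n (s z)).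
Proof.
elim: n s => [|n IH] s ms //=.
apply: measurable_fun_ifT; last first.
- exact: measurableT_comp.
- by apply: (IH (fun z j => s z j.+1)) => j; exact: ms.
apply: (measurable_fun_bool true); rewrite setTI.
rewrite (_ : _ @^-1` _ = [set z | stays b 1 (s z)]); last first.
  by apply/seteqP; split=> z /=; rewrite andbT.
exact: measurable_stays.
Qed.

End FirstExcursion.

(** * The walk on the canonical space *)

Section CanonicalWalk.
Context {R : realType} {dT : measure_display} {T : measurableType dT}.
Local Notation E := (canon R T).
Implicit Types x y t : R.

Definition cX (i : nat) (e : E) : R := e.1 i.
Definition cU (k : nat) (e : E) : T := e.2 k.

Lemma measurable_walk d (Z : measurableType d) (y : Z -> R) (e : Z -> E) n :
  measurable_fun setT y -> measurable_fun setT e ->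
  measurable_fun setT (fun z : Z => walk cX (y z) (e z) n).
Proof.
move=> my me; apply: measurable_funD => //; apply: measurable_sum => i.
exact: (measurableT_comp (measurable_coord1 i) me).
Qed.

Lemma measurable_cwalk y n : measurable_fun setT (fun e : E => walk cX y e n).
Proof. exact: measurable_walk. Qed.

Lemma walk1 y (e : E) : walk cX y e 1 = y + e.1 0%N.
Proof. by rewrite /walk big_ord_recr/= big_ord0 add0r. Qed.

Lemma walk0 y (e : E) : walk cX y e 0 = y.
Proof. by rewrite /walk big_ord0 addr0. Qed.

Lemma walk_splice_le m k y (e e' : E) i : (i <= m)%N ->
  walk cX y (splice m k (e, e')) i = walk cX y e i.
Proof.
move=> im; rewrite /walk; congr (_ + _); apply: eq_bigr => j _ /=.
by rewrite /cX/= (leq_trans (ltn_ord j) im).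
Qed.

Lemma walk_splice m k y (e e' : E) j :
  walk cX y (splice m k (e, e')) (m + j) = walk cX (walk cX y e m) e' j.
Proof.
rewrite /walk big_split_ord/= addrA; congr (_ + _ + _).
  by apply: eq_bigr => i _; rewrite /cX/= ltn_ord.
by apply: eq_bigr => i _; rewrite /cX/= ltnNge leq_addr/= addKn.
Qed.

Variable lam : probability E R.
Hypothesis lam_iid : iid_law lam.
Local Open Scope ereal_scope.

Definition stay_prob b n (y : R) : \bar R :=
  \int[lam]_e ((stays b n (walk cX y e))%:R)%:E.
Definition exit_mean b n (y : R) : \bar R :=
  \int[lam]_e (overshoot b n (walk cX y e))%:E.

Lemma measurable_boolR d (Z : measurableType d) (A : Z -> bool) :
  measurable [set z | A z] -> measurable_fun setT (fun z => (A z)%:R : R).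
Proof.
move=> mA; rewrite (_ : (fun _ => _) = \1_[set z | A z]); first exact: measurable_indic.
apply/funext => z; rewrite indicE; have -> // : (z \in [set z | A z]) = A z.
by apply/idP/idP; rewrite inE.
Qed.

Lemma measurable_sideb b : measurable_fun setT (fun t : R => (0 <= t)%R == b).
Proof.
apply: (measurable_fun_bool true); rewrite setTI.
case: b.
  rewrite (_ : _ @^-1` _ = `[0%R, +oo[%classic)//.
  by apply/seteqP; split=> t /=; rewrite in_itv/= andbT; case: (0 <= t)%R.
rewrite (_ : _ @^-1` _ = `]-oo, 0%R[%classic)//.
by apply/seteqP; split=> t /=; rewrite in_itv/= ltNge; case: (0 <= t)%R.
Qed.

Lemma stay_probE b n y : stay_prob b n y = lam [set e | stays b n (walk cX y e)].
Proof.
set A := [set e | _]; have mA : measurable A.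
  by apply: measurable_stays => i; exact: measurable_cwalk.
rewrite -(setIT A) -(integral_indic lam measurableT mA).
apply: eq_integral => e _; rewrite indicE.
have -> // : (e \in [set e | stays b n (walk cX y e)]) = stays b n (walk cX y e).
by apply/idP/idP; rewrite inE.
Qed.

Lemma walk_splice1 y (e e' : E) :
  (fun j => walk cX y (splice 1 0 (e, e')) j.+1) = walk cX (y + e.1 0%N)%R e'.
Proof.
by apply/funext => j; rewrite -[in RHS]walk1 -(walk_splice 1 0 y e e' j).
Qed.

Lemma side_splice1 y (e e' : E) :
  side (walk cX y (splice 1 0 (e, e'))) 1 = (0 <= y + e.1 0%N)%R.
Proof. by rewrite /side walk_splice_le// walk1. Qed.

Lemma nnmeas_stay_prob b n : nnmeas (stay_prob b n).
Proof.
split=> [|y]; last by apply: integral_ge0 => e _; rewrite lee_fin.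
pose f (p : R * E) := ((stays b n (walk cX p.1 p.2))%:R : R)%:E.
apply: (measurable_fun_fubini_tonelli_F (m2 := lam) f); last first.
  by move=> p; rewrite lee_fin.
apply/measurable_EFinP/measurable_boolR.
apply: (measurable_stays b n (s := fun p : R * E => walk cX p.1 p.2)) => i.
exact: measurable_walk.
Qed.

Lemma nnmeas_exit_mean b n : nnmeas (exit_mean b n).
Proof.
split=> [|y]; last by apply: integral_ge0 => e _; rewrite lee_fin overshoot_ge0.
pose f (p : R * E) := (overshoot b n (walk cX p.1 p.2))%:E.
apply: (measurable_fun_fubini_tonelli_F (m2 := lam) f); last first.
  by move=> p; rewrite lee_fin overshoot_ge0.
apply/measurable_EFinP.
apply: (measurable_overshoot b n (s := fun p : R * E => walk cX p.1 p.2)) => i.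
exact: measurable_walk.
Qed.

(** First-step analysis: the splice is made after one step and no mark. *)
Lemma stay_probS b n y : stay_prob b n.+1 y =
  \int[lam]_e (if (0 <= y + e.1 0%N)%R == b then stay_prob b n (y + e.1 0%N)%R else 0).
Proof.
rewrite /stay_prob (integral_splice lam_iid 1 0); first last.
- by move=> e; rewrite lee_fin.
- apply/measurable_EFinP/measurable_boolR/measurable_stays => i.
  exact: measurable_cwalk.
apply: eq_integral => e _.
have h e' : stays b n.+1 (walk cX y (splice 1 0 (e, e'))) =
    ((0 <= y + e.1 0%N)%R == b) && stays b n (walk cX (y + e.1 0%N)%R e').
  by rewrite [LHS]/= side_splice1 walk_splice1.
case: ifP => hb; first by apply: eq_integral => e' _; rewrite h hb.
by apply: integral0_eq => e' _; rewrite h hb.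
Qed.

Lemma exit_meanS b n y : exit_mean b n.+1 y =
  \int[lam]_e (if (0 <= y + e.1 0%N)%R == b then exit_mean b n (y + e.1 0%N)%R
               else `|y + e.1 0%N|%:E).
Proof.
rewrite /exit_mean (integral_splice lam_iid 1 0); first last.
- by move=> e; rewrite lee_fin overshoot_ge0.
- apply/measurable_EFinP/measurable_overshoot => i.
  exact: measurable_cwalk.
apply: eq_integral => e _.
have h e' : overshoot b n.+1 (walk cX y (splice 1 0 (e, e'))) =
    if (0 <= y + e.1 0%N)%R == b then overshoot b n (walk cX (y + e.1 0%N)%R e')
    else `|y + e.1 0%N|%R.
  by rewrite [LHS]/= side_splice1 walk_splice1 walk_splice_le// walk1.
case: ifP => hb; first by apply: eq_integral => e' _; rewrite h hb.
under eq_integral do rewrite h hb.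
by rewrite integral_cst//= probability_setT mule1.
Qed.

Hypothesis iX : lam.-integrable setT (fun e => (e.1 0%N)%:E).
Hypothesis EX0 : \int[lam]_e (e.1 0%N)%:E = 0.
Hypothesis X2 : \int[lam]_e (e.1 0%N ^+ 2)%:E < +oo.
Hypothesis X2n0 : \int[lam]_e (e.1 0%N ^+ 2)%:E != 0.

(** A reflection for [b = false], so that the estimates on the nonnegative half-line serve both
    sides of zero. *)
Let sg (b : bool) : R := (if b then 1 else -1)%R.
Let Yb b (e : E) : R := (sg b * e.1 0%N)%R.

Let sgsg b : (sg b * sg b = 1)%R.
Proof. by case: b; rewrite /sg ?mulrNN mulr1. Qed.

Let mYb b : measurable_fun setT (Yb b).
Proof. by apply: measurable_funM => //; exact: measurable_coord1. Qed.

Let iYb b : lam.-integrable setT (EFin \o Yb b).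
Proof.
rewrite (_ : _ \o _ = (fun e => (sg b)%:E * (e.1 0%N)%:E)); first exact: integrableZl.
by apply/funext => e /=; rewrite EFinM.
Qed.

Let EYb b : \int[lam]_e (Yb b e)%:E = 0.
Proof.
under eq_integral do rewrite /Yb EFinM.
by rewrite integralZl// EX0 mule0.
Qed.

Let Yb2 b : \int[lam]_e (Yb b e ^+ 2)%:E = \int[lam]_e (e.1 0%N ^+ 2)%:E.
Proof.
by apply: eq_integral => e _; rewrite /Yb exprMn [(sg b ^+ 2)%R]expr2 sgsg mul1r.
Qed.

Let sgle (b : bool) (t : R) : (0 <= t)%R = b -> (0 <= sg b * t)%R.
Proof. by case: b => h; rewrite /sg ?mul1r// mulN1r oppr_ge0 ltW// ltNge h. Qed.

Let sgabs (b : bool) (t : R) : (0 <= t)%R = b -> (sg b * t = `|t|)%R.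
Proof.
move=> tb; rewrite /sg -tb; case: (lerP 0 t) => h; first by rewrite mul1r ger0_norm.
by rewrite mulN1r ltr0_norm.
Qed.

Lemma stay_prob_bound : exists2 C : R, (0 <= C)%R &
  forall b n y, (0 < n)%N -> (0 <= y)%R = b ->
  stay_prob b n y <= (C * (1 + `|y|) / Num.sqrt n%:R)%:E.
Proof.
have H b : exists2 C : R, (0 <= C)%R & forall n y, (0 < n)%N -> (0 <= y)%R = b ->
    stay_prob b n y <= (C * (1 + `|y|) / Num.sqrt n%:R)%:E.
  have Y2n0 : \int[lam]_e (Yb b e ^+ 2)%:E != 0 by rewrite Yb2.
  have [a [q [a0 q0 Pa]]] := centred_negative_jump (mYb b) (EYb b) Y2n0.
  have Y2b : \int[lam]_e (Yb b e ^+ 2)%:E < +oo by rewrite Yb2.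
  have [C C0 HC] := survival_bound (mYb b) (iYb b) (EYb b) a0 q0 Pa Y2b.
  exists C => // n y n0 yb.
  have := HC (fun n z => stay_prob b n (sg b * z)%R) _ _ _ _ n (sg b * y)%R n0 (sgle yb).
  rewrite mulrA sgsg mul1r.
  rewrite (sgabs yb).
  apply=> [m|m z|m z|m z z0].
  - have [h1 h2] := nnmeas_stay_prob b m; split=> // .
    by apply: (measurableT_comp h1); exact: measurable_funM.
  - by rewrite stay_probE probability_le1//; apply: measurable_stays => i; exact: measurable_cwalk.
  - rewrite !stay_probE le_measure ?inE//; try by apply: measurable_stays => i; exact: measurable_cwalk.
    by move=> e; rewrite /mkset => /staysP h; apply/staysP => j /andP[j0 jm]; apply: h; rewrite j0 leqW.
  - rewrite stay_probS /step; apply: ge0_le_integral => //.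
    + by move=> e _; case: ifP => // _; exact: (nnmeas_stay_prob b m).2.
    + apply: (measurableT_comp (nnmeas_if (b := fun t => (0 <= t)%R == b) _ (nnmeas_stay_prob b m)).1).
        exact: measurable_sideb.
      by apply: measurable_funD => //; exact: measurable_coord1.
    + apply: (nnmeas_step_fun (f := fun t => if (0 <= t)%R then stay_prob b m (sg b * t) else 0) (mYb b) z).
      apply: nnmeas_if; first exact: measurable_fun_ler.
      have [h1 h2] := nnmeas_stay_prob b m; split=> //.
      by apply: (measurableT_comp h1); exact: measurable_funM.
    (* For [b = false] the reflected side is the open half-line, so the integrands compare only by
       an inequality, which is all that [survival_bound] asks. *)
    + move=> e _; rewrite /Yb mulrDr !mulrA sgsg mul1r.
      case: eqP => [hb|_].
        by rewrite (_ : (0 <= z + _)%R)//; have := sgle hb; rewrite mulrDr mulrA sgsg mul1r.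
      by case: ifP => // _; exact: (nnmeas_stay_prob b m).2.
have [C1 C10 H1] := H true; have [C2 C20 H2] := H false.
exists (C1 + C2)%R; first exact: addr_ge0.
have pos (n : nat) (y : R) : (0 <= (1 + `|y|) / Num.sqrt n%:R)%R.
  by rewrite divr_ge0 ?sqrtr_ge0// addr_ge0.
move=> [] n y n0 yb.
  apply: (le_trans (H1 n y n0 yb)); rewrite lee_fin -!mulrA ler_wpM2r// lerDl//.
apply: (le_trans (H2 n y n0 yb)); rewrite lee_fin -!mulrA ler_wpM2r// lerDr//.
Qed.

Lemma exit_mean_bound (eps : R) : (0 < eps)%R -> exists2 C : R, (0 <= C)%R &
  forall b n y, (0 <= y)%R = b -> exit_mean b n y <= (eps * `|y| + C)%:E.
Proof.
move=> eps0.
have H b : exists2 C : R, (0 <= C)%R & forall n y, (0 <= y)%R = b ->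
    exit_mean b n y <= (eps * `|y| + C)%:E.
  have Y2n0 : \int[lam]_e (Yb b e ^+ 2)%:E != 0 by rewrite Yb2.
  have [a [q [a0 q0 Pa]]] := centred_negative_jump (mYb b) (EYb b) Y2n0.
  have Y2b : \int[lam]_e (Yb b e ^+ 2)%:E < +oo by rewrite Yb2.
  have [C C0 HC] := overshoot_bound (mYb b) (iYb b) (EYb b) a0 q0 Pa Y2b eps0.
  exists C => // n y yb.
  have := HC (fun n z => exit_mean b n (sg b * z)%R) _ _ _ n (sg b * y)%R (sgle yb).
  rewrite mulrA sgsg mul1r (sgabs yb).
  have nO m : nnmeas (fun z => exit_mean b m (sg b * z)).
    have [h1 h2] := nnmeas_exit_mean b m; split=> //.
    by apply: (measurableT_comp h1); exact: measurable_funM.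
  apply=> [//|z|m z z0].
  - by rewrite /exit_mean/= integral0.
  - rewrite exit_meanS /psi -stepD//; [|exact: nnmeas_negpart|].
      2: by apply: nnmeas_if => //; exact: measurable_fun_ler.
    apply: ge0_le_integral => //.
    + by move=> e _; case: ifP => // _; exact: (nnmeas_exit_mean b m).2.
    + apply: (measurableT_comp (f := fun t => if (0 <= t)%R == b then exit_mean b m t else `|t|%:E)).
        apply: measurable_fun_ifT; first exact: measurable_sideb.
          exact: (nnmeas_exit_mean b m).1.
        by apply/measurable_EFinP; exact: (@normr_measurable R setT).
      by apply: measurable_funD => //; exact: measurable_coord1.
    + apply: (nnmeas_step_fun (f := fun t => (negpart t)%:E +
        (if (0 <= t)%R then exit_mean b m (sg b * t) else 0)) (mYb b) z).
      apply: nnmeasD; first exact: nnmeas_negpart.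
      by apply: nnmeas_if => //; exact: measurable_fun_ler.
    + move=> e _; have tE : (sg b * z + e.1 0%N = sg b * (z + Yb b e))%R.
        by rewrite mulrDr /Yb [(sg b * (sg b * _))%R]mulrA sgsg mul1r.
      rewrite tE; move: (z + Yb b e)%R => t; case: eqP => [hb|hb].
        have -> : (0 <= t)%R by have := sgle hb; rewrite mulrA sgsg mul1r.
        by rewrite leeDr// lee_fin negpart_ge0.
      apply: (@le_trans _ _ (negpart t)%:E).
        have t0 : (t <= 0)%R.
          move: hb; rewrite /sg; case: (b); rewrite ?mul1r ?mulN1r.
            by case: (lerP 0 t) => // /ltW.
          by rewrite oppr_ge0; case: (lerP t 0).
        rewrite lee_fin /negpart le_max normrM (ler0_norm t0).
        have -> : (`|sg b| = 1)%R by rewrite /sg; case: (b); rewrite ?normrN normr1.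
        by rewrite mul1r lexx orbT.
      rewrite leeDl//; case: ifP => // _; exact: (nO m).2.
have [C1 C10 H1] := H true; have [C2 C20 H2] := H false.
exists (C1 + C2)%R; first exact: addr_ge0.
by move=> [] n y yb; [apply: (le_trans (H1 n y yb))|apply: (le_trans (H2 n y yb))];
  rewrite lee_fin lerD2l ?lerDl ?lerDr.
Qed.

End CanonicalWalk.

(** * Linear interpolation and functionals of continuous paths *)

Section Interpolation.
Context {R : realType}.
Implicit Types (s p : nat -> R) (r t x y v c : R).

Definition ipart r : nat := `|Num.floor r|%N.

Definition interp s r : R :=
  s (ipart r) + (r - (ipart r)%:R) * (s (ipart r).+1 - s (ipart r)).

Lemma ipart_itv r : 0 <= r -> (ipart r)%:R <= r < (ipart r).+1%:R.
Proof.
move=> r0; have f0 : 0 <= Num.floor r by rewrite floor_ge0.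
have E : (ipart r)%:R = (Num.floor r)%:~R :> R.
  by rewrite -[in RHS](gez0_abs f0).
have := floor_itv r; rewrite -natr1 E => /andP[-> h] /=.
by rewrite (lt_le_trans h)// intrD.
Qed.

Lemma ipart_eq r m : m%:R <= r < m.+1%:R -> ipart r = m.
Proof.
move=> /andP[mr rm]; rewrite /ipart (floor_def (m := m))//.
by rewrite -[X in X <= r]/(m%:R) mr/= (lt_le_trans rm)// -natr1 intrD.
Qed.

Lemma ipart_le r m : 0 <= r -> r <= m%:R -> (ipart r <= m)%N.
Proof.
move=> r0 rm; have /andP[h _] := ipart_itv r0.
by rewrite -(ler_nat R); exact: le_trans rm.
Qed.

Lemma ipart_lt r m : 0 <= r -> r < m%:R -> (ipart r < m)%N.
Proof.
move=> r0 rm; have /andP[h _] := ipart_itv r0.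
by rewrite -(ltr_nat R); exact: le_lt_trans rm.
Qed.

Lemma interp_shift s m r : 0 <= r ->
  interp s (m%:R + r) = interp (fun j => s (m + j)%N) r.
Proof.
move=> r0; have /andP[h1 h2] := ipart_itv r0.
have E : ipart (m%:R + r) = (m + ipart r)%N.
  by apply: ipart_eq; rewrite -addnS !natrD lerD2l ltrD2l h1.
by rewrite /interp E -addnS natrD opprD addrACA subrr add0r.
Qed.

Lemma interp_close s r v c : 0 <= r -> `|s (ipart r) - v| <= c ->
  `|s (ipart r).+1 - v| <= c -> `|interp s r - v| <= c.
Proof.
move=> r0; have /andP[h1 h2] := ipart_itv r0; rewrite /interp.
move: (s (ipart r)) (s (ipart r).+1) => a b ha hb.
set th := r - (ipart r)%:R.
have th0 : 0 <= th by rewrite subr_ge0.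
have th1 : 0 <= 1 - th by rewrite /th; move: h2; rewrite -natr1; lra.
have -> : a + th * (b - a) - v = (1 - th) * (a - v) + th * (b - v) by ring.
apply: (le_trans (ler_normD _ _)); rewrite !normrM (ger0_norm th0) (ger0_norm th1).
have := ler_wpM2l th1 ha; have := ler_wpM2l th0 hb; lra.
Qed.

Definition clamp t : R := Num.max 0 (Num.min 1 t).

Lemma clamp_lip x y : `|clamp x - clamp y| <= `|x - y|.
Proof.
have cl z : [\/ z <= 0 /\ clamp z = 0, (0 <= z /\ z <= 1) /\ clamp z = z | 1 <= z /\ clamp z = 1].
  rewrite /clamp; case: (lerP 1 z) => hz.
    by apply: Or33; split=> //; apply/max_idPr.
  case: (lerP 0 z) => hz'; first by apply: Or32; do 2?split => //; exact: ltW.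
  by apply: Or31; split=> //; exact: ltW.
have h1 := ler_norm (x - y); have h2 := ler_norm (y - x); rewrite distrC in h2.
have h3 := normr_ge0 (x - y).
rewrite ler_norml.
by case: (cl x) => -[hx ->]; case: (cl y) => -[hy ->]; apply/andP; split; lra.
Qed.

(** Each increment is switched on linearly over its own unit interval; in this form a Lipschitz
    bound is inherited from [clamp]. *)
Lemma interp_sum s r N : 0 <= r <= N%:R ->
  interp s r = s 0%N + \sum_(i < N) (s i.+1 - s i) * clamp (r - i%:R).
Proof.
move=> /andP[r0 rN]; pose S N := s 0%N + \sum_(i < N) (s i.+1 - s i) * clamp (r - i%:R).
have SS n : S n.+1 = S n + (s n.+1 - s n) * clamp (r - n%:R).
  by rewrite /S big_ord_recr/= addrA.
rewrite -[RHS]/(S N); have /andP[h1 h2] := ipart_itv r0.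
set m := ipart r in h1 h2 *.
have lo n : (n <= m)%N -> S n = s n.
  elim: n => [|n IH] nm; first by rewrite /S big_ord0 addr0.
  rewrite SS IH; last exact: ltnW.
  have -> : clamp (r - n%:R) = 1.
    rewrite /clamp; have h : 1 <= r - n%:R.
      by rewrite lerBrDr addrC natr1; apply: le_trans h1; rewrite ler_nat.
    by rewrite (min_idPl h); apply/max_idPr.
  by rewrite mulr1 addrC subrK.
have hi n : S (m.+1 + n)%N = interp s r.
  elim: n => [|n IH].
    rewrite addn0 SS lo// /interp -/m mulrC; congr (_ + _ * _).
    rewrite /clamp; have h : r - m%:R <= 1 by rewrite lerBlDr addrC natr1 ltW.
    by rewrite (min_idPr h); apply/max_idPr; rewrite subr_ge0.
  rewrite addnS SS IH (_ : clamp _ = 0) ?mulr0 ?addr0//.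
  have h : r - (m.+1 + n)%:R <= 0.
    by rewrite subr_le0; apply: le_trans (ltW h2) _; rewrite ler_nat leq_addr.
  by rewrite /clamp (min_idPr (le_trans h ler01)); apply/max_idPl.
have mN : (m <= N)%N by exact: ipart_le.
move: mN; rewrite leq_eqVlt => /orP[/eqP mN|mN]; last by rewrite -(subnKC mN) hi.
rewrite -mN lo// /interp -/m (_ : r - m%:R = 0) ?mul0r ?addr0//.
by apply/eqP; rewrite subr_eq0 eq_le h1 andbT mN.
Qed.

Lemma interp_lipschitz s N : exists2 L : R, 0 <= L & forall r r',
  0 <= r <= N%:R -> 0 <= r' <= N%:R -> `|interp s r - interp s r'| <= L * `|r - r'|.
Proof.
exists (\sum_(i < N) `|s i.+1 - s i|); first by apply: sumr_ge0 => i _.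
move=> r r' hr hr'; rewrite (interp_sum s hr) (interp_sum s hr').
rewrite opprD addrACA subrr add0r -sumrB mulr_suml.
apply: (le_trans (ler_norm_sum _ _ _)); apply: ler_sum => i _.
rewrite -mulrBr normrM ler_wpM2l//; apply: (le_trans (clamp_lip _ _)).
by rewrite opprD addrACA opprK [- _ + _]addrC subrr addr0.
Qed.

Lemma cont01P (g : R -> R) : cont01 g <-> forall x, 0 <= x <= 1 -> forall e : R, 0 < e ->
  exists2 del : R, 0 < del & forall y, 0 <= y <= 1 -> `|x - y| < del -> `|g x - g y| < e.
Proof.
split=> [cg x x01 e e0|H].
  have xA : `[0, 1]%classic x by rewrite /= in_itv.
  have := cg x; rewrite /continuous_at => /cvgrPdist_lt /(_ e e0).
  rewrite -[nbhs (x : subspace _)]/(nbhs_subspace _) -nbhs_subspace_in//.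
  rewrite /near_simpl /prop_near1 /nbhs/= /within/= => -[del /= del0 h].
  exists del => // y y01 xy; apply: h => //=.
rewrite /cont01 continuous_subspace_in => x; rewrite inE/= in_itv/= => x01.
rewrite /continuous_at; apply/cvgrPdist_lt => e e0.
have [del del0 h] := H x x01 e e0.
have xA : `[0, 1]%classic x by rewrite /= in_itv.
rewrite /near_simpl /prop_near1 -nbhs_subspace_in// /nbhs/= /within/=.
by exists del => //= y xy; rewrite in_itv/= => y01; exact: h.
Qed.

Lemma cont01_unif (g : R -> R) : cont01 g -> forall e : R, 0 < e ->
  exists2 del : R, 0 < del & forall x y, 0 <= x <= 1 -> 0 <= y <= 1 ->
    `|x - y| < del -> `|g x - g y| < e.
Proof.
move=> /cont01P cg e e0.
have := (compact_near_coveringP `[0 : R, 1]%classic).1 (@segment_compact R 0 1).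
pose Pd (del : R) (x : R) := 0 <= x <= 1 -> forall y, 0 <= y <= 1 ->
   `|x - y| < del -> `|g x - g y| < e.
move=> /(_ _ (0 : R)^'+ Pd _) [|].
  move=> x; rewrite /= in_itv/= => x01.
  have e20 : 0 < e / 2 by rewrite divr_gt0.
  have [del del0 h] := cg x x01 _ e20.
  have d20 : 0 < del / 2 by rewrite divr_gt0.
  exists ([set x' | `|x - x'| < del / 2], [set d | d < del / 2]) => /=.
    split; first by exists (del / 2).
    exact: nbhs_right_lt.
  move=> [x' d]/= [xx' dd] x'01 y y01 x'y.
  have h1 : `|g x - g x'| < e / 2 by apply: h => //; lra.
  have h2 : `|g x - g y| < e / 2.
    apply: h => //; have := ler_normD (x - x') (x' - y).
    by rewrite addrA subrK; lra.
  have := ler_normD (g x' - g x) (g x - g y).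
  by rewrite addrA subrK [`|g x' - g x|]distrC; lra.
move=> del /= del0 H; exists (del / 2); first by rewrite divr_gt0.
move=> x y x01 y01 xy.
have : `|0 - del / 2| < del by rewrite sub0r normrN ger0_norm; lra.
move=> /H/(_ _ x); apply=> //.
by rewrite divr_gt0.
Qed.

Lemma cont01_bounded (g : R -> R) : cont01 g ->
  exists2 M : R, 0 <= M & forall t, 0 <= t <= 1 -> `|g t| <= M.
Proof.
move=> cg; have [a _ ha] := EVT_max ler01 cg; have [b _ hb] := EVT_min ler01 cg.
exists (`|g a| + `|g b|); first exact: addr_ge0.
move=> t t01; have := ha t; have := hb t; rewrite !in_itv/= => /(_ t01) h1 /(_ t01) h2.
have := ler_norm (g a); have := lerNnormlW (lexx `|g b|).
have := normr_ge0 (g a); have := normr_ge0 (g b).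
by rewrite ler_norml => *; apply/andP; split; lra.
Qed.

Lemma cont01_interp s N c : cont01 (fun t => interp s (t * N%:R) / c).
Proof.
apply/cont01P => x /andP[x0 x1] e e0.
have [L L0 hL] := interp_lipschitz s N.
pose C : R := L * N%:R * `|c^-1| + 1.
have C0 : 0 < C by rewrite ltr_wpDl// !mulr_ge0.
exists (e / C); first by rewrite divr_gt0.
move=> y /andP[y0 y1] xy; rewrite -mulrBl normrM.
have xN (z : R) : 0 <= z -> z <= 1 -> 0 <= z * N%:R <= N%:R.
  by move=> z0 z1; rewrite mulr_ge0//= ler_piMl.
apply: (@le_lt_trans _ _ (L * `|x * N%:R - y * N%:R| * `|c^-1|)).
  by rewrite ler_wpM2r// hL ?xN.
rewrite -mulrBl normrM normr_nat.
have -> : L * (`|x - y| * N%:R) * `|c^-1| = (C - 1) * `|x - y| by rewrite /C; ring.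
apply: (@le_lt_trans _ _ (C * `|x - y|)); last by rewrite mulrC -ltr_pdivlMr.
by rewrite ler_wpM2r//; lra.
Qed.

Lemma nat_above x : exists J, forall j, (J <= j)%N -> x <= j%:R.
Proof.
exists (Num.truncn x).+1 => j Jj; apply: (le_trans (ltW (truncnS_gt x))).
by rewrite ler_nat.
Qed.

Definition hat (sigma : R) n s t := interp s (t * n%:R) / (sigma * Num.sqrt n%:R).

(* Removing the first [m] steps changes the rescaled path little: time and space
   are rescaled by [(j + m) / j] and its square root, and the first [m] values
   are [O(1 / sqrt j)]. *)
Lemma hat_shift_close (sigma : R) m B (g : R -> R) : 0 < sigma -> 0 <= B -> cont01 g ->
  forall e : R, 0 < e -> exists2 del : R, 0 < del & exists J, forall j, (J <= j)%N ->
  forall p, (forall i, (i <= m)%N -> `|p i| <= B) ->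
  (forall t, 0 <= t <= 1 -> `|g t - hat sigma j (fun i => p (m + i)%N) t| <= del) ->
  forall t, 0 <= t <= 1 -> `|g t - hat sigma (j + m) p t| <= e.
Proof.
move=> sg0 B0 cg e e0; have e40 : 0 < e / 4 by rewrite divr_gt0.
have [eta eta0 heta] := cont01_unif cg e40.
have [M M0 hM] := cont01_bounded cg.
have [J1 hJ1] := nat_above (m%:R / eta + 1).
have [J2 hJ2] := nat_above (m%:R * M / (e / 4)).
have [J3 hJ3] := nat_above ((B / (sigma * (e / 4))) ^+ 2).
exists (e / 4) => //; exists (maxn (maxn J1 J2) (maxn J3 1)) => j.
rewrite !geq_max => /andP[/andP[/hJ1 h1 /hJ2 h2] /andP[/hJ3 h3 j1]] p pB hp t t01.
have j0 : 0 < j%:R :> R by rewrite ltr0n.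
set n := (j + m)%N; have nE : n%:R = j%:R + m%:R :> R by rewrite natrD.
have m0 : 0 <= m%:R :> R by [].
have n0 : 0 < n%:R :> R by rewrite nE ltr_pwDl.
have sj0 : 0 < Num.sqrt j%:R :> R by rewrite sqrtr_gt0.
have sn0 : 0 < Num.sqrt n%:R :> R by rewrite sqrtr_gt0.
have sjn : Num.sqrt j%:R <= Num.sqrt n%:R :> R by rewrite ler_wsqrtr// nE lerDl.
have mj : m%:R / j%:R < eta.
  by rewrite ltr_pdivrMr// mulrC -ltr_pdivrMr//; lra.
have mjM : m%:R / j%:R * M <= e / 4.
  by rewrite mulrAC ler_pdivrMr// [leRHS]mulrC -ler_pdivrMr.
have Bj : B / (sigma * Num.sqrt j%:R) <= e / 4.
  have : B / (sigma * (e / 4)) <= Num.sqrt j%:R.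
    have q0 : 0 <= B / (sigma * (e / 4)).
      by rewrite divr_ge0// mulr_ge0// ltW.
    by rewrite -[leLHS](ger0_norm q0) -sqrtr_sqr ler_wsqrtr.
  rewrite ler_pdivrMr ?mulr_gt0// => h4.
  rewrite ler_pdivrMr ?mulr_gt0//; apply: (le_trans h4).
  by rewrite le_eqVlt; apply/orP; left; apply/eqP; ring.
have Bn : B / (sigma * Num.sqrt n%:R) <= e / 4.
  apply: le_trans Bj; rewrite ler_wpM2l// lef_pV2 ?posrE ?mulr_gt0//.
  by rewrite ler_pM2l.
have /andP[t0 t1] := t01.
(* Beyond the first [m] steps the shifted path is read at the time [th] near [t]. Within them [t] is
   near [0], and both rescaled paths, at [t] and at [0], are of size [O(1 / sqrt j)]. *)
have [mt|tm] := lerP (m%:R) (t * n%:R).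
  set r := t * n%:R - m%:R; have r0 : 0 <= r by rewrite subr_ge0.
  pose th := r / j%:R.
  have th01 : 0 <= th <= 1.
    rewrite (divr_ge0 r0 (ltW j0))/= ler_pdivrMr// mul1r /r lerBlDr -nE.
    by rewrite ler_piMl// ltW.
  pose c := Num.sqrt j%:R / Num.sqrt n%:R : R.
  have c0 : 0 <= c by rewrite divr_ge0// ltW.
  have c1 : c <= 1 by rewrite ler_pdivrMr// mul1r.
  have -> : hat sigma n p t = c * hat sigma j (fun i => p (m + i)%N) th.
    rewrite /hat [th * _]mulfVK ?gt_eqF// -interp_shift// /r [m%:R + _]addrC subrK.
    rewrite /c; field; by rewrite !gt_eqF.
  have a1 : `|g t - g th| < e / 4.
    apply: heta => //; apply: le_lt_trans mj.
    rewrite /th /r nE (_ : t - _ = (m%:R / j%:R) * (1 - t)); last by field; rewrite gt_eqF.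
    have q0 : 0 <= m%:R / j%:R :> R by exact: divr_ge0 m0 (ltW j0).
    have q1 : 0 <= 1 - t by rewrite subr_ge0.
    by rewrite (ger0_norm (mulr_ge0 q0 q1)) ler_piMr// gerBl.
  have a2 : `|g th - c * g th| <= e / 4.
    rewrite -{1}[g th]mul1r -mulrBl normrM ger0_norm ?subr_ge0//.
    apply: le_trans mjM; apply: ler_pM => //; first by rewrite subr_ge0.
      have cc : c * c = j%:R / n%:R.
        rewrite /c mulrACA -expr2 sqr_sqrtr//; congr (_ * _).
        by rewrite -invfM -expr2 sqr_sqrtr.
      have h5 : c * c <= c by rewrite ler_piMr.
      have h6 : 1 - j%:R / n%:R <= m%:R / j%:R :> R.
        have -> : 1 - j%:R / n%:R = m%:R / n%:R :> R.
          by rewrite nE; field; rewrite -nE gt_eqF.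
        by rewrite ler_wpM2l// lef_pV2 ?posrE// nE lerDl.
      by move: h5; rewrite cc; lra.
    exact: hM.
  have a3 : `|c * g th - c * hat sigma j (fun i => p (m + i)%N) th| <= e / 4.
    rewrite -mulrBr normrM ger0_norm//; apply: (@le_trans _ _ (1 * (e / 4))); last by rewrite mul1r.
    by apply: ler_pM => //; exact: hp.
  have := ler_normD (g t - g th) (g th - c * g th + (c * g th - c * hat sigma j (fun i => p (m + i)%N) th)).
  have := ler_normD (g th - c * g th) (c * g th - c * hat sigma j (fun i => p (m + i)%N) th).
  by rewrite !addrA !subrK; lra.
have tn0 : 0 <= t * n%:R by rewrite mulr_ge0// ltW.
have im := ipart_lt tn0 tm.
have b1 : `|hat sigma n p t| <= e / 4.
  apply: le_trans Bn; rewrite /hat normrM [`|(_ * _)^-1|]ger0_norm; last first.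
    by rewrite invr_ge0 mulr_ge0// ltW.
  rewrite ler_wpM2r//; first by rewrite invr_ge0 mulr_ge0// ltW.
  rewrite -[interp _ _]subr0; apply: interp_close => //; rewrite subr0; apply: pB => //.
  exact: ltnW.
have z01 : 0 <= (0 : R) <= (1 : R) by rewrite lexx ler01.
have b2 : `|g t - g 0| < e / 4.
  apply: heta => //; rewrite subr0 ger0_norm//; apply: le_lt_trans mj.
  apply: (@le_trans _ _ (m%:R / n%:R)); first by rewrite ler_pdivlMr// ltW.
  by rewrite ler_wpM2l// lef_pV2 ?posrE// nE lerDl.
have b3 := hp 0 z01.
have b4 : `|hat sigma j (fun i => p (m + i)%N) 0| <= e / 4.
  apply: le_trans Bj; rewrite /hat mul0r /interp (_ : ipart 0 = 0%N); last first.
    by apply: ipart_eq; rewrite lexx ltr01.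
  rewrite subr0 mul0r addr0 addn0 normrM [`|(_ * _)^-1|]ger0_norm; last first.
    by rewrite invr_ge0 mulr_ge0// ltW.
  by rewrite ler_wpM2r ?pB// invr_ge0 mulr_ge0// ltW.
have := ler_normD (g t - g 0) (g 0 - hat sigma j (fun i => p (m + i)%N) 0 +
   hat sigma j (fun i => p (m + i)%N) 0 - hat sigma n p t).
have := ler_normD (g 0 - hat sigma j (fun i => p (m + i)%N) 0)
   (hat sigma j (fun i => p (m + i)%N) 0 - hat sigma n p t).
have := ler_normB (hat sigma j (fun i => p (m + i)%N) 0) (hat sigma n p t).
by rewrite !addrA !subrK; lra.
Qed.

End Interpolation.

(** * Measurability and comparison of functionals *)

Section Functionals.
Context {R : realType}.
Implicit Types (f : (R -> R) -> R) (g h : R -> R) (t : R).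

(** Only continuity of [f] at continuous paths is available. A path is approximated by interpolating
    its grid values, rounded to multiples of [1 / N.+1]. At each level there are countably many
    approximants, each used on a measurable event, and [f] of them converges pointwise. *)
Lemma measurable_functional d (Om : measurableType d) (W : Om -> R -> R) f :
  cont_process W -> bounded_cont_functional f ->
  measurable_fun setT (fun w => f (W w)).
Proof.
move=> [mW cW] [_ cf].
pose pt (N i : nat) : R := (minn i N)%:R / N%:R.
have pt01 N i : (0 < N)%N -> 0 <= pt N i <= 1.
  move=> N0; rewrite /pt divr_ge0//= ler_pdivrMr ?ltr0n// mul1r ler_nat.
  exact: geq_minr.
pose vec (N : nat) (w : Om) : {ffun 'I_N.+2 -> int} :=
  [ffun i : 'I_N.+2 => Num.floor (N.+1%:R * W w (pt N.+1 i))].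
pose path (N : nat) (a : {ffun 'I_N.+2 -> int}) (i : nat) : R :=
  (a (inord (minn i N.+1)))%:~R / N.+1%:R.
pose F N (a : {ffun 'I_N.+2 -> int}) := f (fun t => interp (path N a) (t * N.+1%:R) / 1).
apply: (measurable_fun_cvg (h := fun N w => F N (vec N w))).
  move=> N _ B mB; rewrite setTI.
  rewrite (_ : _ @^-1` B = [set w | exists n, exists2 a, unpickle n = Some a &
     B (F N a) /\ vec N w = a]); last first.
    apply/seteqP; split=> w /=; last by move=> [n [a _ [Ba ->]]].
    by move=> Bw; exists (pickle (vec N w)), (vec N w); rewrite ?pickleK.
  apply: measurable_exP => n; case: (unpickle n) => [a|]; last first.
    by rewrite (_ : [set w | _] = set0)//; apply/seteqP; split=> w // -[].
  rewrite (_ : [set w | _] = [set w | B (F N a) /\ vec N w = a]); last first.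
    by apply/seteqP; split=> w /=; [move=> [_ [<-]]|exists a].
  apply: measurable_andP; first exact: measurable_cstP.
  rewrite (_ : [set w | _] = [set w | forall i : nat, (i < N.+2)%N ->
     Num.floor (N.+1%:R * W w (pt N.+1 i)) = a (inord i)]); last first.
    apply/seteqP; split=> w /=; first by move=> <- i iN; rewrite ffunE inordK.
    by move=> h; apply/ffunP => i; rewrite ffunE h// inord_val.
  apply: measurable_allP => i; apply: measurable_implP; first exact: measurable_cstP.
  set z := a (inord i).
  rewrite (_ : [set w | _] = setT `&` (fun w => N.+1%:R * W w (pt N.+1 i)) @^-1`
     `[z%:~R, (z + 1)%:~R[%classic).
    by apply: measurable_funM => //; apply: mW; exact: pt01.
  rewrite setTI; apply/seteqP; split=> w /=; rewrite in_itv/=.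
    by move=> <-; exact: floor_itv.
  by move=> /floor_def.
move=> w _; apply/cvgrPdist_le => e e0.
have [del del0 H] := cf (W w) (cW w) e e0.
have d20 : 0 < del / 2 by rewrite divr_gt0.
have [eta eta0 heta] := cont01_unif (cW w) d20.
near=> N; apply: ltW; apply: H; first exact: cont01_interp.
move=> t t01; have /andP[t0 t1] := t01; rewrite divr1 distrC.
have N0 : 0 < N.+1%:R :> R by rewrite ltr0n.
have Neta : N.+1%:R^-1 < eta.
  by near: N; exact: (near_infty_natSinv_lt (PosNum eta0)).
have Ndel : N.+1%:R^-1 < del / 2.
  by near: N; exact: (near_infty_natSinv_lt (PosNum d20)).
have tN0 : 0 <= t * N.+1%:R by rewrite mulr_ge0// ltW.
have tN1 : t * N.+1%:R <= N.+1%:R by rewrite ler_piMl// ltW.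
have pathP i : `|path N (vec N w) i - W w (pt N.+1 i)| <= del / 2.
  rewrite /path ffunE inordK; last by rewrite ltnS geq_minr.
  have -> : pt N.+1 (minn i N.+1) = pt N.+1 i by rewrite /pt -minnA minnn.
  have /andP[h1 h2] := floor_itv (N.+1%:R * W w (pt N.+1 i)).
  apply: le_trans (ltW Ndel).
  set z := Num.floor _ in h1 h2 *; set v := W w _ in h1 h2 *.
  have -> : z%:~R / N.+1%:R - v = (z%:~R - N.+1%:R * v) / N.+1%:R.
    by field; rewrite gt_eqF.
  rewrite normrM [`|_^-1|]ger0_norm ?invr_ge0 ?(ltW N0)//.
  rewrite -[leRHS]mul1r ler_pM2r ?invr_gt0// ler_norml.
  by move: h2; rewrite intrD => h2; apply/andP; split; lra.
have close i : `|pt N.+1 i - t| < eta -> `|path N (vec N w) i - W w t| <= del.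
  move=> h; have h1 := heta (pt N.+1 i) t (pt01 _ i (ltn0Sn N)) t01 h.
  have := ler_normD (path N (vec N w) i - W w (pt N.+1 i)) (W w (pt N.+1 i) - W w t).
  by rewrite addrA subrK; have := pathP i; lra.
have /andP[i1 i2] := ipart_itv tN0.
have iN := ipart_le tN0 tN1.
set m := ipart _ in i1 i2 iN *.
apply: interp_close => //; rewrite -/m; apply: close.
  rewrite /pt (minn_idPl iN) -normrN opprB ger0_norm; last first.
    by rewrite subr_ge0 ler_pdivrMr.
  apply: le_lt_trans Neta; rewrite lerBlDr -[t](@mulfK _ N.+1%:R) ?gt_eqF//.
  rewrite -{2}[N.+1%:R^-1]mul1r -mulrDl ler_pM2r ?invr_gt0//.
  by move: i2; rewrite -natr1; lra.
apply: le_lt_trans Neta; rewrite /pt.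
have [mN|mN] := leqP m.+1 N.+1.
  rewrite ger0_norm; last by rewrite subr_ge0 ler_pdivlMr// ltW.
  rewrite lerBlDr -[t](@mulfK _ N.+1%:R) ?gt_eqF//.
  rewrite -{2}[N.+1%:R^-1]mul1r -mulrDl ler_pM2r ?invr_gt0// -natr1.
  by move: i1; lra.
have mE : m = N.+1 by apply/eqP; rewrite eqn_leq iN.
rewrite divff ?gt_eqF// (_ : t = 1) ?subrr ?normr0 ?invr_ge0 ?(ltW N0)//.
apply/eqP; rewrite eq_le t1/= -(ler_pM2r N0) mul1r.
by rewrite mE in i1.
Unshelve. all: by end_near.
Qed.

(* Extended continuous mapping without tightness: the discrepancy between
   [f (Y' n w)] and [f (Y n w)] is dominated by the Lipschitz sup-convolutions
   [F N] below, evaluated at [Y n w], and these decrease to zero pointwise. *)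
Lemma functional_defect (Om : Type) (Y Y' : nat -> Om -> R -> R) f :
  bounded_cont_functional f ->
  (forall n w, cont01 (Y n w)) -> (forall n w, cont01 (Y' n w)) ->
  (forall g, cont01 g -> forall e : R, 0 < e -> exists2 del : R, 0 < del &
     exists N, forall n, (N <= n)%N -> forall w,
     (forall t, 0 <= t <= 1 -> `|g t - Y n w t| <= del) ->
     forall t, 0 <= t <= 1 -> `|g t - Y' n w t| <= e) ->
  exists (F : nat -> (R -> R) -> R) (M : R),
    [/\ forall N, bounded_cont_functional (F N),
        forall N g, 0 <= F N g <= M,
        forall N n w, (N <= n)%N -> `|f (Y' n w) - f (Y n w)| <= F N (Y n w)
      & forall g, cont01 g -> (fun N => F N g) @ \oo --> (0 : R)].
Proof.
move=> [[M0 hM0] cf] cY cY' H.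
have M00 : 0 <= M0 by apply: le_trans (hM0 (fun=> 0)).
pose M := 2 * M0; have MM : 0 <= M by rewrite mulr_ge0.
pose A N g := [set x : R | x = 0 \/ exists n w (c : R), [/\ (N <= n)%N, 0 <= c,
   forall t, 0 <= t <= 1 -> `|g t - Y n w t| <= c &
   x = `|f (Y' n w) - f (Y n w)| - N%:R * c]].
have dM n w : `|f (Y' n w) - f (Y n w)| <= M.
  apply: (le_trans (ler_normB _ _)); rewrite /M.
  by have := hM0 (Y' n w); have := hM0 (Y n w); lra.
have ubA N g : ubound (A N g) M.
  move=> _ [->//|[n [w [c [_ c0 _ ->]]]]]; rewrite lerBlDr.
  by apply: (le_trans (dM n w)); rewrite lerDl mulr_ge0.
have A0 N g : A N g 0 by left.
pose F N g := sup (A N g).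
have F0 N g : 0 <= F N g by apply: ub_le_sup; [exists M; exact: ubA|exact: A0].
have FM N g : F N g <= M by apply: ge_sup; [exists 0; exact: A0|exact: ubA].
have lip N g h (c : R) : 0 <= c -> (forall t, 0 <= t <= 1 -> `|g t - h t| <= c) ->
    F N g <= F N h + N%:R * c.
  move=> c0 gh; apply: ge_sup; first by exists 0; exact: A0.
  move=> _ [->|[n [w [c1 [Nn c10 hc ->]]]]]; first by rewrite addr_ge0// mulr_ge0.
  rewrite -lerBlDr; apply: ub_le_sup; first by exists M; exact: ubA.
  right; exists n, w, (c1 + c); split=> //; first exact: addr_ge0.
    move=> t t01; have := ler_normD (h t - g t) (g t - Y n w t).
    by rewrite addrA subrK [`|h t - g t|]distrC; have := hc t t01; have := gh t t01; lra.
  by rewrite mulrDr opprD addrA.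
exists F, M; split=> [N|N g|N n w Nn|g cg].
- split; first by exists M => g; rewrite ger0_norm.
  move=> g cg e e0; exists (e / (N%:R + 1) / 2); first by rewrite !divr_gt0// ltr_wpDl.
  move=> h ch gh; set c := e / (N%:R + 1) / 2 in gh *.
  have N1 : 0 < N%:R + 1 :> R by rewrite ltr_wpDl.
  have c0 : 0 < c by rewrite !divr_gt0.
  have Nc : N%:R * c < e.
    rewrite /c; have -> : N%:R * (e / (N%:R + 1) / 2) = e * (N%:R / (N%:R + 1)) / 2 by field; rewrite gt_eqF.
    have q1 : N%:R / (N%:R + 1) <= 1 :> R by rewrite ler_pdivrMr// mul1r lerDl.
    have := ler_wpM2l (ltW e0) q1; lra.
  have h1 := lip N g h c (ltW c0) gh.
  have hg t : 0 <= t <= 1 -> `|h t - g t| <= c by rewrite distrC; exact: gh.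
  have h2 := lip N h g c (ltW c0) hg.
  by rewrite ltr_norml; apply/andP; split; lra.
- by rewrite F0 FM.
- apply: ub_le_sup; first by exists M; exact: ubA.
  right; exists n, w, 0; split=> //; last by rewrite mulr0 subr0.
  by move=> t _; rewrite subrr normr0.
- apply/cvgrPdist_le => e e0; have e20 : 0 < e / 2 by rewrite divr_gt0.
  have [d1 d10 h1] := cf g cg _ e20.
  have [d2 d20 [N0 h2]] := H g cg d1 d10.
  pose dd := Num.min d1 d2; have dd0 : 0 < dd by rewrite lt_min d10.
  have [J hJ] := nat_above (M / dd).
  exists (maxn N0 J) => // N /=; rewrite geq_max => /andP[N0N /hJ JN].
  rewrite sub0r normrN ger0_norm//; apply: ge_sup; first by exists 0; exact: A0.
  move=> _ [->|[n [w [c [Nn c0 hc ->]]]]]; first exact: ltW.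
  have [cd|dc] := lerP c dd; last first.
    have : M <= N%:R * c.
      move: JN; rewrite ler_pdivrMr// => h; apply: (le_trans h).
      by rewrite ler_wpM2l// ltW.
    by have := dM n w; lra.
  have cd1 : c <= d1 by apply: (le_trans cd); rewrite ge_min lexx.
  have cd2 : c <= d2 by apply: (le_trans cd); rewrite ge_min lexx orbT.
  have a1 : `|f g - f (Y n w)| < e / 2.
    by apply: h1 => // t t01; exact: le_trans (hc t t01) cd1.
  have a2 : `|f g - f (Y' n w)| < e / 2.
    apply: h1 => // t t01; apply: (h2 n) => //; first exact: leq_trans Nn.
    by move=> t' t'01; exact: le_trans (hc t' t'01) cd2.
  have := ler_normD (f (Y' n w) - f g) (f g - f (Y n w)).
  rewrite addrA subrK [`|f (Y' n w) - f g|]distrC.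
  have : 0 <= N%:R * c by rewrite mulr_ge0.
  lra.
Qed.

End Functionals.

(** * The Markov property at crossing times *)

Section CrossingMarkov.
Context {R : realType} {dT : measure_display} {T : measurableType dT}.
Local Notation E := (canon R T).
Variable lam : probability E R.
Hypothesis lam_iid : iid_law lam.
Variable K : nat -> T -> R -> bool.
Hypothesis mK : forall i, measurable [set p : T * R | K i p.1 p.2].
Local Open Scope ereal_scope.
Implicit Types y z : R.

Definition Al y k m : set E :=
  [set e | alive K (fun i => cU i e) (walk cX y e) k m].
(** Unlike the event in (C1), this one excludes the paths with [T_k = tau = +oo]. *)
Definition AA y k : set E := \bigcup_m Al y k m.
Definition Sk y k (e : E) : R :=
  walk cX y e (odflt 0%N (cross (walk cX y e) k)).

Lemma measurable_cU i : measurable_fun setT (cU i : E -> T).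
Proof. exact: measurable_coord2. Qed.

Lemma measurable_Al y k m : measurable (Al y k m).
Proof. by apply: measurable_alive => // i; [exact: measurable_cwalk|exact: measurable_cU]. Qed.

Lemma measurable_AA y k : measurable (AA y k).
Proof. by apply: bigcupT_measurable => m; exact: measurable_Al. Qed.

Lemma AlSk y k m e : Al y k m e -> Sk y k e = walk cX y e m.
Proof. by move=> [E _]; rewrite /Sk E. Qed.

Lemma Al_uniq y k m m' e : Al y k m e -> Al y k m' e -> m = m'.
Proof. by move=> [E _] [E' _]; move: E'; rewrite E => -[]. Qed.

Lemma Al_trivIset y k : trivIset setT (Al y k).
Proof. by apply/trivIsetP => i j _ _ ij; apply/seteqP; split=> // e [/Al_uniq h /h] /eqP; rewrite (negbTE ij). Qed.

Lemma measurable_Sk y k : measurable_fun setT (Sk y k).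
Proof.
move=> _ B mB; rewrite setTI.
rewrite (_ : _ @^-1` B = [set e | (exists m, cross (walk cX y e) k = Some m /\ B (walk cX y e m)) \/
    ((forall m, ~ cross (walk cX y e) k = Some m) /\ B y)]); last first.
  apply/seteqP; split=> e; rewrite /= /Sk.
    by case: cross => [m|] /= h; [left; exists m|right; rewrite walk0 in h].
  by case: cross => [m|] /= [[m' [//]]|]; [case=> -> |move=> [/(_ m)]|move=> [_]; rewrite walk0].
apply: measurable_orP.
  apply: measurable_exP => m; apply: measurable_andP.
    by apply: measurable_cross => i; exact: measurable_cwalk.
  by rewrite -[X in measurable X]setTI; exact: (measurable_cwalk y m).
apply: measurable_andP; last exact: measurable_cstP.
apply: measurable_allP => m; apply: measurable_notP.
by apply: measurable_cross => i; exact: measurable_cwalk.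
Qed.

Lemma Al_splice y k m e e' : Al y k m (splice m k (e, e')) <-> Al y k m e.
Proof.
split; apply: alive_local => i im.
- exact: walk_splice_le.
- by rewrite /cU/= im.
- by rewrite walk_splice_le.
- by rewrite /cU/= im.
Qed.

Lemma splice_walk_shift y k m (e e' : E) :
  (fun j => walk cX y (splice m k (e, e')) (m + j)%N) = walk cX (walk cX y e m) e'.
Proof. by apply/funext => j; exact: walk_splice. Qed.

Lemma splice_U_shift k m (e e' : E) :
  (fun i => cU (k + i)%N (splice m k (e, e'))) = (fun i => cU i e').
Proof. by apply/funext => i; rewrite /cU/= ltnNge leq_addr/= addKn. Qed.

Lemma Al_splice_shift y k m l j e e' : Al y k m e ->
  Al y (k + l) (m + j) (splice m k (e, e')) <-> Al (walk cX y e m) l j e'.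
Proof.
move=> /(Al_splice y k m e e').2 h; rewrite {1}/Al /mkset (alive_shift _ _ _ _ _ _ _ h).
by rewrite splice_walk_shift splice_U_shift.
Qed.

Lemma tau_splice_shift y k m j e e' : Al y k m e ->
  olt (m + j) (tau cX cU K y (splice m k (e, e'))) <->
  olt j (tau cX cU K (walk cX y e m) e').
Proof.
move=> /(Al_splice y k m e e').2 h; rewrite {1}/tau (absorb_shift_olt _ _ _ _ _ _ h).
by rewrite splice_walk_shift splice_U_shift.
Qed.

Lemma Tk_splice_shift y k m l j e e' : Al y k m e ->
  olt (m + j) (Tk cX y (k + l) (splice m k (e, e'))) <->
  olt j (Tk cX (walk cX y e m) l e').
Proof.
move=> /(Al_splice y k m e e').2 [h _].
by rewrite {1}/Tk (cross_shift _ _ _ _ h) olt_omap splice_walk_shift.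
Qed.

(** The Markov property on an event of the past, recognised as such by its invariance under splicing
    of the future. *)
Lemma integral_past m k (D : set E) (G : E -> \bar R) : measurable D ->
  (forall e e', D (splice m k (e, e')) <-> D e) ->
  measurable_fun setT G -> (forall e, 0 <= G e) ->
  \int[lam]_(e in D) G e = \int[lam]_(e in D) \int[lam]_e' G (splice m k (e, e')).
Proof.
move=> mD Ds mG G0; rewrite integral_mkcond [RHS]integral_mkcond.
rewrite (integral_splice lam_iid m k); first last.
- by move=> e; rewrite /patch; case: ifP.
- by apply/(measurable_restrictT _ mD); exact: measurable_funTS.
apply: eq_integral => e _; rewrite /patch.
have Dsb e' : (splice m k (e, e') \in D) = (e \in D).
  by apply/idP/idP; rewrite !inE => /Ds.
case: ifP => eD; first by apply: eq_integral => e' _; rewrite Dsb eD.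
by apply: integral0_eq => e' _; rewrite Dsb eD.
Qed.

Lemma measurable_splice_integral m k (G : E -> \bar R) : measurable_fun setT G ->
  (forall e, 0 <= G e) ->
  measurable_fun setT (fun e => \int[lam]_e' G (splice m k (e, e'))).
Proof.
move=> mG G0.
apply: (measurable_fun_fubini_tonelli_F (m2 := lam) (G \o splice m k)).
  exact: (measurableT_comp mG (measurable_splice m k)).
by move=> p; exact: G0.
Qed.

Lemma measurable_splice_future m k e : measurable_fun setT (fun e' => splice m k (e, e') : E).
Proof.
by apply: (measurableT_comp (measurable_splice m k)); exact: measurable_fun_pair.
Qed.

Lemma prob_past m k (D B : set E) : measurable D -> measurable B ->
  (forall e e', D (splice m k (e, e')) <-> D e) ->
  lam (D `&` B) = \int[lam]_(e in D) lam [set e' | B (splice m k (e, e'))].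
Proof.
move=> mD mB Ds; rewrite setIC -(integral_indic lam mD mB).
rewrite [LHS](integral_past mD Ds); first last.
- by move=> e; rewrite lee_fin.
- exact/measurable_EFinP/measurable_indic.
apply: eq_integral => e _; set B' := [set e' | _].
have mB' : measurable B'.
  by rewrite -[B']setTI; exact: (measurable_splice_future m k e measurableT mB).
rewrite -(setIT B') -(integral_indic lam measurableT mB').
apply: eq_integral => e' _; rewrite !indicE.
have -> // : (splice m k (e, e') \in B) = (e' \in B').
by apply/idP/idP; rewrite !inE.
Qed.

Lemma prob_past_le m k (D B : set E) (phi : E -> \bar R) : measurable D -> measurable B ->
  (forall e e', D (splice m k (e, e')) <-> D e) ->
  measurable_fun D phi ->
  (forall e, D e -> lam [set e' | B (splice m k (e, e'))] <= phi e) ->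
  lam (D `&` B) <= \int[lam]_(e in D) phi e.
Proof.
move=> mD mB Ds mphi h; rewrite (prob_past mD mB Ds); apply: ge0_le_integral => //.
apply: measurable_funTS.
have := measurable_splice_integral m k (G := fun e => (\1_B e)%:E).
have -> : (fun e => \int[lam]_e' (\1_B (splice m k (e, e')))%:E) =
    (fun e => lam [set e' | B (splice m k (e, e'))]).
  apply/funext => e; set B' := [set e' | _].
  have mB' : measurable B'.
    by rewrite -[B']setTI; exact: (measurable_splice_future m k e measurableT mB).
  rewrite -(setIT B') -(integral_indic lam measurableT mB').
  apply: eq_integral => e' _; rewrite !indicE.
  have -> // : (splice m k (e, e') \in B) = (e' \in B').
  by apply/idP/idP; rewrite !inE.
by apply=> [|e]; [exact/measurable_EFinP/measurable_indic|rewrite lee_fin].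
Qed.

Variables (c gam : R).
Hypotheses (c0 : (0 < c)%R) (gam0 : (0 < gam)%R) (gam1 : (gam < 1)%R).
Hypothesis C1 : forall y k,
  lam [set e | ole (Tk cX y k e) (tau cX cU K y e)] <= (c * gam ^+ k)%:E.

Lemma AA_mass y k : lam (AA y k) <= (c * gam ^+ k)%:E.
Proof.
apply: le_trans (C1 y k); apply: le_measure; rewrite ?inE; first exact: measurable_AA.
  rewrite (_ : [set e | _] = [set e | (exists m, Al y k m e) \/
     ((forall m, ~ cross (walk cX y e) k = Some m) /\
      forall n, olt n (tau cX cU K y e))]).
    apply: measurable_orP; first by apply: measurable_exP => m; exact: measurable_Al.
    apply: measurable_andP; apply: measurable_allP => m.
      apply: measurable_notP.
      by apply: measurable_cross => i; exact: measurable_cwalk.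
    by apply: measurable_olt_absorb => // i; [exact: measurable_cwalk|exact: measurable_cU].
  apply/seteqP; split=> e; rewrite /= /Tk /tau.
    case E1 : (cross (walk cX y e) k) => [m|] h; first by left; exists m; split.
    by right; split=> // n; case: absorb h.
  move=> [[m [E1 h]]|[h1 h2]]; first by rewrite E1.
  case E1 : (cross (walk cX y e) k) => [m|]; first by case: (h1 m).
  by case E2 : absorb => [n|//]; have := h2 n; rewrite E2/= ltnn.
by move=> e [m _ [h1 h2]]; rewrite /= /Tk h1.
Qed.

Lemma integral_AA y k (phi : E -> \bar R) : measurable_fun setT phi ->
  (forall e, 0 <= phi e) ->
  \int[lam]_(e in AA y k) phi e = \sum_(0 <= m <oo) \int[lam]_(e in Al y k m) phi e.
Proof.
move=> mphi phi0; rewrite ge0_integral_bigcup//.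
- by move=> m; exact: measurable_Al.
- exact: measurable_funTS.
- exact: Al_trivIset.
Qed.

Lemma Al_succ y k m' e : Al y k.+1 m' e ->
  exists2 m, Al y k m e & (m < m')%N /\ cross (fun j => walk cX y e (m + j)%N) 1 = Some (m' - m)%N.
Proof.
move=> A'; have [m Am _] := alive_mono _ _ _ _ _ _ (leqnSn k) A'.
exists m => //; have [cm _] := Am; have [cm' _] := A'.
move: cm'; rewrite -addn1 (cross_shift _ _ _ _ cm).
case E1 : (cross _ 1) => [t|//] /= [<-]; rewrite addKn; split=> //.
by have := cross_ge _ _ _ E1; rewrite -{1}[m]addn0 ltn_add2l.
Qed.

Lemma nneseries_le_bound (a : nat -> \bar R) (B : \bar R) : (forall n, 0 <= a n) ->
  (forall N, \sum_(0 <= i < N) a i <= B) -> \sum_(0 <= i <oo) a i <= B.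
Proof.
move=> a0 h; apply: lime_le; first exact: is_cvg_nneseries.
exact: nearW.
Qed.

Lemma nneseries_partial_le (a : nat -> \bar R) N : (forall n, 0 <= a n) ->
  \sum_(0 <= i < N) a i <= \sum_(0 <= i <oo) a i.
Proof.
move=> a0; rewrite (nneseries_split 0%N N)// add0n leeDl//.
exact: nneseries_ge0.
Qed.

Definition absSk y k e : R := `|Sk y k e|%R.

Lemma measurable_absSk y k : measurable_fun setT (absSk y k).
Proof. exact: measurableT_comp (@normr_measurable R setT) (measurable_Sk y k). Qed.

(** The modulus of [S_{T_(k+1)}] is the overshoot of the excursion begun at [T_k]. Survival during
    that excursion is dropped, the past being weighted by survival up to [T_k]; (C1) bounds the mass
    multiplying [Ce]. *)
Lemma crossing_mean_step (eps Ce : R) y k : (0 <= eps)%R -> (0 <= Ce)%R ->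
  (forall b n z, (0 <= z)%R = b -> exit_mean lam b n z <= (eps * `|z| + Ce)%:E) ->
  \int[lam]_(e in AA y k.+1) (absSk y k.+1 e)%:E <=
  eps%:E * \int[lam]_(e in AA y k) (absSk y k e)%:E + (Ce * (c * gam ^+ k))%:E.
Proof.
move=> eps0 Ce0 hex.
have mabs k' : measurable_fun setT (fun e => (absSk y k' e)%:E).
  by apply/measurable_EFinP; exact: measurable_absSk.
have abs0 k' e : 0 <= (absSk y k' e)%:E by rewrite lee_fin normr_ge0.
rewrite integral_AA//; apply: nneseries_le_bound => [m|N].
  by apply: integral_ge0 => e _.
(* A finite horizon suffices: if [T_(k+1) < N], this crossing is seen within [N] steps after
   [T_k]. *)
pose ov (N m : nat) (e : E) := (overshoot (0 <= walk cX y e m)%R N (fun j => walk cX y e (m + j)%N))%:E.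
have ov0 m e : 0 <= ov N m e by rewrite lee_fin overshoot_ge0.
have mov m : measurable_fun setT (ov N m).
  apply/measurable_EFinP.
  rewrite (_ : (fun _ => _) = fun e => if (0 <= walk cX y e m)%R == true then
     overshoot true N (fun j => walk cX y e (m + j)%N) else
     overshoot false N (fun j => walk cX y e (m + j)%N)); last first.
    by apply/funext => e; case: (0 <= _)%R.
  apply: measurable_fun_ifT.
  - exact: (measurableT_comp (measurable_sideb true) (measurable_cwalk y m)).
  - by apply: measurable_overshoot => j; exact: measurable_cwalk.
  - by apply: measurable_overshoot => j; exact: measurable_cwalk.
apply: (@le_trans _ _ (\sum_(0 <= m < N) \int[lam]_(e in Al y k m) ov N m e)).
  rewrite (eq_bigr (fun m => \int[lam]_e ((fun e => (absSk y k.+1 e)%:E) \_ (Al y k.+1 m)) e)); last first.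
    by move=> m _; rewrite integral_mkcond.
  rewrite [leRHS](eq_bigr (fun m => \int[lam]_e ((ov N m) \_ (Al y k m)) e)); last first.
    by move=> m _; rewrite integral_mkcond.
  have mA1 m : measurable_fun setT ((fun e => (absSk y k.+1 e)%:E) \_ (Al y k.+1 m)).
    by apply/(measurable_restrictT _ (measurable_Al _ _ _)); exact: measurable_funTS.
  have mA2 m : measurable_fun setT ((ov N m) \_ (Al y k m)).
    by apply/(measurable_restrictT _ (measurable_Al _ _ _)); exact: measurable_funTS.
  have p1 m e : 0 <= ((fun e => (absSk y k.+1 e)%:E) \_ (Al y k.+1 m)) e.
    by rewrite /patch; case: ifP.
  have p2 m e : 0 <= ((ov N m) \_ (Al y k m)) e by rewrite /patch; case: ifP.
  rewrite -ge0_integral_sum// -ge0_integral_sum//; apply: ge0_le_integral => //.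
  - by move=> e _; apply: sume_ge0.
  - exact: emeasurable_sum.
  - exact: emeasurable_sum.
  move=> e _; rewrite !big_mkord.
  have [[m' A']|nA] := pselect (exists m' : 'I_N, Al y k.+1 m' e); last first.
    rewrite big1 ?sume_ge0// => m _; rewrite /patch; case: ifP => //.
    by rewrite inE => h; exfalso; apply: nA; exists m.
  rewrite (bigD1 m')//= big1 ?adde0; last first.
    move=> m mm'; rewrite /patch; case: ifP => //; rewrite inE => h.
    by move/eqP : mm'; case; apply/val_inj; exact: Al_uniq h A'.
  have [m Am [mm' c1]] := Al_succ A'.
  have mN : (m < N)%N by exact: ltn_trans (ltn_ord m').
  rewrite (bigD1 (Ordinal mN))//=; apply: (@le_trans _ _ (((ov N m) \_ (Al y k m)) e)); last first.
    by rewrite leeDl// sume_ge0.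
  rewrite /patch !ifT ?inE// /absSk (AlSk A') /ov lee_fin.
  rewrite -{1}[m]addn0 (overshoot_cross1 c1); last first.
    by rewrite (leq_trans (leq_subr _ _))// ltnW.
  by rewrite subnKC// ltnW.
apply: (@le_trans _ _ (\sum_(0 <= m < N) (eps%:E * \int[lam]_(e in Al y k m) (absSk y k e)%:E +
    Ce%:E * lam (Al y k m)))).
  apply: lee_sum => m _; rewrite (integral_past (m := m) (k := k))//; first last.
  - by move=> e e'; exact: Al_splice.
  - exact: measurable_Al.
  apply: (@le_trans _ _ (\int[lam]_(e in Al y k m) (eps%:E * (absSk y k e)%:E + Ce%:E))).
    apply: ge0_le_integral => //.
    - exact: measurable_Al.
    - by move=> e _; apply: integral_ge0.
    - by apply: measurable_funTS; exact: measurable_splice_integral.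
    - by apply: measurable_funTS; apply: emeasurable_funD => //; exact: measurable_funeM.
    - move=> e Ae; rewrite /absSk (AlSk Ae) -EFinM -EFinD.
      apply: le_trans (hex _ N _ erefl); rewrite le_eqVlt; apply/orP; left; apply/eqP.
      apply: eq_integral => e' _; rewrite /ov splice_walk_shift.
      by rewrite walk_splice_le.
  rewrite ge0_integralD//; first last.
  - by apply: measurable_funTS; exact: measurable_funeM.
  - by move=> e _; rewrite mule_ge0// lee_fin.
  - exact: measurable_Al.
  rewrite ge0_integralZl//; first last.
  - exact: measurable_funTS.
  - exact: measurable_Al.
  rewrite integral_cst//; exact: measurable_Al.
rewrite big_split/=; apply: leeD.
  rewrite -ge0_sume_distrr; last by move=> m _; apply: integral_ge0.
  rewrite integral_AA//; apply: lee_wpmul2l; first by rewrite lee_fin.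
  by apply: nneseries_partial_le => m; apply: integral_ge0.
rewrite -ge0_sume_distrr// EFinM; apply: lee_wpmul2l; first by rewrite lee_fin.
apply: le_trans (AA_mass y k).
rewrite measure_bigcup//; [|by move=> m _; exact: measurable_Al|exact: Al_trivIset].
rewrite [leRHS](eq_eseriesl _ (Q := xpredT)); last by move=> m; rewrite in_setT.
exact: nneseries_partial_le.
Qed.

End CrossingMarkov.

Lemma predn_split j k : (j < k)%N -> k.-1 = ((k - j.+1) + j)%N.
Proof. lia. Qed.

Lemma divn_ge_half n k : (0 < k)%N -> (k <= n)%N -> (n <= 2 * k * (n %/ k))%N.
Proof.
move=> k0 kn; have r0 : (0 < n %/ k)%N by rewrite divn_gt0.
have := ltn_ceil n k0; rewrite mulSn; nia.
Qed.

Lemma leq_sq n k : (n <= k)%N -> (n <= k ^ 2)%N.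
Proof. by move=> nk; nia. Qed.

(** * Moments and tails of the crossing times on survival *)

Section CrossingBounds.
Context {R : realType} {dT : measure_display} {T : measurableType dT}.
Local Notation E := (canon R T).
Variable lam : probability E R.
Hypothesis lam_iid : iid_law lam.
Variable K : nat -> T -> R -> bool.
Hypothesis mK : forall i, measurable [set p : T * R | K i p.1 p.2].
Local Open Scope ereal_scope.
Implicit Types y z : R.
Local Notation Al := (Al K).
Local Notation AA := (AA K).
Variables (c gam : R).
Hypotheses (c0 : (0 < c)%R) (gam0 : (0 < gam)%R) (gam1 : (gam < 1)%R).
Hypothesis C1 : forall y k,
  lam [set e | ole (Tk cX y k e) (tau cX cU K y e)] <= (c * gam ^+ k)%:E.
Variable CF : R.
Hypothesis CF0 : (0 <= CF)%R.
Hypothesis survival : forall n y, (0 < n)%N ->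
  lam [set e | olt n (Tk cX y 1 e)] <= (CF * (1 + `|y|) / Num.sqrt n%:R)%:E.
Hypothesis overshoots : forall eps : R, (0 < eps)%R -> exists2 Ce : R, (0 <= Ce)%R &
  forall b n z, (0 <= z)%R = b -> exit_mean lam b n z <= (eps * `|z| + Ce)%:E.
Variable x : R.

Let gamk k : (0 <= gam ^+ k)%R. Proof. by rewrite exprn_ge0// ltW. Qed.
Let mAl := measurable_Al mK.
Let mAA := measurable_AA mK.

Lemma crossing_mean : exists2 Ca : R, (0 <= Ca)%R & forall k,
  \int[lam]_(e in AA x k) (1 + absSk x k e)%:E <= (Ca * gam ^+ k)%:E.
Proof.
have g20 : (0 < gam / 2)%R by rewrite divr_gt0.
have [Ce Ce0 hCe] := overshoots g20.
(* Since [Ce * c <= gam / 2 * B], the sequence [B * gam ^ k] is a supersolution of the recursion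
   with slope [gam / 2] and source [Ce * c * gam ^ k]. *)
pose B : R := (`|x| + 2 * Ce * c / gam)%R.
have B0 : (0 <= B)%R.
  by rewrite addr_ge0// divr_ge0 ?(ltW gam0)// !mulr_ge0// ltW.
have hB k : \int[lam]_(e in AA x k) (absSk x k e)%:E <= (B * gam ^+ k)%:E.
  elim: k => [|k IH].
    apply: (@le_trans _ _ (\int[lam]_(e in AA x 0) (`|x|)%:E)).
      rewrite le_eqVlt; apply/orP; left; apply/eqP; apply: eq_integral => e _.
      by rewrite /absSk /Sk/= walk0.
    rewrite integral_cst// expr0 mulr1.
    apply: (@le_trans _ _ (`|x|%:E * 1)).
      by rewrite lee_wpmul2l// probability_le1.
    by rewrite mule1 lee_fin lerDl divr_ge0 ?(ltW gam0)// !mulr_ge0// ltW.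
  apply: (le_trans (crossing_mean_step lam_iid mK C1 x k (ltW g20) Ce0 hCe)).
  apply: (@le_trans _ _ ((gam / 2)%:E * (B * gam ^+ k)%:E + (Ce * (c * gam ^+ k))%:E)).
    by apply: leeD => //; apply: lee_wpmul2l => //; rewrite lee_fin ltW.
  rewrite -EFinM -EFinD lee_fin exprS.
  have : (Ce * c <= gam / 2 * B)%R.
    rewrite /B mulrDr (_ : gam / 2 * (2 * Ce * c / gam) = Ce * c)%R; last by field; rewrite gt_eqF.
    by rewrite lerDr mulr_ge0// ltW.
  move=> h; have := ler_wpM2r (gamk k) h; nra.
exists (B + c)%R; first by rewrite addr_ge0// ltW.
move=> k; under eq_integral do rewrite EFinD.
rewrite ge0_integralD//; first last.
- by apply: measurable_funTS; apply/measurable_EFinP; exact: measurable_absSk.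
- by move=> e _; rewrite lee_fin normr_ge0.
have -> : ((B + c) * gam ^+ k)%:E = (c * gam ^+ k)%:E + (B * gam ^+ k)%:E.
  by rewrite -EFinD mulrDl [in LHS]addrC.
rewrite integral_cst// mul1e; apply: leeD; last exact: hB.
exact: (AA_mass mK C1).
Qed.

Lemma Al_splice_le y j t m k e e' : (j <= k)%N -> (t <= m)%N ->
  Al y j t (splice m k (e, e')) <-> Al y j t e.
Proof.
move=> jk tm; split; apply: alive_local => i im.
- by rewrite walk_splice_le// (leq_trans im).
- by rewrite /cU/= (leq_trans im).
- by rewrite walk_splice_le// (leq_trans im).
- by rewrite /cU/= (leq_trans im).
Qed.

Variable Ca : R.
Hypothesis Ca0 : (0 <= Ca)%R.
Hypothesis meanS : forall k,
  \int[lam]_(e in AA x k) (1 + absSk x k e)%:E <= (Ca * gam ^+ k)%:E.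

Let mS k : measurable_fun setT (fun e : E => (1 + absSk x k e)%:E).
Proof. by apply/measurable_EFinP; apply: measurable_funD => //; exact: measurable_absSk. Qed.
Let S0 k (e : E) : 0 <= (1 + absSk x k e)%:E.
Proof. by rewrite lee_fin addr_ge0// normr_ge0. Qed.

Lemma measurable_olt_Tk y k n : measurable [set e : E | olt n (Tk cX y k e)].
Proof. by apply: measurable_olt_cross => i; exact: measurable_cwalk. Qed.

Lemma measurable_olt_tau y n : measurable [set e : E | olt n (tau cX cU K y e)].
Proof. by apply: measurable_olt_absorb => // i; [exact: measurable_cwalk|exact: measurable_cU]. Qed.

Lemma long_excursion_after j t r : (0 < r)%N ->
  lam (Al x j t `&` [set e | olt (t + r) (Tk cX x j.+1 e)]) <=
  (CF / Num.sqrt r%:R)%:E * \int[lam]_(e in Al x j t) (1 + absSk x j e)%:E.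
Proof.
move=> r0; have q0 : (0 <= CF / Num.sqrt r%:R)%R by rewrite divr_ge0.
rewrite -ge0_integralZl//; last exact: measurable_funTS.
apply: (prob_past_le (m := t) (k := j) lam_iid).
- exact: mAl.
- exact: measurable_olt_Tk.
- by move=> e e'; exact: Al_splice.
- by apply: measurable_funTS; exact: measurable_funeM.
move=> e Ae; apply: (@le_trans _ _ (lam [set e' | olt r (Tk cX (walk cX x e t) 1 e')])).
  rewrite le_eqVlt; apply/orP; left; apply/eqP; congr (lam _).
  by apply/seteqP; split=> e' /=; rewrite -[j.+1]addn1 => /(Tk_splice_shift _ _ _ Ae).
apply: (le_trans (survival (walk cX x e t) r0)).
by rewrite /absSk (AlSk Ae) -EFinM lee_fin mulrAC.
Qed.

(** Three factors from the Markov property at [T_j] and at [T_(j+1)]: the moment at [T_j], the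
    survival bound for an excursion of length [r], and (C1) restarted for the remaining [k - j - 1]
    crossings. *)
Lemma gap_bound j k r : (j < k)%N -> (0 < r)%N ->
  lam (\bigcup_t' ([set e | Al x j.+1 t' e /\ exists t, Al x j t e /\ (t + r < t')%N]
         `&` AA x k)) <=
  (c * gam ^+ (k - j.+1) * (CF / Num.sqrt r%:R * (Ca * gam ^+ j)))%:E.
Proof.
move=> jk r0; pose D t' := [set e | Al x j.+1 t' e /\ exists t, Al x j t e /\ (t + r < t')%N].
have mD t' : measurable (D t').
  apply: measurable_andP; first exact: mAl.
  apply: measurable_exP => t; apply: measurable_andP; first exact: mAl.
  exact: measurable_cstP.
have g0 : (0 <= c * gam ^+ (k - j.+1))%R by rewrite mulr_ge0// ltW.
have q0 : (0 <= CF / Num.sqrt r%:R)%R by rewrite divr_ge0.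
have mDA t' : measurable (D t' `&` AA x k) by exact: measurableI.
have mU : measurable (\bigcup_t' (D t' `&` AA x k)) by exact: bigcupT_measurable.
have h1 := generalized_Boole_inequality lam mDA mU.
apply: (le_trans h1); move=> {h1}.
apply: (@le_trans _ _ (\sum_(0 <= t' <oo) (c * gam ^+ (k - j.+1))%:E * lam (D t'))).
  apply: lee_nneseries => [t' _ _|t' _]; first exact: measure_ge0.
  rewrite -integral_cst//; apply: (prob_past_le (m := t') (k := j.+1) lam_iid) => //.
    move=> e e'; rewrite /D /mkset Al_splice; split=> -[A' [t [At tr]]]; split=> //;
      have tt' : (t <= t')%N by apply: leq_trans (ltnW tr); exact: leq_addr.
      by exists t; split=> //; exact: (Al_splice_le x e e' (leqnSn j) tt').1.
    by exists t; split=> //; exact: (Al_splice_le x e e' (leqnSn j) tt').2.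
  move=> e [A' _]; apply: le_trans (AA_mass mK C1 (walk cX x e t') (k - j.+1)).
  apply: le_measure; rewrite ?inE//.
    rewrite -[X in measurable X]setTI.
    exact: (measurable_splice_future t' j.+1 e measurableT (mAA x k)).
  move=> e' [m _ Am].
  have [m0 Am0 m0m] := alive_mono _ _ _ _ _ _ jk Am.
  have m0E : m0 = t' by apply: Al_uniq Am0 _; apply/Al_splice.
  rewrite m0E in m0m; exists (m - t')%N => //.
  by apply/(Al_splice_shift (k - j.+1) (m - t') e' A'); rewrite !subnKC.
rewrite nneseriesZl// [leRHS]EFinM; apply: lee_wpmul2l; first by rewrite lee_fin.
have tD : trivIset setT D.
  apply/trivIsetP => i1 i2 _ _ ii; apply/seteqP; split=> // e [[h1 _] [h2 _]].
  by have /eqP := Al_uniq h1 h2; rewrite (negbTE ii).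
have -> : \sum_(0 <= t' <oo) lam (D t') = lam (\bigcup_t' D t').
  rewrite measure_bigcup//.
  by apply: eq_eseriesl => i; rewrite in_setT.
pose G t := Al x j t `&` [set e | olt (t + r) (Tk cX x j.+1 e)].
have mG t : measurable (G t) by apply: measurableI => //; exact: measurable_olt_Tk.
apply: (@le_trans _ _ (lam (\bigcup_t G t))).
  apply: le_measure; rewrite ?inE//; try exact: bigcupT_measurable.
  move=> e [t' _ [A' [t [At tr]]]]; exists t => //; split=> //=.
  by rewrite /Tk A'.1.
have mUG : measurable (\bigcup_t G t) by exact: bigcupT_measurable.
have h1 := generalized_Boole_inequality lam mG mUG.
apply: (le_trans h1); move=> {h1}.
apply: (@le_trans _ _ (\sum_(0 <= t <oo) (CF / Num.sqrt r%:R)%:E *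
    \int[lam]_(e in Al x j t) (1 + absSk x j e)%:E)).
  by apply: lee_nneseries => [t _ _|t _]; [exact: measure_ge0|exact: long_excursion_after].
rewrite nneseriesZl; last by move=> t _; apply: integral_ge0.
rewrite -integral_AA// [leRHS]EFinM; apply: lee_wpmul2l => //.
Qed.

Definition late k n : set E := \bigcup_(m in [set m | (n < m)%N]) Al x k m.

Lemma measurable_late k n : measurable (late k n).
Proof. by apply: bigcup_measurable => m _; exact: mAl. Qed.

(** One factor [k] counts the excursions, and [2 * k] bounds [sqrt n / sqrt (n %/ k)]. The long
    excursion itself yields no factor [gam], hence the exponent [k.-1]; the [+ 1] serves the case
    [n < k]. *)
Definition late_cst k : R := (2 * c * (CF * Ca + 1) * k%:R ^+ 2 * gam ^+ k.-1)%R.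

Lemma late_bound k n : (0 < n)%N ->
  lam (late k n) <= (late_cst k / Num.sqrt n%:R)%:E.
Proof.
move=> n0; have sn0 : (0 < Num.sqrt n%:R :> R)%R by rewrite sqrtr_gt0 ltr0n.
have CC0 : (0 <= CF * Ca)%R by rewrite mulr_ge0.
have lc0 : (0 <= late_cst k)%R by rewrite /late_cst !mulr_ge0// ?addr_ge0// ltW.
have [k0|k0] := posnP k.
  rewrite (_ : late k n = set0) ?measure0 ?lee_fin ?divr_ge0 ?(ltW sn0)//.
  by apply/seteqP; split=> // e [m /= nm [+ _]]; rewrite k0 => -[m0]; rewrite -m0 in nm.
(* For [n < k] the length [n %/ k] is zero, but then [sqrt n <= k] and (C1) alone suffices. *)
have [nk|kn] := ltnP n k.
  apply: (@le_trans _ _ (lam (AA x k))).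
    apply: le_measure; rewrite ?inE//; first exact: measurable_late.
    by move=> e [m _ Am]; exists m.
  apply: (le_trans (AA_mass mK C1 x k)); rewrite lee_fin ler_pdivlMr//.
  have snk : (Num.sqrt n%:R <= k%:R :> R)%R.
    rewrite -[leRHS]ger0_norm// -sqrtr_sqr ler_wsqrtr// -natrX ler_nat.
    exact/leq_sq/ltnW.
  have gk : (gam ^+ k <= gam ^+ k.-1)%R.
    by rewrite -{1}(prednK k0) exprS ler_piMl// ltW.
  have k1 : (1 <= k%:R :> R)%R by rewrite ler1n.
  apply: (@le_trans _ _ (c * gam ^+ k.-1 * k%:R)%R).
    apply: ler_pM => //; first by rewrite mulr_ge0// ltW.
    by rewrite ler_pM2l.
  rewrite /late_cst.
  have -> : (2 * c * (CF * Ca + 1) * k%:R ^+ 2 * gam ^+ k.-1 =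
     (c * gam ^+ k.-1 * k%:R) * (2 * (CF * Ca + 1) * k%:R))%R by ring.
  rewrite ler_peMr//; first by rewrite !mulr_ge0// ltW.
  apply: (@le_trans _ _ (2 * (CF * Ca + 1) * 1)%R); first by rewrite mulr1; lra.
  by rewrite ler_wpM2l// mulr_ge0// addr_ge0.
pose r := (n %/ k)%N; have r0 : (0 < r)%N by rewrite divn_gt0.
pose Gp j := \bigcup_t' ([set e | Al x j.+1 t' e /\ exists t, Al x j t e /\ (t + r < t')%N]
         `&` AA x k).
have mGp j : measurable (Gp j).
  apply: bigcupT_measurable => t'; apply: measurableI => //.
  apply: measurable_andP; first exact: mAl.
  apply: measurable_exP => t; apply: measurable_andP; first exact: mAl.
  exact: measurable_cstP.
have sub : late k n `<=` \big[setU/set0]_(j < k) Gp j.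
  move=> e [m /= nm Am]; rewrite -bigcup_mkord.
  apply: contrapT => nG.
  (* Without an excursion longer than [r] the crossing times would satisfy [T_k <= k * r <= n]. *)
  have gap j t : (j <= k)%N -> Al x j t e -> (t <= j * r)%N.
    elim: j t => [|j IH] t jk At; first by have := At.1 => -[<-].
    have [t0 At0 _] := alive_mono _ _ _ _ _ _ (leqnSn j) At.
    have h0 := IH _ (ltnW jk) At0.
    rewrite mulSn; apply: leq_trans (leq_add (leqnn r) h0); rewrite leqNgt addnC.
    apply/negP => ht; apply: nG; exists j => //; exists t => //; split; last by exists m.
    by split=> //; exists t0.
  by have := gap k m (leqnn k) Am; rewrite mulnC leqNgt (leq_ltn_trans (leq_trunc_div n k) nm).
have mGpk j : `I_k j -> measurable (Gp j) by [].
apply: (le_trans (content_subadditive lam mGpk (measurable_late k n) sub)).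
have sr0 : (0 < Num.sqrt r%:R :> R)%R by rewrite sqrtr_gt0 ltr0n.
apply: (@le_trans _ _ (\sum_(j < k) (c * (CF * Ca) * gam ^+ k.-1 / Num.sqrt r%:R)%:E)).
  apply: lee_sum => j _; apply: (le_trans (gap_bound (ltn_ord j) r0)).
  rewrite lee_fin le_eqVlt; apply/orP; left; apply/eqP.
  have -> : (gam ^+ k.-1 = gam ^+ (k - j.+1) * gam ^+ j)%R.
    by rewrite -exprD -predn_split.
  by ring.
rewrite sumEFin lee_fin sumr_const card_ord -[(_ *+ k)%R]mulr_natr ler_pdivlMr//.
have snr : (Num.sqrt n%:R <= 2 * k%:R * Num.sqrt r%:R :> R)%R.
  have nkr : (n <= (2 * k) * r)%N by exact: divn_ge_half.
  apply: (@le_trans _ _ (Num.sqrt ((2 * k) * r)%:R)%R).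
    by rewrite ler_wsqrtr// ler_nat.
  rewrite natrM sqrtrM// ler_wpM2r ?sqrtr_ge0// -natrM.
  rewrite -[leRHS]ger0_norm// -sqrtr_sqr ler_wsqrtr// -natrX ler_nat.
  exact: leq_sq.
apply: (@le_trans _ _ (c * (CF * Ca) * gam ^+ k.-1 / Num.sqrt r%:R * k%:R *
    (2 * k%:R * Num.sqrt r%:R))%R).
  rewrite ler_wpM2l//.
  by rewrite mulr_ge0// divr_ge0 ?(ltW sr0)// !mulr_ge0// ltW.
have -> : (c * (CF * Ca) * gam ^+ k.-1 / Num.sqrt r%:R * k%:R *
    (2 * k%:R * Num.sqrt r%:R) = 2 * c * (CF * Ca) * k%:R ^+ 2 * gam ^+ k.-1)%R.
  by field; rewrite gt_eqF.
rewrite /late_cst ler_wpM2r// ler_wpM2r ?exprn_ge0// ler_wpM2l ?lerDl//.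
by rewrite mulr_ge0// ltW.
Qed.

End CrossingBounds.

(** * Limit of a single excursion *)

Lemma cvg_seq_eq (V : topologicalType) (f g : nat -> V) (l : V) :
  (forall n, f n = g n) -> g @ \oo --> l -> f @ \oo --> l.
Proof. by move=> fg; rewrite (funext fg). Qed.

Lemma cvg_seq_near (V : topologicalType) (f g : nat -> V) (l : V) N :
  (forall n, (N <= n)%N -> f n = g n) -> g @ \oo --> l -> f @ \oo --> l.
Proof.
move=> fg; apply: cvg_trans; apply: near_eq_cvg; exists N => // n /= Nn.
exact/esym/fg.
Qed.

Section BoundedIntegrals.
Context {R : realType} {d : measure_display} {Om : measurableType d}.
Variable P : probability Om R.
Implicit Types (A : set Om) (F G H : Om -> R).
Local Open Scope ereal_scope.

Definition Rint A F : R := fine (\int[P]_(w in A) (F w)%:E).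

Lemma Rint_bound A F (M : R) : measurable A -> measurable_fun setT F ->
  (forall w, 0 <= F w <= M)%R ->
  \int[P]_(w in A) (F w)%:E \is a fin_num /\ (0 <= Rint A F <= M * fine (P A))%R.
Proof.
move=> mA mF FM.
have F0 w : (0 <= F w)%R by have /andP[] := FM w.
have i0 : 0 <= \int[P]_(w in A) (F w)%:E by apply: integral_ge0 => w _; rewrite lee_fin.
have PA : P A \is a fin_num by exact: fin_num_measure.
have iM : \int[P]_(w in A) (F w)%:E <= (M * fine (P A))%:E.
  rewrite EFinM fineK// -integral_cst//; apply: ge0_le_integral => //.
  - by move=> w _; rewrite lee_fin.
  - by apply: measurable_funTS; exact/measurable_EFinP.
  - by move=> w _; rewrite lee_fin; have /andP[] := FM w.
have fi : \int[P]_(w in A) (F w)%:E \is a fin_num.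
  by rewrite ge0_fin_numE//; apply: (le_lt_trans iM); rewrite ltry.
split=> //; rewrite /Rint fine_ge0//= -lee_fin fineK//.
Qed.

Lemma Rint_dist A F G H (M : R) : measurable A -> measurable_fun setT F ->
  measurable_fun setT G -> measurable_fun setT H ->
  (forall w, 0 <= F w <= M)%R -> (forall w, 0 <= G w <= M)%R -> (forall w, 0 <= H w <= M)%R ->
  (forall w, `|F w - G w| <= H w)%R -> (`|Rint A F - Rint A G| <= Rint A H)%R.
Proof.
move=> mA mF mG mH FM GM HM FGH.
have le F' G' : measurable_fun setT F' -> measurable_fun setT G' ->
    (forall w, 0 <= F' w <= M)%R -> (forall w, 0 <= G' w <= M)%R ->
    (forall w, F' w <= G' w + H w)%R -> (Rint A F' <= Rint A G' + Rint A H)%R.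
  move=> mF' mG' F'M G'M h.
  have [f1 _] := Rint_bound mA mF' F'M; have [f2 _] := Rint_bound mA mG' G'M.
  have [f3 _] := Rint_bound mA mH HM.
  rewrite -lee_fin EFinD /Rint !fineK// -ge0_integralD//.
  - apply: ge0_le_integral => //.
    + by move=> w _; rewrite lee_fin; have /andP[] := F'M w.
    + by apply: measurable_funTS; exact/measurable_EFinP.
    + by apply: measurable_funTS; apply: emeasurable_funD; exact/measurable_EFinP.
    + by move=> w _; rewrite -EFinD lee_fin.
  - by move=> w _; rewrite lee_fin; have /andP[] := G'M w.
  - by apply: measurable_funTS; exact/measurable_EFinP.
  - by move=> w _; rewrite lee_fin; have /andP[] := HM w.
  - by apply: measurable_funTS; exact/measurable_EFinP.
have h1 : (Rint A F <= Rint A G + Rint A H)%R.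
  by apply: le => // w; have := FGH w; rewrite ler_norml => /andP[]; lra.
have h2 : (Rint A G <= Rint A F + Rint A H)%R.
  by apply: le => // w; have := FGH w; rewrite ler_norml => /andP[]; lra.
by rewrite ler_norml; apply/andP; split; lra.
Qed.

End BoundedIntegrals.

Lemma hat_walk_cont_process (R : realType) d (Om : measurableType d) (X : nat -> Om -> R)
    (sigma y : R) n : (forall i, measurable_fun setT (X i)) ->
  cont_process (hat_walk X sigma y n).
Proof.
move=> mX; have mw i : measurable_fun setT (fun w => walk X y w i).
  by apply: measurable_funD => //; apply: measurable_sum => j; exact: mX.
split=> [t t01|w].
  apply: measurable_funM => //; apply: measurable_funD => //.
  by apply: measurable_funM => //; apply: measurable_funB.
exact: cont01_interp.
Qed.

Section ExcursionLimit.
Context {R : realType} {dT : measure_display} {T : measurableType dT}.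
Local Notation E := (canon R T).
Variable lam : probability E R.
Variable K : nat -> T -> R -> bool.
Hypothesis mK : forall i, measurable [set p : T * R | K i p.1 p.2].
Context {d' : measure_display} {Om' : measurableType d'}.
Variables (Q : probability Om' R) (Wp Wm : Om' -> R -> R) (sigma : R) (u : R -> R).
Hypothesis sigma0 : 0 < sigma.
Hypotheses (cWp : cont_process Wp) (cWm : cont_process Wm).
Hypothesis C2 : cond_C2 lam cX cU K u.
Hypothesis C4 : forall y, 0 < u y -> weak_conv
  (fun n f => cond_expect lam (fun e => f (hat_walk cX sigma y n e))
     [set e | olt n (tau cX cU K y e) /\ olt n (Tk cX y 1 e)])
  (fun f => expect Q (fun w => f (if 0 <= y then Wp w else Wm w))).
Implicit Types y z : R.
Local Notation Al := (Al K).

Definition ev y n : set E :=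
  [set e | olt n (tau cX cU K y e) /\ olt n (Tk cX y 1 e)].

Lemma measurable_ev y n : measurable (ev y n).
Proof.
apply: measurable_andP; last exact: measurable_olt_Tk.
exact: measurable_olt_tau.
Qed.

Definition wlim f y : R := expect Q (fun w => f (if 0 <= y then Wp w else Wm w)).

(** Nonnegativity permits integrals and series in the extended reals; a general bounded functional
    is reached at the end by adding a constant. *)
Definition nnfun f (M : R) := bounded_cont_functional f /\ forall g : R -> R, 0 <= f g <= M.

Lemma measurable_hat_walk f y n : bounded_cont_functional f ->
  measurable_fun setT (fun e : E => f (hat_walk cX sigma y n e)).
Proof.
move=> cf; apply: measurable_functional => //; apply: hat_walk_cont_process => i.
exact: measurable_coord1.
Qed.

Lemma cont_process_sel y : cont_process (fun w => if 0 <= y then Wp w else Wm w).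
Proof. by case: (0 <= y). Qed.

Lemma wlim_ge0 f M y : nnfun f M -> 0 <= wlim f y <= M.
Proof.
move=> [cf fM]; have := Rint_bound Q measurableT
  (measurable_functional (cont_process_sel y) cf) (fun w => fM _).
by rewrite probability_setT mulr1 => -[].
Qed.

Lemma sqrt_prob_ge0 y (n : nat) : 0 <= Num.sqrt n%:R * fine (lam (ev y n)).
Proof. by rewrite mulr_ge0 ?sqrtr_ge0// fine_ge0. Qed.

Lemma u_ge0 y : 0 <= u y.
Proof.
have cy := @C2 y; rewrite -(cvg_lim _ cy)//; apply: limr_ge; first by apply/cvg_ex; exists (u y).
by apply: nearW => n; exact: sqrt_prob_ge0.
Qed.

(** For [u y > 0] this is the product of (C2) and (C4). For [u y = 0], where (C4) is silent, (C2)
    and the bound on [f] force the limit [0]. *)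
Lemma excursion_limit f M y : nnfun f M ->
  (fun n => Num.sqrt n%:R * Rint lam (ev y n) (fun e => f (hat_walk cX sigma y n e)))
    @ \oo --> u y * wlim f y.
Proof.
move=> [cf fM].
have bnd n := Rint_bound lam (measurable_ev y n) (measurable_hat_walk y n cf) (fun e => fM _).
have := u_ge0 y; rewrite le_eqVlt => /orP[/eqP u0|u0].
  rewrite -u0 mul0r.
  have c0 : (fun n => M * (Num.sqrt n%:R * fine (lam (ev y n)))) @ \oo --> (0 : R).
    by rewrite -[X in _ --> X](mulr0 M); apply: cvgM; [exact: cvg_cst|rewrite u0; exact: C2].
  apply: (squeeze_cvgr _ (cvg_cst (0 : R)) c0); apply: nearW => n.
  have [_ /andP[h1 h2]] := bnd n; rewrite mulr_ge0 ?sqrtr_ge0//=.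
  by rewrite mulrCA ler_wpM2l ?sqrtr_ge0.
have cc := C4 u0 cf.
apply: cvg_seq_eq (cvgM (@C2 y) cc) => n /=.
rewrite /cond_expect -/(ev y n) -/(Rint lam (ev y n) (fun e => f (hat_walk cX sigma y n e))).
(* If the conditioning event is null, the quotient in [cond_expect] is [0] by convention, and so is
   the integral. *)
rewrite -mulrA; congr (_ * _); have [p0|p0] := eqVneq (fine (lam (ev y n))) 0; last first.
  by rewrite mulrC mulfVK.
have [_ /andP[h1 h2]] := bnd n; rewrite p0 mulr0 in h2.
by rewrite p0 mul0r; apply/eqP; rewrite eq_le h1 h2.
Qed.

(* The limit does not see the first [m] steps of the path. *)
Lemma excursion_limit_shift f M x k m e : nnfun f M -> Al x k m e ->
  (fun j => Num.sqrt (j + m)%:R * Rint lam (ev (walk cX x e m) j)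
     (fun e' => f (hat_walk cX sigma x (j + m) (splice m k (e, e')))))
   @ \oo --> u (walk cX x e m) * wlim f (walk cX x e m).
Proof.
move=> nf Ae; have [cf fM] := nf; set z := walk cX x e m.
pose Y j (e' : E) := hat_walk cX sigma z j e'.
pose Y' j (e' : E) := hat_walk cX sigma x (j + m) (splice m k (e, e')).
have cY j e' : cont01 (Y j e') by exact: cont01_interp.
have cY' j e' : cont01 (Y' j e') by exact: cont01_interp.
have mY' j : measurable_fun setT (fun e' => f (Y' j e')).
  exact: (measurableT_comp (measurable_hat_walk x (j + m) cf) (measurable_splice_future m k e)).
have mY F j : bounded_cont_functional F -> measurable_fun setT (fun e' => F (Y j e')).
  exact: measurable_hat_walk.
pose B : R := \sum_(i < m.+1) `|walk cX x e i|.
have B0 : 0 <= B by apply: sumr_ge0.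
have close g : cont01 g -> forall eps : R, 0 < eps -> exists2 del : R, 0 < del &
     exists N, forall j, (N <= j)%N -> forall e',
     (forall t, 0 <= t <= 1 -> `|g t - Y j e' t| <= del) ->
     forall t, 0 <= t <= 1 -> `|g t - Y' j e' t| <= eps.
  move=> cg eps eps0; have [del del0 [J HJ]] := hat_shift_close m sigma0 B0 cg eps0.
  exists del => //; exists J => j Jj e' h.
  apply: (HJ j Jj (walk cX x (splice m k (e, e')))) => [i im|t t01].
    rewrite walk_splice_le// /B.
    by rewrite (bigD1 (Ordinal (im : (i < m.+1)%N)))//= lerDl sumr_ge0.
  by rewrite splice_walk_shift; exact: h.
have [F [MF [cF F0 dF F0lim]]] := functional_defect cf cY cY' close.
pose M' : R := Num.max M MF.
have fM' g : 0 <= f g <= M' by have /andP[-> h] := fM g; rewrite le_max h.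
have FM' N g : 0 <= F N g <= M' by have /andP[-> h] := F0 N g; rewrite le_max h orbT.
have nF N : nnfun (F N) M' by split.
pose a j := Num.sqrt j%:R * Rint lam (ev z j) (fun e' => f (Y j e')).
pose a' j := Num.sqrt j%:R * Rint lam (ev z j) (fun e' => f (Y' j e')).
have ca : a @ \oo --> u z * wlim f z by exact: excursion_limit nf.
have wF : (fun N => wlim (F N) z) @ \oo --> (0 : R).
  pose W w := if 0 <= z then Wp w else Wm w.
  have cW : cont_process W by exact: cont_process_sel.
  have mFW N : measurable_fun setT (fun w => (F N (W w))%:E).
    by apply/measurable_EFinP; exact: measurable_functional.
  have ig : Q.-integrable setT (fun=> MF%:E) by exact: finite_measure_integrable_cst.
  have fc w : setT w -> (fun N => (F N (W w))%:E) @ \oo --> (0%R : R)%:E.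
    by move=> _; apply: cvg_EFin; [exact: nearW|exact: F0lim (cW.2 w)].
  have dom N w : setT w -> (`|(F N (W w))%:E| <= MF%:E)%E.
    by move=> _; rewrite abse_EFin lee_fin; have /andP[h0 h1] := F0 N (W w); rewrite ger0_norm.
  have fing (w : Om') : setT w -> (MF%:E : \bar R) \is a fin_num by [].
  have := dominated_cvg measurableT mFW fc fing ig dom.
  by rewrite integral0 => /fine_cvg.
have ca' : a' @ \oo --> u z * wlim f z.
  (* [N] is chosen first, with [u z * wlim (F N) z] small, and [j] afterwards: the difference is
     dominated by the integral of [F N], to which [excursion_limit] applies. *)
  suff d0 : (fun j => a' j - a j) @ \oo --> (0 : R).
    rewrite -[X in _ --> X]add0r; apply: cvg_seq_eq (cvgD d0 ca) => j /=.
    by rewrite subrK.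
  apply/cvgrPdist_le => eps eps0.
  have uw : (fun N => u z * wlim (F N) z) @ \oo --> (0 : R).
    by rewrite -[X in _ --> X](mulr0 (u z)); apply: cvgM => //; exact: cvg_cst.
  move/cvgrPdist_lt : uw => /(_ _ eps0) [N _ /(_ N (leqnn N))/=]; rewrite sub0r normrN => hN.
  have := excursion_limit (y := z) (nF N); move/cvgrPdist_lt.
  have e10 : 0 < eps - `|u z * wlim (F N) z| by rewrite subr_gt0.
  move=> /(_ _ e10) near1; near=> j.
  rewrite sub0r normrN /a' /a -mulrBr normrM ger0_norm ?sqrtr_ge0//.
  apply: (@le_trans _ _ (Num.sqrt j%:R * Rint lam (ev z j) (fun e' => F N (Y j e')))).
    rewrite ler_wpM2l ?sqrtr_ge0//; apply: (@Rint_dist _ _ _ lam _ _ _ _ M') => //.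
    - exact: measurable_ev.
    - exact: mY.
    - exact: mY.
    - move=> e'; apply: dF; near: j; exact: nbhs_infty_ge.
  have : `|u z * wlim (F N) z - Num.sqrt j%:R * Rint lam (ev z j) (fun e' => F N (Y j e'))| <
      eps - `|u z * wlim (F N) z| by near: j.
  rewrite ltr_norml => /andP[h1 h2]; have := ler_norm (u z * wlim (F N) z); lra.
pose q j := Num.sqrt (j + m)%:R / Num.sqrt j%:R : R.
have cq : q @ \oo --> (1 : R).
  apply/cvgrPdist_le => eps eps0; have [J hJ] := nat_above (m%:R / eps).
  exists J.+1 => // j /= Jj; have /hJ mj := ltnW Jj.
  have j0 : 0 < j%:R :> R by rewrite ltr0n (leq_trans _ Jj).
  have sj0 : 0 < Num.sqrt j%:R :> R by rewrite sqrtr_gt0.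
  have q1 : 1 <= q j by rewrite /q ler_pdivlMr// mul1r ler_wsqrtr// ler_nat leq_addr.
  have qq : q j * q j = 1 + m%:R / j%:R.
    rewrite /q mulrACA -expr2 sqr_sqrtr// -invfM -expr2 sqr_sqrtr; last exact: ltW.
    by rewrite natrD mulrDl divff// gt_eqF.
  have mje : m%:R / j%:R <= eps by rewrite ler_pdivrMr// mulrC -ler_pdivrMr.
  rewrite distrC ger0_norm ?subr_ge0//.
  have := ler_wpM2l (le_trans ler01 q1) q1; rewrite mulr1 qq; lra.
rewrite -[X in _ --> X]mul1r; apply: (cvg_seq_near (N := 1)) (cvgM cq ca') => j j1 /=.
by rewrite /q /a' mulrA mulfVK// gt_eqF// sqrtr_gt0 ltr0n.
Unshelve. all: by end_near.
Qed.

End ExcursionLimit.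

(** * Summation over the excursions *)

Lemma half_ltn n m : (0 < n)%N -> (m <= n./2)%N -> (m < n)%N.
Proof. lia. Qed.

Lemma half_leq n m : (m <= n./2)%N -> (m <= n)%N.
Proof. lia. Qed.

Lemma half_le4 n m : (m <= n./2)%N -> (n <= 4 * (n - m))%N.
Proof. lia. Qed.

Lemma half_le4' n : (1 < n)%N -> (n <= 4 * n./2)%N.
Proof. lia. Qed.

Lemma divn_compl n D : (D * n <= D.+1 * (n - n %/ D.+1))%N.
Proof.
have h := leq_trunc_div n D.+1.
rewrite mulnBr -(leq_add2r (D.+1 * (n %/ D.+1))) subnK ?leq_pmul2l ?leq_div//.
by rewrite addnC [(D.+1 * n)%N]mulSn leq_add2r mulnC.
Qed.

Lemma divn_compl_half n D : (0 < D)%N -> (n <= 2 * (n - n %/ D.+1))%N.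
Proof.
move=> D0; have : (n %/ D.+1 <= n %/ 2)%N by exact: leq_div2l.
by rewrite divn2; move: (n %/ D.+1)%N; lia.
Qed.

Lemma sqrt_le_mul (R : realType) (a b t : R) :
  1 <= t -> 0 <= b -> a <= t * b -> Num.sqrt a <= t * Num.sqrt b.
Proof.
move=> t1 b0 ab; have t0 : 0 <= t by exact: le_trans t1.
apply: (@le_trans _ _ (Num.sqrt (t ^+ 2 * b))); last first.
  by rewrite sqrtrM ?exprn_ge0// sqrtr_sqr ger0_norm.
apply: ler_wsqrtr; apply: (le_trans ab).
by rewrite expr2 -mulrA ler_peMl// mulr_ge0.
Qed.

Lemma nneseries_tail_small (R : realType) (b : nat -> \bar R) (eps : R) :
  (forall n, 0 <= b n)%E -> (\sum_(0 <= i <oo) b i < +oo)%E -> 0 < eps ->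
  exists N, forall n, (N <= n)%N -> (\sum_(n <= i <oo) b i <= eps%:E)%E.
Proof.
move=> b0 bf e0.
have /(_ (fun k _ => b0 k)) := @nneseries_tail_cvg R b xpredT bf.
move=> /fine_cvgP[[N1 _ fi]] /cvgrPdist_le/(_ _ e0)[N2 _ h2].
exists (maxn N1 N2) => n; rewrite geq_max => /andP[n1 n2].
rewrite -(fineK (fi n n1)) lee_fin.
by have := h2 n n2; rewrite /= sub0r normrN; apply: le_trans; exact: ler_norm.
Qed.

Lemma geometric_sum_le (R : realType) (t : R) k : 0 <= t < 1 ->
  \sum_(0 <= i < k) t ^+ i <= (1 - t)^-1.
Proof.
move=> /andP[t0 t1]; have h0 : 0 < 1 - t by rewrite subr_gt0.
rewrite -[leRHS]mul1r ler_pdivlMr// big_mkord.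
have -> : (\sum_(i < k) t ^+ i) * (1 - t) = 1 - t ^+ k.
  by rewrite -[1 - t ^+ k]opprB subrX1 -mulNr opprB mulrC.
by rewrite gerBl exprn_ge0.
Qed.

(* With [h = (1 - gam) / 3] and [t = 1 - h] one has [gam <= t ^ 3] and
   [k * t ^ k <= h^-1], so that [k ^ 2 * gam ^ k <= h ^- 2 * t ^ k]. *)
Lemma sq_geometric_bound (R : realType) (gam : R) : 0 < gam -> gam < 1 ->
  exists C t : R, [/\ 0 <= C, 0 <= t, t < 1 & forall k,
    gam ^+ k <= C * t ^+ k /\ k%:R ^+ 2 * gam ^+ k.-1 <= C * t ^+ k].
Proof.
move=> g0 g1; pose h := (1 - gam) / 3; pose t := 1 - h.
have h0 : 0 < h by rewrite /h; lra.
have h3 : h < 1 / 3 by rewrite /h; lra.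
have t0 : 0 < t by rewrite /t; lra.
have t1 : t < 1 by rewrite /t; lra.
have gt : gam <= t ^+ 3.
  have -> : gam = 1 - 3 * h by rewrite /h; field.
  have -> : t ^+ 3 = 1 - 3 * h + h ^+ 2 * (3 - h) by rewrite /t; ring.
  by rewrite lerDl mulr_ge0// ?exprn_ge0 ?ltW//; lra.
have kt k : k%:R * t ^+ k <= h^-1.
  have -> : h = 1 - t by rewrite /t; ring.
  apply: le_trans (geometric_sum_le k _); last by rewrite t1 ltW.
  rewrite big_mkord mulr_natl -[X in _ *+ X](card_ord k) -sumr_const.
  by apply: ler_sum => i _; apply: ler_wiXn2l; rewrite ?(ltW t0) ?(ltW t1)// ltnW.
have gk k : gam ^+ k <= (t ^+ k) ^+ 3.
  by rewrite exprAC; apply: lerXn2r; rewrite ?nnegrE// ltW// exprn_gt0.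
have hi : 0 <= h^-1 by rewrite invr_ge0 ltW.
pose C := 1 + h^-1 ^+ 2 * gam^-1.
have C1 : 1 <= C by rewrite lerDl mulr_ge0 ?exprn_ge0 ?invr_ge0// ltW.
exists C, t; split=> //; [exact: le_trans C1|exact: ltW|].
move=> k; have tk : 0 < t ^+ k by rewrite exprn_gt0.
have tk1 : t ^+ k <= 1 by rewrite exprn_ile1// ltW.
split.
  apply: (le_trans (gk k)); apply: (@le_trans _ _ (t ^+ k)).
    by rewrite exprS ler_piMr ?exprn_ile1 ?exprn_ge0// ltW.
  by rewrite ler_peMl// ltW.
case: k tk {tk1} => [|k] tk; first by rewrite expr0n/= mul0r mulr_ge0// ltW// (lt_le_trans _ C1).
apply: (@le_trans _ _ ((h^-1 ^+ 2 * gam^-1) * t ^+ k.+1)); last first.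
  by rewrite ler_pM2r// lerDr.
rewrite -ler_pdivrMr//.
have -> : k.+1%:R ^+ 2 * gam ^+ k = (k.+1%:R ^+ 2 * gam ^+ k.+1) * gam^-1.
  by rewrite -[RHS]mulrA; congr (_ * _); rewrite exprSr mulfK// gt_eqF.
rewrite mulrAC ler_pM2r ?invr_gt0// ler_pdivrMr//.
apply: (@le_trans _ _ (k.+1%:R ^+ 2 * (t ^+ k.+1) ^+ 3)); first by rewrite ler_wpM2l ?exprn_ge0.
rewrite [X in _ * X]exprSr mulrA ler_pM2r// -exprMn.
by apply: lerXn2r; rewrite ?nnegrE// mulr_ge0// ltW.
Qed.

Lemma cross_olt_mono (R : realType) (s : nat -> R) k k' n : (k <= k')%N ->
  olt n (cross s k) -> olt n (cross s k').
Proof.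
move=> kk; case E : (cross s k') => [t'|//].
have [t -> h] := cross_mono _ _ _ _ kk E; rewrite /=; lia.
Qed.

Lemma late_vanish_arith N1 N2 D n : (2 * (N1 + N2) + D.+1 <= n)%N ->
  (n./2 < n)%N /\ [/\ (N1 <= n./2.+1)%N, (2 * N2 <= n)%N & (D.+1 <= n)%N].
Proof. by move=> h; split; [|split]; lia. Qed.

Section FullLimit.
Context {R : realType} {dT : measure_display} {T : measurableType dT}.
Local Notation E := (canon R T).
Variable lam : probability E R.
Hypothesis lam_iid : iid_law lam.
Variable K : nat -> T -> R -> bool.
Hypothesis mK : forall i, measurable [set p : T * R | K i p.1 p.2].
Local Notation Al := (Al K).
Local Notation AA := (AA K).
Local Notation ev := (ev K).
Variables (c gam : R).
Hypotheses (c0 : 0 < c) (gam0 : 0 < gam) (gam1 : gam < 1).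
Hypothesis C1 : forall y k,
  (lam [set e | ole (Tk cX y k e) (tau cX cU K y e)] <= (c * gam ^+ k)%:E)%E.
Variable CF : R.
Hypothesis CF0 : 0 <= CF.
Hypothesis survival : forall n y, (0 < n)%N ->
  (lam [set e | olt n (Tk cX y 1 e)] <= (CF * (1 + `|y|) / Num.sqrt n%:R)%:E)%E.
Variables (x Ca : R).
Hypothesis Ca0 : 0 <= Ca.
Hypothesis meanS : forall k,
  (\int[lam]_(e in AA x k) (1 + absSk x k e)%:E <= (Ca * gam ^+ k)%:E)%E.
Context {d' : measure_display} {Om' : measurableType d'}.
Variables (Q : probability Om' R) (Wp Wm : Om' -> R -> R) (sigma : R) (u : R -> R).
Hypothesis sigma0 : 0 < sigma.
Hypotheses (cWp : cont_process Wp) (cWm : cont_process Wm).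
Hypothesis C2 : cond_C2 lam cX cU K u.
Hypothesis C4 : forall y, 0 < u y -> weak_conv
  (fun n f => cond_expect lam (fun e => f (hat_walk cX sigma y n e))
     [set e | olt n (tau cX cU K y e) /\ olt n (Tk cX y 1 e)])
  (fun f => expect Q (fun w => f (if 0 <= y then Wp w else Wm w))).
Local Notation wlim := (wlim Q Wp Wm).
Local Notation hw n e := (hat_walk cX sigma x n e).
Local Open Scope ereal_scope.

Let mAl := measurable_Al mK.
Let mAA := measurable_AA mK.
Let u0 y : (0 <= u y)%R := u_ge0 C2 y.

Lemma ev_bound z j : (0 < j)%N ->
  lam (ev z j) <= (CF * (1 + `|z|) / Num.sqrt j%:R)%:E.
Proof.
move=> j0; apply: le_trans (survival z j0); apply: le_measure; rewrite ?inE.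
- exact: measurable_ev.
- exact: measurable_olt_Tk.
- by move=> e [].
Qed.

(** By (C2), [u] is a pointwise limit of survival probabilities, which are measurable in the
    starting point as measures of sections. *)
Lemma measurable_u : measurable_fun setT u.
Proof.
apply: (measurable_fun_cvg (h := fun n y => (Num.sqrt n%:R * fine (lam (ev y n)))%R)).
  move=> n; apply: measurable_funM => //; apply: measurableT_comp => //.
  pose A := [set p : R * E | olt n (tau cX cU K p.1 p.2) /\ olt n (Tk cX p.1 1 p.2)].
  have mA : measurable A.
    apply: measurable_andP.
      apply: measurable_olt_absorb => // i; first exact: measurable_walk.
      exact: (measurableT_comp (measurable_coord2 i) measurable_snd).
    by apply: measurable_olt_cross => i; exact: measurable_walk.
  rewrite (_ : (fun y => lam (ev y n)) = lam \o xsection A).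
    exact: measurable_fun_xsection.
  apply/funext => y /=; congr (lam _); apply/seteqP; split=> e.
    by move=> h; rewrite /xsection/= inE.
  by rewrite /xsection/= inE.
by move=> y _; exact: C2.
Qed.

Lemma u_bound y : (u y <= CF * (1 + `|y|))%R.
Proof.
have cy := @C2 y; rewrite -(cvg_lim _ cy)//; apply: limr_le; first by apply/cvg_ex; exists (u y).
exists 1%N => // n /= n0; have sn0 : (0 < Num.sqrt n%:R :> R)%R by rewrite sqrtr_gt0 ltr0n.
rewrite mulrC -ler_pdivlMr// -lee_fin fineK; first exact: ev_bound.
by apply: fin_num_measure; exact: (measurable_ev mK y n).
Qed.

(** Survival up to [n] with at most [k] crossings so far. *)
Definition live n k : set E := [set e | olt n (tau cX cU K x e) /\ olt n (Tk cX x k.+1 e)].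
Definition Bk k m n : set E := Al x k m `&` live n k.

Lemma measurable_live n k : measurable (live n k).
Proof. by apply: measurable_andP; [exact: measurable_olt_tau|exact: measurable_olt_Tk]. Qed.

Lemma measurable_Bk k m n : measurable (Bk k m n).
Proof. by apply: measurableI => //; exact: measurable_live. Qed.

Lemma Bk_trivI k n (b : pred nat) : trivIset setT (fun m => if b m then Bk k m n else set0).
Proof.
apply/trivIsetP => i j _ _ ij; apply/seteqP; split=> // e.
move=> []; case: (b i) => //; case: (b j) => // -[h1 _] [h2 _].
by have /eqP := Al_uniq h1 h2; rewrite (negbTE ij).
Qed.

(** The predicate selects admissible values of [T_k]: early, late, or all times up to [n]. Some
    selection is essential, because [live n k] also allows [T_k > n]. *)
Definition Bsel (b : pred nat) k n : set E := \bigcup_m (if b m then Bk k m n else set0).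

Lemma measurable_Bif (b : pred nat) k n m : measurable (if b m then Bk k m n else set0).
Proof. by case: (b m) => //; exact: measurable_Bk. Qed.

Lemma measurable_Bsel b k n : measurable (Bsel b k n).
Proof. by apply: bigcupT_measurable => m; exact: measurable_Bif. Qed.

Lemma integral_Bsel b k n (phi : E -> \bar R) : measurable_fun setT phi -> (forall e, 0 <= phi e) ->
  \int[lam]_(e in Bsel b k n) phi e =
  \sum_(0 <= m <oo) if b m then \int[lam]_(e in Bk k m n) phi e else 0.
Proof.
move=> mphi phi0; rewrite ge0_integral_bigcup//; first last.
- exact: Bk_trivI.
- exact: measurable_funTS.
- by move=> m; exact: measurable_Bif.
by apply: eq_eseriesr => m _; case: (b m) => //; rewrite integral_set0.
Qed.

Section functional.
Variables (f : (R -> R) -> R) (M : R).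
Hypothesis nf : nnfun f M.

Let mf n : measurable_fun setT (fun e : E => f (hw n e)).
Proof. exact: measurable_hat_walk nf.1. Qed.
Let mfE n : measurable_fun setT (fun e : E => (f (hw n e))%:E).
Proof. by apply/measurable_EFinP; exact: mf. Qed.
Let f0 g : (0 <= f g)%R. Proof. by have /andP[] := nf.2 g. Qed.
Let M0 : (0 <= M)%R. Proof. by have /andP[h] := nf.2 (fun=> 0%R); exact: le_trans. Qed.

Definition Gf n k (e : E) : \bar R := (f (hw n e) * \1_(live n k) e)%:E.

Lemma measurable_Gf n k : measurable_fun setT (Gf n k).
Proof.
by apply/measurable_EFinP; apply: measurable_funM => //; apply: measurable_indic; exact: measurable_live.
Qed.

Lemma Gf_ge0 n k e : 0 <= Gf n k e.
Proof. by rewrite lee_fin mulr_ge0. Qed.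

(** The conditional expectation of [Gf n k] given the first [m] steps and [k] marks. *)
Definition Phi k m n (e : E) := \int[lam]_e' Gf n k (splice m k (e, e')).

Lemma PhiE k m n e : Al x k m e -> (m <= n)%N -> Phi k m n e =
  \int[lam]_(e' in ev (walk cX x e m) (n - m)) (f (hw n (splice m k (e, e'))))%:E.
Proof.
move=> Ae mn; rewrite [RHS]integral_mkcond; apply: eq_integral => e' _.
rewrite /Gf /patch indicE.
have -> : (splice m k (e, e') \in live n k) = (e' \in ev (walk cX x e m) (n - m)).
  have h1 := tau_splice_shift (n - m) e' Ae; have h2 := Tk_splice_shift 1 (n - m) e' Ae.
  move: h1 h2; rewrite addn1 !subnKC// => h1 h2.
  by apply/idP/idP; rewrite !inE => -[/h1 ? /h2 ?].
by case: ifP => _; rewrite ?mulr1 ?mulr0.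
Qed.

Lemma Phi_fine k m n e : Al x k m e -> (m <= n)%N -> Phi k m n e =
  (Rint lam (ev (walk cX x e m) (n - m)) (fun e' => f (hw n (splice m k (e, e')))))%:E.
Proof.
move=> Ae mn; rewrite (PhiE Ae mn) /Rint fineK//.
have := Rint_bound lam (M := M) (measurable_ev mK (walk cX x e m) (n - m))
  (measurableT_comp (mf n) (measurable_splice_future m k e)) (fun e' => nf.2 _).
by case.
Qed.

Lemma Phi_ge0 k m n e : 0 <= Phi k m n e.
Proof. by apply: integral_ge0 => e' _; exact: Gf_ge0. Qed.

Lemma Phi_le k m n e : Al x k m e -> (m < n)%N ->
  Phi k m n e <= (M * (CF * (1 + absSk x k e) / Num.sqrt (n - m)%:R))%:E.
Proof.
move=> Ae mn; rewrite (PhiE Ae (ltnW mn)) /absSk (AlSk Ae).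
apply: (@le_trans _ _ (\int[lam]_(e' in ev (walk cX x e m) (n - m)) (M%:E))).
  apply: ge0_le_integral => //.
  - exact: measurable_ev.
  - by move=> e' _; rewrite lee_fin.
  - apply: measurable_funTS; apply/measurable_EFinP.
    exact: (measurableT_comp (mf n) (measurable_splice_future m k e)).
  - by move=> e' _; rewrite lee_fin; have /andP[] := nf.2 (hw n (splice m k (e, e'))).
rewrite integral_cst; last exact: measurable_ev.
by rewrite EFinM; apply: lee_wpmul2l => //; apply: ev_bound; rewrite subn_gt0.
Qed.

Lemma integral_Bk k m n :
  \int[lam]_(e in Bk k m n) (f (hw n e))%:E = \int[lam]_(e in Al x k m) Phi k m n e.
Proof.
rewrite -(integral_past lam_iid (mAl x k m)); first last.
- exact: Gf_ge0.
- exact: measurable_Gf.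
- by move=> e e'; exact: Al_splice.
rewrite /Bk integral_mkcondr; apply: eq_integral => e _.
by rewrite /patch /Gf indicE; case: ifP => _; rewrite ?mulr1 ?mulr0.
Qed.

(** Up to [n / 2] the remaining time is comparable with [n], so the survival bound gives a
    dominating function free of [n]. *)
Definition early n := fun m => (m <= n./2)%N.

Definition Hf k n (e : E) : \bar R :=
  let m := odflt 0%N (cross (walk cX x e) k) in
  if (m <= n./2)%N then (Num.sqrt n%:R)%:E * Phi k m n e else 0.

Lemma HfE k m n e : Al x k m e ->
  Hf k n e = if (m <= n./2)%N then (Num.sqrt n%:R)%:E * Phi k m n e else 0.
Proof. by move=> [h _]; rewrite /Hf h. Qed.

Lemma Hf_ge0 k n e : 0 <= Hf k n e.
Proof. by rewrite /Hf; case: ifP => // _; rewrite mule_ge0 ?Phi_ge0// lee_fin sqrtr_ge0. Qed.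

Lemma measurable_Phi k m n : measurable_fun setT (Phi k m n).
Proof. by apply: measurable_splice_integral; [exact: measurable_Gf|exact: Gf_ge0]. Qed.

Lemma measurable_Hf k n : measurable_fun (AA x k) (Hf k n).
Proof.
apply/measurable_fun_bigcup; first by move=> m; exact: mAl.
move=> m.
apply: (eq_measurable_fun (fun e => if (m <= n./2)%N then (Num.sqrt n%:R)%:E * Phi k m n e else 0)).
  by move=> e; rewrite inE => /HfE ->.
case: (m <= n./2)%N; last exact: measurable_cst.
by apply: measurable_funeM; apply: measurable_funTS; exact: measurable_Phi.
Qed.

Lemma integral_Hf k n : \int[lam]_(e in AA x k) Hf k n e =
  (Num.sqrt n%:R)%:E * \int[lam]_(e in Bsel (early n) k n) (f (hw n e))%:E.
Proof.
rewrite ge0_integral_bigcup//; first last.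
- exact: Al_trivIset.
- by move=> e _; exact: Hf_ge0.
- exact: measurable_Hf.
rewrite integral_Bsel//; last by move=> e; rewrite lee_fin.
rewrite -nneseriesZl; last first.
  by move=> m _; case: ifP => // _; apply: integral_ge0 => e _; rewrite lee_fin.
apply: eq_eseriesr => m _; rewrite /early integral_Bk.
rewrite (eq_integral (fun e => if (m <= n./2)%N then (Num.sqrt n%:R)%:E * Phi k m n e else 0)); last first.
  by move=> e; rewrite inE => /HfE ->.
case: ifP => _; last by rewrite integral0 mule0.
rewrite ge0_integralZl//.
- by apply: measurable_funTS; exact: measurable_Phi.
- by move=> e _; exact: Phi_ge0.
Qed.

Lemma half_sqrt n m : (m <= n./2)%N -> (Num.sqrt n%:R <= 2 * Num.sqrt (n - m)%:R :> R)%R.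
Proof.
move=> mn; have h := half_le4 mn.
apply: (@le_trans _ _ (Num.sqrt (4 * (n - m)%:R))%R).
  by rewrite ler_wsqrtr// -natrM ler_nat.
rewrite sqrtrM//; rewrite (_ : 4 = 2 ^+ 2)%R; last by rewrite expr2 -natrM.
by rewrite sqrtr_sqr ger0_norm.
Qed.

Lemma Hf_le k n e : AA x k e -> `|Hf k n e| <= (2 * M * CF)%:E * (1 + absSk x k e)%:E.
Proof.
move=> [m _ Ae]; rewrite gee0_abs ?Hf_ge0// (HfE n Ae).
have S0 : (0 <= 1 + absSk x k e)%R by rewrite addr_ge0// normr_ge0.
have g0 : 0 <= (2 * M * CF)%:E * (1 + absSk x k e)%:E by rewrite -EFinM lee_fin !mulr_ge0.
case: ifP => // mn; have [n0|n0] := posnP n.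
  by rewrite n0 sqrtr0 mul0e.
have mltn : (m < n)%N by exact: half_ltn n0 mn.
apply: (@le_trans _ _ ((Num.sqrt n%:R)%:E * (M * (CF * (1 + absSk x k e) / Num.sqrt (n - m)%:R))%:E)).
  by apply: lee_wpmul2l; [rewrite lee_fin sqrtr_ge0|exact: Phi_le].
rewrite -!EFinM lee_fin.
have s0 : (0 < Num.sqrt (n - m)%:R :> R)%R by rewrite sqrtr_gt0 ltr0n subn_gt0.
have -> : (Num.sqrt n%:R * (M * (CF * (1 + absSk x k e) / Num.sqrt (n - m)%:R)) =
  (M * CF * (1 + absSk x k e)) * (Num.sqrt n%:R / Num.sqrt (n - m)%:R))%R by ring.
have -> : (2 * M * CF * (1 + absSk x k e) = (M * CF * (1 + absSk x k e)) * 2)%R by ring.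
rewrite ler_wpM2l ?mulr_ge0// ler_pdivrMr//; exact: half_sqrt.
Qed.

Definition limk k : \bar R := \int[lam]_(e in AA x k) (u (Sk x k e) * wlim f (Sk x k e))%:E.

(** Dominated convergence over the past: with the past fixed the integrand converges by
    [excursion_limit_shift], and a multiple of [1 + |S_{T_k}|] dominates it. *)
Lemma early_limit k :
  (fun n => (Num.sqrt n%:R)%:E * \int[lam]_(e in Bsel (early n) k n) (f (hw n e))%:E)
    @ \oo --> limk k.
Proof.
apply: cvg_seq_eq (fun n => esym (integral_Hf k n)) _.
have mS : measurable_fun setT (fun e : E => (1 + absSk x k e)%:E).
  by apply/measurable_EFinP; apply: measurable_funD => //; exact: measurable_absSk.
apply: (@dominated_cvg _ _ _ lam (AA x k) (mAA x k) (Hf k) _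
  (fun e => (2 * M * CF)%:E * (1 + absSk x k e)%:E)).
- by move=> n; exact: measurable_Hf.
- move=> e [m _ Ae]; rewrite (AlSk Ae); set z := walk cX x e m.
  have cz := excursion_limit_shift mK sigma0 cWp cWm C2 C4 nf Ae.
  suff key : (fun j => Hf k (j + m) e) @ \oo --> (u z * wlim f z)%:E.
    by have := key; rewrite (cvg_shiftn m (fun n => Hf k n e)).
  apply: (@cvg_seq_near _ _ (fun j => (Num.sqrt (j + m)%:R * Rint lam (ev z j)
     (fun e' => f (hw (j + m) (splice m k (e, e')))))%:E) _ m); last first.
    by apply: cvg_EFin => //; exact: nearW.
  move=> j mj; rewrite (HfE _ Ae) ifT; last by rewrite geq_half_double -addnn leq_add2r.
  by rewrite (Phi_fine Ae) ?leq_addl// addnK -EFinM.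
- by move=> e _; rewrite -EFinM.
- apply: integrableZl => //; apply/integrableP; split; first exact: measurable_funTS.
  rewrite (eq_integral (fun e => (1 + absSk x k e)%:E)); last first.
    by move=> e _; rewrite gee0_abs// lee_fin addr_ge0// normr_ge0.
  by apply: (le_lt_trans (meanS k)); rewrite ltry.
- by move=> n e; exact: Hf_le.
Qed.

Definition late_sel n := fun m => (n./2 < m <= n)%N.
Definition all_sel n := fun m => (m <= n)%N.

Lemma Bsel_split k n : Bsel (all_sel n) k n = Bsel (early n) k n `|` Bsel (late_sel n) k n.
Proof.
apply/seteqP; split=> e.
  move=> [m _]; case: ifP => // mn Be; have [h|h] := leqP m n./2.
    by left; exists m => //; rewrite ifT.
  by right; exists m => //; rewrite ifT// /late_sel h.
move=> [] [m _]; case: ifP => // mn Be; exists m => //; rewrite /all_sel ifT//.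
  exact: half_leq mn.
by have /andP[] := mn.
Qed.

Lemma Bsel_disj k n : [disjoint Bsel (early n) k n & Bsel (late_sel n) k n].
Proof.
apply/disj_setPS => e [[m _]]; case: ifP => // mn [Am _] [m' _]; case: ifP => // /andP[mn' _] [Am' _].
by have mm := Al_uniq Am Am'; move: mn'; rewrite -mm ltnNge (mn : (m <= n./2)%N).
Qed.

Lemma all_limit k :
  (fun n => Num.sqrt n%:R * fine (lam (Bsel (late_sel n) k n)))%R @ \oo --> (0%R : R) ->
  (fun n => (Num.sqrt n%:R)%:E * \int[lam]_(e in Bsel (all_sel n) k n) (f (hw n e))%:E)
    @ \oo --> limk k.
Proof.
move=> late0.
have lf n : lam (Bsel (late_sel n) k n) \is a fin_num.
  by apply: fin_num_measure; exact: measurable_Bsel.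
have late1 : (fun n => (Num.sqrt n%:R)%:E * \int[lam]_(e in Bsel (late_sel n) k n) (f (hw n e))%:E)
    @ \oo --> 0.
  have cM : (fun n => (M * (Num.sqrt n%:R * fine (lam (Bsel (late_sel n) k n))))%:E) @ \oo --> (0%R : R)%:E.
    apply: cvg_EFin; first exact: nearW.
    by rewrite -[X in _ --> X](mulr0 M); apply: cvgM => //; exact: cvg_cst.
  apply: (squeeze_cvge _ (cvg_cst (0 : \bar R)) cM); apply: nearW => n.
  have [fi /andP[h1 h2]] := Rint_bound lam (measurable_Bsel (late_sel n) k n) (mf n) (fun e => nf.2 _).
  rewrite -(fineK fi) -EFinM !lee_fin mulr_ge0 ?sqrtr_ge0//= mulrCA ler_wpM2l ?sqrtr_ge0//.
have ad : limk k +? 0 by rewrite fin_num_adde_defl.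
have h := cvgeD ad (@early_limit k) late1; rewrite adde0 in h.
have {}h := h ltac:(typeclasses eauto).
apply: (cvg_seq_eq _ h) => n.
  rewrite Bsel_split ge0_integral_setU//.
  - rewrite muleDr// ge0_adde_def// inE; apply: integral_ge0 => e _; by rewrite lee_fin.
  - exact: measurable_Bsel.
  - exact: measurable_Bsel.
  - exact: measurable_funTS.
  - by move=> e _; rewrite lee_fin.
  - exact: Bsel_disj.
Qed.

(** The bound is free of [n], to serve as the dominating sequence in [k]. The late part is contained
    in [late k n./2], and [1 < n] ensures that [n./2] is positive. *)
Lemma all_bound k n : (1 < n)%N ->
  (Num.sqrt n%:R)%:E * \int[lam]_(e in Bsel (all_sel n) k n) (f (hw n e))%:E <=
  (2 * M * CF * (Ca * gam ^+ k) + M * (2 * late_cst c gam CF Ca k))%:E.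
Proof.
move=> n1; have n20 : (0 < n./2)%N by rewrite half_gt0.
rewrite Bsel_split ge0_integral_setU//; first last.
- exact: Bsel_disj.
- by move=> e _; rewrite lee_fin.
- exact: measurable_funTS.
- exact: measurable_Bsel.
- exact: measurable_Bsel.
rewrite muleDr//; last first.
  by rewrite ge0_adde_def// inE; apply: integral_ge0 => e _; rewrite lee_fin.
rewrite [leRHS]EFinD; apply: leeD.
  rewrite -integral_Hf.
  have mS : measurable_fun setT (fun e : E => (1 + absSk x k e)%:E).
    by apply/measurable_EFinP; apply: measurable_funD => //; exact: measurable_absSk.
  apply: (@le_trans _ _ (\int[lam]_(e in AA x k) ((2 * M * CF)%:E * (1 + absSk x k e)%:E))).
    apply: ge0_le_integral => //.
    - by move=> e _; exact: Hf_ge0.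
    - exact: measurable_Hf.
    - by apply: measurable_funTS; exact: measurable_funeM.
    - by move=> e Ae; have := Hf_le n Ae; rewrite gee0_abs// Hf_ge0.
  rewrite ge0_integralZl//; first last.
  - by rewrite lee_fin !mulr_ge0.
  - by move=> e _; rewrite lee_fin addr_ge0// normr_ge0.
  - exact: measurable_funTS.
  by rewrite [leRHS]EFinM; apply: lee_wpmul2l => //; rewrite lee_fin !mulr_ge0.
have [fi /andP[h1 h2]] := Rint_bound lam (measurable_Bsel (late_sel n) k n) (mf n) (fun e => nf.2 _).
rewrite -(fineK fi) -EFinM lee_fin -/(Rint lam (Bsel (late_sel n) k n) (fun e => f (hw n e))).
have s0 : (0 < Num.sqrt (n./2)%:R :> R)%R by rewrite sqrtr_gt0 ltr0n.
have lb := late_bound lam_iid mK c0 gam0 gam1 C1 CF0 survival Ca0 meanS k n20.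
have lf : (fine (lam (Bsel (late_sel n) k n)) <= late_cst c gam CF Ca k / Num.sqrt (n./2)%:R)%R.
  rewrite -lee_fin fineK; last by apply: fin_num_measure; exact: measurable_Bsel.
  apply: le_trans lb; apply: le_measure; rewrite ?inE.
  - exact: measurable_Bsel.
  - exact: measurable_late.
  - by move=> e [m _]; case: ifP => // /andP[mn _] [Am _]; exists m.
have sq : (Num.sqrt n%:R <= 2 * Num.sqrt (n./2)%:R :> R)%R.
  have h := half_le4' n1.
  apply: (@le_trans _ _ (Num.sqrt (4 * (n./2)%:R))%R).
    by rewrite ler_wsqrtr// -natrM ler_nat.
  rewrite sqrtrM//; rewrite (_ : 4 = 2 ^+ 2)%R; last by rewrite expr2 -natrM.
  by rewrite sqrtr_sqr ger0_norm.
apply: (@le_trans _ _ (Num.sqrt n%:R * (M * fine (lam (Bsel (late_sel n) k n)))))%R.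
  by rewrite ler_wpM2l// sqrtr_ge0.
rewrite mulrCA ler_wpM2l//.
apply: (@le_trans _ _ (2 * Num.sqrt (n./2)%:R * (late_cst c gam CF Ca k / Num.sqrt (n./2)%:R)))%R.
  by apply: ler_pM => //; rewrite ?sqrtr_ge0// fine_ge0.
by rewrite -mulrA ler_wpM2l// mulrCA mulfV ?gt_eqF// mulr1.
Qed.

Lemma limk_bounds k : 0 <= limk k <= (M * CF * (Ca * gam ^+ k))%:E.
Proof.
have mS : measurable_fun setT (fun e : E => (1 + absSk x k e)%:E).
  by apply/measurable_EFinP; apply: measurable_funD => //; exact: measurable_absSk.
have w0 y := wlim_ge0 Q cWp cWm y nf.
have ul (e : E) : (0 <= u (Sk x k e) * wlim f (Sk x k e) <= M * CF * (1 + absSk x k e))%R.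
  have /andP[h1 h2] := w0 (Sk x k e); rewrite mulr_ge0//=.
  by rewrite -mulrA mulrC; apply: ler_pM => //; exact: u_bound.
apply/andP; split; first by apply: integral_ge0 => e _; rewrite lee_fin; have /andP[] := ul e.
apply: (@le_trans _ _ (\int[lam]_(e in AA x k) ((M * CF)%:E * (1 + absSk x k e)%:E))).
  apply: ge0_le_integral => //.
  - by move=> e _; rewrite lee_fin; have /andP[] := ul e.
  - apply: measurable_funTS; apply/measurable_EFinP; apply: measurable_funM.
      exact: (measurableT_comp measurable_u (measurable_Sk x k)).
    have -> : (fun e : E => wlim f (Sk x k e)) =
        (fun e => if (0 <= Sk x k e)%R then expect Q (fun w => f (Wp w)) else expect Q (fun w => f (Wm w))).
      by apply/funext => e; rewrite /wlim; case: (0 <= Sk x k e)%R.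
    apply: measurable_fun_ifT => //.
    by apply: measurable_fun_ler => //; exact: measurable_Sk.
  - by apply: measurable_funTS; exact: measurable_funeM.
  - by move=> e _; rewrite -EFinM lee_fin; have /andP[] := ul e.
rewrite ge0_integralZl//; first last.
- by rewrite lee_fin mulr_ge0.
- by move=> e _; rewrite lee_fin addr_ge0// normr_ge0.
- exact: measurable_funTS.
by rewrite [leRHS]EFinM; apply: lee_wpmul2l => //; rewrite lee_fin mulr_ge0.
Qed.

End functional.

(** * Vanishing of the late last crossings for fixed [k] *)

Lemma nnfun1 : nnfun (fun=> 1%R) (1 : R).
Proof.
split; last by move=> g; rewrite ler01 lexx.
split; first by exists 1%R => g; rewrite normr1.
by move=> g _ e e0; exists 1%R => // h _ _; rewrite subrr normr0.
Qed.

Lemma live0 n : live n 0 = Bsel (all_sel n) 0 n.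
Proof.
apply/seteqP; split=> e.
  by move=> h; exists 0%N => //=; split=> //; apply/aliveP; split.
by move=> [m _]; case: ifP => // _ [].
Qed.

(** Splits off the surviving paths with exactly [k + 1] crossings; through it the convergence of the
    survival probabilities passes from [k] to [k + 1]. *)
Lemma live_succ n k : live n k.+1 = live n k `|` Bsel (all_sel n) k.+1 n.
Proof.
apply/seteqP; split=> e; last first.
  move=> [[h1 h2]|[m _]]; last by case: ifP => // _ [].
  by split=> //; exact: cross_olt_mono h2.
move=> [h1 h2]; have [j [m [_ mn Am hj]]] := absorb_last_cross _ _ _ _ h1.
have jk : (j <= k.+1)%N.
  rewrite leqNgt; apply/negP => kj; have := cross_olt_mono kj h2.
  by case: (Am) => -> _ /=; rewrite ltnNge mn.
move: jk; rewrite leq_eqVlt => /orP[/eqP jk|jk].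
  by right; exists m => //; rewrite /all_sel mn -jk; split=> //; split=> //; rewrite /Tk jk.
by left; split=> //; exact: cross_olt_mono hj.
Qed.

Lemma live_succ_disj n k : [disjoint live n k & Bsel (all_sel n) k.+1 n].
Proof.
apply/disj_setPS => e [[_ h2] [m _]]; case: ifP => // mn [[h _] _].
by move: h2; rewrite /Tk h/= ltnNge (mn : (m <= n)%N).
Qed.

Local Notation rt n := (Num.sqrt n%:R : R).

Lemma Bsel_mass_limit k :
  (fun n => rt n * fine (lam (Bsel (late_sel n) k n)))%R @ \oo --> (0%R : R) ->
  exists g : R, (fun n => rt n * fine (lam (Bsel (all_sel n) k n)))%R @ \oo --> g.
Proof.
move=> h; have lim := all_limit nnfun1 h.
have /andP[l0 l1] := limk_bounds nnfun1 k.
have lf : limk (fun=> 1%R) k \is a fin_num by rewrite ge0_fin_numE// (le_lt_trans l1)// ltry.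
exists (fine (limk (fun=> 1%R) k)); rewrite -(fineK lf) in lim.
move/fine_cvgP : lim => [_ lim]; apply: (cvg_seq_eq _ lim) => n /=.
have mB := measurable_Bsel (all_sel n) k n.
by rewrite integral_cst// mul1e fineM// fin_num_measure.
Qed.

(** The last excursion lasts at least [r] steps, and its starting time runs over a tail of a
    convergent series. *)
Lemma late_early_part n k N r : (0 < r)%N ->
  lam (\bigcup_(m in [set m | (N <= m)%N /\ (m + r <= n)%N]) Bk k m n) <=
  (CF / rt r)%:E * \sum_(N <= m <oo) \int[lam]_(e in Al x k m) (1 + absSk x k e)%:E.
Proof.
move=> r0; pose F m := Al x k m `&` [set e | olt (m + r) (Tk cX x k.+1 e)].
have I0 m : 0 <= \int[lam]_(e in Al x k m) (1 + absSk x k e)%:E.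
  by apply: integral_ge0 => e _; rewrite lee_fin addr_ge0// normr_ge0.
have mF m : measurable (F m).
  by apply: measurableI; [exact: mAl|exact: measurable_olt_Tk].
apply: (@le_trans _ _ (\sum_(0 <= i <oo) lam (F (i + N)%N))).
  apply: (measure_sigma_subadditive lam (F := fun i => F (i + N)%N)) => //.
  - by apply: bigcup_measurable => m _; exact: measurable_Bk.
  - move=> e [m [Nm mrn] [Am [_ h]]]; exists (m - N)%N => //; rewrite subnK//; split=> //=.
    move: h; rewrite /olt/=; case: (Tk cX x k.+1 e) => // t; exact: leq_ltn_trans.
rewrite -(nneseries_addn N I0) -nneseriesZl; last by move=> i _; exact: I0.
apply: lee_nneseries => i _ //; exact: long_excursion_after.
Qed.

(** A path whose crossing [k + 1] falls in [(n - r, n]] belongs to [live (n - r) k] but no longer to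
    [live n k]. A short last excursion is thus charged to an increment of a quantity with known
    asymptotics. *)
Lemma late_end_part n k r : (r <= n)%N ->
  (fine (lam (\bigcup_(m in [set m | (n - r < m <= n)%N]) Bk k.+1 m n)) <=
   fine (lam (live (n - r) k)) - fine (lam (live n k)))%R.
Proof.
move=> rn; set B := \bigcup_(m in _) _.
have mB : measurable B by apply: bigcup_measurable => m _; exact: measurable_Bk.
have mL j := measurable_live j k.
rewrite lerBrDr -lee_fin EFinD !fineK; try by apply: fin_num_measure.
rewrite -measureU//; first last.
  apply/seteqP; split=> // e [[m /andP[_ mn] [[h _] _]] [_]].
  by rewrite /Tk h/= ltnNge mn.
apply: le_measure; rewrite ?inE//; first exact: measurableU.
have down o : olt n o -> olt (n - r) o by case: o => // t /=; apply: leq_ltn_trans; exact: leq_subr.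
move=> e [|[h1 h2]]; last by split; exact: down.
by move=> [m /andP[mn _] [[h _] [h1 _]]]; split; [exact: down|rewrite /Tk h].
Qed.

Lemma late_vanish_step k (g : R) :
  (fun n => rt n * fine (lam (live n k)))%R @ \oo --> g ->
  (fun n => rt n * fine (lam (Bsel (late_sel n) k.+1 n)))%R @ \oo --> (0%R : R).
Proof.
move=> hg; apply/cvgrPdist_le => eps eps0.
have a0 n : (0 <= rt n * fine (lam (live n k)))%R by rewrite mulr_ge0 ?sqrtr_ge0// fine_ge0.
(* With [r = n %/ D.+1] one has [sqrt n <= (1 + 1 / D) * sqrt (n - r)], so the rescaled increment is
   about [g / D] at most; this [D] makes it at most [eps / 3]. *)
pose D := (Num.trunc (3 * `|g| / eps)).+1; have D0 : (0 < D)%N by [].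
have gD : (g / D%:R <= eps / 3)%R.
  rewrite ler_pdivrMr// mulrAC ler_pdivlMr//.
  have h : (3 * `|g| / eps < D%:R)%R by exact: truncnS_gt.
  rewrite mulrC; move: h; rewrite ltr_pdivrMr// => h; rewrite (le_trans _ (ltW (lt_le_trans h _)))//.
    by rewrite ler_pM2l// ler_norm.
  by rewrite mulrC.
(* The factor [CF * sqrt n / sqrt r] before time [n - r] is at most [c1], which depends on [D] only;
   the tail of the series is then taken small against it. *)
pose c1 := (2 * D.+1%:R * CF)%R; have c10 : (0 <= c1)%R by rewrite !mulr_ge0.
have e3 : (0 < eps / 3 / (c1 + 1))%R by rewrite !divr_gt0// ltr_wpDl.
have e12 : (0 < eps / 12)%R by rewrite divr_gt0.
pose b m := \int[lam]_(e in Al x k.+1 m) (1 + absSk x k.+1 e)%:E.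
have b0 m : 0 <= b m by apply: integral_ge0 => e _; rewrite lee_fin addr_ge0// normr_ge0.
have bf : \sum_(0 <= i <oo) b i < +oo.
  rewrite -(integral_AA lam mK); first last.
  - by move=> e; rewrite lee_fin addr_ge0// normr_ge0.
  - by apply/measurable_EFinP; apply: measurable_funD => //; exact: measurable_absSk.
  by apply: le_lt_trans (meanS k.+1) _; rewrite ltry.
have [N1 hN1] := nneseries_tail_small b0 bf e3.
have /cvgrPdist_le/(_ _ e12)[N2 _ hN2] := hg.
exists (2 * (N1 + N2) + D.+1)%N => // n /= hn.
have [n2 [nN1 nN2 Dn]] : (n./2 < n)%N /\ [/\ (N1 <= n./2.+1)%N, (2 * N2 <= n)%N & (D.+1 <= n)%N].
  exact: late_vanish_arith hn.
pose r := (n %/ D.+1)%N.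
have r0 : (0 < r)%N by rewrite divn_gt0.
have rn : (r <= n)%N by exact: leq_div.
have nr2 : (N2 <= n - r)%N.
  rewrite -(leq_pmul2l (m := 2))//; apply: leq_trans nN2 _; exact: divn_compl_half.
pose A1 := \bigcup_(m in [set m | (n./2.+1 <= m)%N /\ (m + r <= n)%N]) Bk k.+1 m n.
pose A2 := \bigcup_(m in [set m | (n - r < m <= n)%N]) Bk k.+1 m n.
have mA1 : measurable A1 by apply: bigcup_measurable => m _; exact: measurable_Bk.
have mA2 : measurable A2 by apply: bigcup_measurable => m _; exact: measurable_Bk.
have mL := measurable_Bsel (late_sel n) k.+1 n.
have cover : (fine (lam (Bsel (late_sel n) k.+1 n)) <= fine (lam A1) + fine (lam A2))%R.
  rewrite -lee_fin EFinD !fineK; try by apply: fin_num_measure.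
  apply: le_trans (measureU2 _ mA1 mA2); apply: le_measure; rewrite ?inE//; first exact: measurableU.
  move=> e [m _]; case: ifP => // /andP[nm mn] Be; have [h|h] := leqP m (n - r).
    by left; exists m => //=; split=> //; rewrite -(subnK rn) leq_add2r.
  by right; exists m => //=; rewrite h.
have sn0 : (0 <= rt n)%R by exact: sqrtr_ge0.
have sr0 : (0 < rt r)%R by rewrite sqrtr_gt0 ltr0n.
have part1 : (rt n * fine (lam A1) <= eps / 3)%R.
  have hA : (fine (lam A1) <= CF / rt r * (eps / 3 / (c1 + 1)))%R.
    rewrite -lee_fin fineK; last exact: fin_num_measure.
    apply: le_trans (late_early_part n k.+1 n./2.+1 r0) _.
    rewrite [leRHS]EFinM; apply: lee_wpmul2l; last exact: hN1.
    by rewrite lee_fin divr_ge0// ltW.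
  apply: le_trans (ler_wpM2l sn0 hA) _.
  have sq : (rt n <= 2 * D.+1%:R * rt r)%R.
    apply: sqrt_le_mul; rewrite ?ler0n//.
      by rewrite -natrM ler1n.
    by rewrite -!natrM ler_nat divn_ge_half.
  apply: (@le_trans _ _ (2 * D.+1%:R * rt r * (CF / rt r * (eps / 3 / (c1 + 1)))))%R.
    by rewrite ler_wpM2r//; apply: mulr_ge0; [rewrite divr_ge0// ltW|exact: ltW].
  have -> : (2 * D.+1%:R * rt r * (CF / rt r * (eps / 3 / (c1 + 1))) =
      c1 * (eps / 3 / (c1 + 1)) * (rt r / rt r))%R by rewrite /c1; ring.
  rewrite mulfV ?gt_eqF// mulr1 mulrA ler_pdivrMr ?ltr_wpDl// mulrC.
  by rewrite ler_wpM2l ?lerDl// ltW// divr_gt0.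
have part2 : (rt n * fine (lam A2) <= 3 * (eps / 12) + eps / 3)%R.
  have hA := late_end_part k rn.
  apply: le_trans (ler_wpM2l sn0 hA) _; rewrite mulrBr.
  have tD : (1 <= 1 + D%:R^-1 :> R)%R by rewrite lerDl invr_ge0.
  have sq : (rt n <= (1 + D%:R^-1) * rt (n - r))%R.
    apply: sqrt_le_mul; rewrite ?ler0n//.
    have -> : (1 + D%:R^-1 = D.+1%:R / D%:R :> R)%R.
      by rewrite -[D.+1%:R]natr1 mulrDl mul1r mulfV ?pnatr_eq0.
    rewrite mulrAC ler_pdivlMr ?ltr0n// mulrC -!natrM ler_nat; exact: divn_compl.
  have h1 := hN2 n; have h2 := hN2 _ nr2.
  have nn2 : (N2 <= n)%N by apply: leq_trans nr2 (leq_subr _ _).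
  have {}h1 := h1 nn2; move: h1 h2 => /=; rewrite !ler_norml.
  have h3 : (rt n * fine (lam (live (n - r) k)) <=
     (1 + D%:R^-1) * (rt (n - r) * fine (lam (live (n - r) k))))%R.
    by rewrite mulrA ler_wpM2r// fine_ge0.
  move: h3 (a0 (n - r)%N) (a0 n) gD.
  set p := (rt (n - r) * _)%R; set q := (rt n * fine (lam (live n k)))%R; set v := (D%:R^-1)%R.
  have v0 : (0 <= v)%R by rewrite invr_ge0.
  have v1 : (v <= 1)%R by rewrite invf_le1// ?ltr0n// ler1n.
  move=> h3 p0 q0 gD /andP[h4 h5] /andP[h6 h7].
  have h8 : (v * p <= g * v + eps / 12)%R.
    apply: (@le_trans _ _ (v * (g + eps / 12)))%R; first by rewrite ler_wpM2l//; lra.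
    by rewrite mulrDr [(v * g)%R]mulrC lerD2l ler_piMl// ltW.
  by move: h3; rewrite mulrDl mul1r; lra.
rewrite sub0r normrN ger0_norm; last by rewrite mulr_ge0// fine_ge0.
apply: le_trans (ler_wpM2l sn0 cover) _; rewrite mulrDr; lra.
Qed.

(** A joint induction with the convergence for [live n k]: vanishing at [k + 1] uses that limit at
    [k], and in turn yields it at [k + 1]. *)
Lemma late_vanish k :
  (fun n => rt n * fine (lam (Bsel (late_sel n) k n)))%R @ \oo --> (0%R : R).
Proof.
suff [] : (fun n => rt n * fine (lam (Bsel (late_sel n) k n)))%R @ \oo --> (0%R : R) /\
  exists g : R, (fun n => rt n * fine (lam (live n k)))%R @ \oo --> g by [].
elim: k => [|k [IH1 [g hg]]].
  have h0 : (fun n => rt n * fine (lam (Bsel (late_sel n) 0 n)))%R @ \oo --> (0%R : R).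
    apply: (cvg_seq_eq (g := fun=> 0%R)); last exact: cvg_cst.
    move=> n; rewrite (_ : Bsel _ _ _ = set0) ?measure0 ?mulr0//.
    apply/seteqP; split=> // e [m _]; case: ifP => // /andP[nm _] [[/= [h] _] _].
    by rewrite -h in nm.
  split=> //; have [g hg] := Bsel_mass_limit h0; exists g.
  by apply: (cvg_seq_eq _ hg) => n; rewrite live0.
have h1 := late_vanish_step hg; split=> //.
have [g' hg'] := Bsel_mass_limit h1; exists (g + g')%R.
apply: (cvg_seq_eq _ (cvgD hg hg')) => n /=.
have mB := measurable_Bsel (all_sel n) k.+1 n; have mL := measurable_live n k.
rewrite live_succ measureU//; last exact/disj_set2P/live_succ_disj.
by rewrite fineD ?mulrDr//; exact: fin_num_measure.
Qed.

Lemma tau_split n : [set e | olt n (tau cX cU K x e)] = \bigcup_k Bsel (all_sel n) k n.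
Proof.
apply/seteqP; split=> e; last by move=> [k _ [m _]]; case: ifP => // _ [_ []].
move=> h; have [k [m [_ mn Am hk]]] := absorb_last_cross _ _ _ _ h.
by exists k => //; exists m => //; rewrite /all_sel mn.
Qed.

Lemma Bsel_trivI n : trivIset setT (fun k => Bsel (all_sel n) k n).
Proof.
apply/trivIsetP => i j _ _.
wlog ij : i j / (i < j)%N.
  move=> H; rewrite neq_ltn => /orP[h|h]; first by apply: H => //; rewrite ltn_eqF.
  by rewrite setIC; apply: H => //; rewrite ltn_eqF.
move=> _; apply/seteqP; split=> // e [[m _]]; case: ifP => // _ [_ [_ h]] [m' _].
case: ifP => // mn [[h' _] _]; have := cross_olt_mono ij h.
by rewrite h'/= ltnNge (mn : (m' <= n)%N).
Qed.

Lemma bound_summable M : (0 <= M)%R ->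
  \sum_(0 <= k <oo) (2 * M * CF * (Ca * gam ^+ k) + M * (2 * late_cst c gam CF Ca k))%:E < +oo.
Proof.
move=> M0; have [C [t [C0 t0 t1 hC]]] := sq_geometric_bound gam0 gam1.
pose B := (2 * M * CF * Ca + M * (2 * (2 * c * (CF * Ca + 1))))%R.
have q0 : (0 <= 2 * c * (CF * Ca + 1))%R by rewrite !mulr_ge0 ?addr_ge0 ?mulr_ge0// ltW.
have B0 : (0 <= B)%R.
  by apply: addr_ge0; [rewrite !mulr_ge0|apply: mulr_ge0 => //; exact: mulr_ge0].
have gk k : (0 <= gam ^+ k)%R by rewrite exprn_ge0// ltW.
apply: (@le_lt_trans _ _ (B * C / (1 - t))%:E); last exact: ltry.
apply: nneseries_le_bound.
  by move=> n; rewrite lee_fin addr_ge0// /late_cst !mulr_ge0 ?exprn_ge0 ?addr_ge0 ?mulr_ge0// ltW.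
move=> N; rewrite sumEFin lee_fin.
apply: (@le_trans _ _ (\sum_(0 <= k < N) (B * C) * t ^+ k))%R; last first.
  by rewrite -mulr_sumr ler_wpM2l ?mulr_ge0//; apply: geometric_sum_le; rewrite t0.
apply: ler_sum => k _; have [h1 h2] := hC k; rewrite -[leRHS]mulrA /B [leRHS]mulrDl; apply: lerD.
  by rewrite -!mulrA !ler_wpM2l ?mulr_ge0//.
rewrite -[leRHS]mulrA ler_wpM2l// -[leRHS]mulrA ler_wpM2l// /late_cst -[leLHS]mulrA.
by rewrite ler_wpM2l.
Qed.

(** The sum over [k] is an integral against the counting measure, so dominated convergence exchanges
    it with the limit in [n]. *)
Lemma survival_limit f M : nnfun f M ->
  (fun n => (rt n)%:E * \int[lam]_(e in [set e | olt n (tau cX cU K x e)]) (f (hw n e))%:E)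
    @ \oo --> \sum_(0 <= k <oo) limk f k.
Proof.
move=> nf; have f0 g : (0 <= f g)%R by have /andP[] := nf.2 g.
have M0 : (0 <= M)%R by have /andP[h] := nf.2 (fun=> 0%R); exact: le_trans.
pose h n k := (rt n)%:E * \int[lam]_(e in Bsel (all_sel n) k n) (f (hw n e))%:E.
have h0 n k : 0 <= h n k.
  by rewrite mule_ge0 ?lee_fin ?sqrtr_ge0//; apply: integral_ge0 => e _; rewrite lee_fin.
have l0 k : 0 <= limk f k by have /andP[] := limk_bounds nf k.
have eqS n : (rt n)%:E * \int[lam]_(e in [set e | olt n (tau cX cU K x e)]) (f (hw n e))%:E =
    \int[counting]_k h n k.
  rewrite ge0_integral_count// tau_split ge0_integral_bigcup//; first last.
  - exact: Bsel_trivI.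
  - by move=> e _; rewrite lee_fin.
  - by apply: measurable_funTS; apply/measurable_EFinP; exact: measurable_hat_walk nf.1.
  - by move=> k; exact: measurable_Bsel.
  by rewrite -nneseriesZl// => k _; apply: integral_ge0 => e _; rewrite lee_fin.
apply: (cvg_seq_eq eqS); rewrite -ge0_integral_count//.
(* The dominating sequence is valid from [n = 2] on. *)
rewrite -(cvg_shiftn 2 (fun n => \int[counting]_k h n k)).
pose bd k := (2 * M * CF * (Ca * gam ^+ k) + M * (2 * late_cst c gam CF Ca k))%:E.
apply: (@dominated_cvg _ _ _ counting setT _ (fun n => h (n + 2)%N) _ bd) => //.
- move=> k _; have := all_limit nf (@late_vanish k).
  by rewrite -(cvg_shiftn 2).
- apply/integrableP; split=> //.
  have bd0 k : 0 <= bd k by apply: le_trans (h0 2%N k) _; exact: all_bound.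
  rewrite (eq_integral bd); last by move=> k _; rewrite gee0_abs.
  by rewrite ge0_integral_count//; exact: bound_summable.
- by move=> n k _; rewrite gee0_abs//; apply: all_bound => //; rewrite addn2.
Qed.

End FullLimit.

(** * Independent mixtures *)

Section Mixture.
Context {R : realType} {d : measure_display} {Om : measurableType d}.
Variable Q : probability Om R.
Implicit Types (D : set Om) (h : Om -> R).
Local Open Scope ereal_scope.

Lemma integral_mrestr D (mD : measurable D) (phi : Om -> \bar R) :
  measurable_fun setT phi -> (forall w, 0 <= phi w) ->
  \int[mrestr Q mD]_w phi w = \int[Q]_(w in D) phi w.
Proof.
move=> mphi phi0; rewrite -(setUv D) ge0_integral_setU//; first last.
- exact/disj_setPCl.
- exact: measurable_funTS.
- exact: measurableC.
rewrite (eq_measure_integral Q); last first.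
  by move=> A _ AD; change (Q (A `&` D) = Q A); rewrite setIidl.
rewrite [X in _ + X](eq_measure_integral mzero) ?integral_measure_zero ?adde0//.
move=> A _ AD; change (Q (A `&` D) = 0); rewrite (_ : A `&` D = set0) ?measure0//.
by apply/seteqP; split=> // w [/AD].
Qed.

(** Independence says that the law of [h] under [Q] restricted to [D] is [Q D] times its law under
    [Q]; both sides integrate the modulus against these laws. *)
Lemma indep_integral D h : measurable D -> measurable_fun setT h -> (forall w, 0 <= h w)%R ->
  (forall B, measurable B -> Q (D `&` h @^-1` B) = Q D * Q (h @^-1` B)) ->
  \int[Q]_(w in D) (h w)%:E = Q D * \int[Q]_w (h w)%:E.
Proof.
move=> mD mh h0 ind.
have QDf : Q D \is a fin_num by exact: fin_num_measure.
pose k : {nonneg R} := NngNum (fine_ge0 (measure_ge0 Q D)).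
have nh w : `|(h w)|%:E = (h w)%:E :> \bar R by rewrite ger0_norm.
have push (m : {measure set Om -> \bar R}) :
    \int[pushforward m h]_y `|y|%:E = \int[m]_w (h w)%:E.
  rewrite ge0_integral_pushforward ?preimage_setT//; last exact/measurable_EFinP.
  by apply: eq_integral => w _ /=.
rewrite -(integral_mrestr mD); [|exact/measurable_EFinP|by move=> w; rewrite lee_fin].
rewrite -(push (mrestr Q mD)) -(push Q).
have -> : Q D = k%:num%:E by rewrite /= fineK.
rewrite -ge0_integral_mscale//; last exact/measurable_EFinP.
apply: eq_measure_integral => A mA _.
change (Q (h @^-1` A `&` D) = (fine (Q D))%:E * Q (h @^-1` A)).
by rewrite setIC ind// fineK.
Qed.

Variables (Wp Wm : Om -> R -> R) (rho : Om -> R).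
Hypotheses (cWp : cont_process Wp) (cWm : cont_process Wm).
Hypothesis mrho : measurable_fun setT rho.
Hypothesis rho01 : forall w, rho w = 0%R \/ rho w = 1%R.
Hypothesis ind : indep2 Q (preimg_sets rho) (process_sigma Wp Wm).

Let Gen : set (set Om) := [set A | exists t : R, (0 <= t <= 1)%R /\
  (preimg_sets (fun w => Wp w t) A \/ preimg_sets (fun w => Wm w t) A)].
(** The same sample space with only the events of the two processes. Applying
    [measurable_functional] on it shows that [f (Wp w)] and [f (Wm w)] generate events independent
    of [rho]. *)
Let G := g_sigma_algebraType Gen.

Let cWpG : cont_process (Wp : G -> R -> R).
Proof.
split; last exact: cWp.2.
move=> t t01 _ B mB; rewrite setTI; apply: sub_sigma_algebra.
by exists t; split=> //; left; exists B.
Qed.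

Let cWmG : cont_process (Wm : G -> R -> R).
Proof.
split; last exact: cWm.2.
move=> t t01 _ B mB; rewrite setTI; apply: sub_sigma_algebra.
by exists t; split=> //; right; exists B.
Qed.

Let mixture w : R -> R := fun t => (rho w * Wp w t + (1 - rho w) * Wm w t)%R.

Lemma mixtureE w : mixture w = if rho w == 1%R then Wp w else Wm w.
Proof.
apply/funext => t; rewrite /mixture; have [->|->] := rho01 w.
  by rewrite eq_sym oner_eq0 mul0r subr0 mul1r add0r.
by rewrite eqxx subrr mul0r addr0 mul1r.
Qed.

Lemma cont_process_mixture : cont_process mixture.
Proof.
split; last by move=> w; rewrite mixtureE; case: eqP => _; [exact: cWp.2|exact: cWm.2].
move=> t t01; apply: measurable_funD; apply: measurable_funM => //.
- exact: cWp.1.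
- exact: measurable_funB.
- exact: cWm.1.
Qed.

Lemma expect_mixture f (M : R) : nnfun f M ->
  expect Q (fun w => f (mixture w)) =
  (fine (Q [set w | rho w = 1%R]) * expect Q (fun w => f (Wp w)) +
   (1 - fine (Q [set w | rho w = 1%R])) * expect Q (fun w => f (Wm w)))%R.
Proof.
move=> nf; set D := [set w | rho w = 1%R].
have f0 g : (0 <= f g)%R by have /andP[] := nf.2 g.
have mD : measurable D.
  by have := mrho measurableT (measurable_set1 1%R); rewrite setTI.
have pD : preimg_sets rho D by exists [set 1%R] => //; exact: measurable_set1.
have pC : preimg_sets rho (~` D) by exists (~` [set 1%R]) => //; apply: measurableC; exact: measurable_set1.
have mix_f := measurable_functional cont_process_mixture nf.1.
have fin W : cont_process W -> \int[Q]_w (f (W w))%:E \is a fin_num.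
  by move=> cW; have [] := Rint_bound Q measurableT (measurable_functional cW nf.1) (fun w => nf.2 _).
have part A (W : Om -> R -> R) : @cont_process R d Om W -> preimg_sets rho A -> measurable A ->
    @cont_process R _ G W ->
    \int[Q]_(w in A) (f (W w))%:E = Q A * \int[Q]_w (f (W w))%:E.
  move=> cW pA mA cWG; apply: indep_integral => //; first exact: (measurable_functional cW nf.1).
  move=> B mB; apply: ind => //.
  by have := measurable_functional cWG nf.1 measurableT mB; rewrite setTI.
have QDf : Q D \is a fin_num by exact: fin_num_measure.
rewrite /expect -(setUv D) ge0_integral_setU//; first last.
- exact/disj_setPCl.
- by move=> w _; rewrite lee_fin.
- by apply: measurable_funTS; apply/measurable_EFinP.
- exact: measurableC.
rewrite (eq_integral (fun w => (f (Wp w))%:E)); last first.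
  by move=> w; rewrite inE => Dw; rewrite mixtureE ifT//; apply/eqP.
rewrite [X in _ + X](eq_integral (fun w => (f (Wm w))%:E)); last first.
  by move=> w; rewrite inE => Dw; rewrite mixtureE ifF//; apply/negP => /eqP.
rewrite !setUv (part D Wp)// (part (~` D) Wm)//; last exact: measurableC.
have fQ : Q (~` D) = (1 - fine (Q D))%:E by rewrite probability_setC// EFinB fineK.
rewrite fQ fineD ?fineM ?fin_numM ?fin//.
Qed.

End Mixture.

(** * From nonnegative to bounded functionals *)

Section Shift.
Context {R : realType} {d : measure_display} {Om : measurableType d}.
Variable P : probability Om R.

Lemma bounded_integrable (A : set Om) (F : Om -> R) (M : R) : measurable A ->
  measurable_fun setT F -> (forall w, `|F w| <= M) -> P.-integrable A (EFin \o F).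
Proof.
move=> mA mF FM; apply: measurable_bounded_integrable => //.
- by rewrite (le_lt_trans (probability_le1 P mA))// ltry.
- exact: measurable_funTS.
- exists M; split; first exact: num_real.
  by move=> z Mz w _ /=; exact: le_trans (FM w) (ltW Mz).
Qed.

Lemma Rint_shift (A : set Om) (F : Om -> R) (M : R) : measurable A ->
  measurable_fun setT F -> (forall w, `|F w| <= M) ->
  Rint P A (fun w => F w + M) = Rint P A F + M * fine (P A).
Proof.
move=> mA mF FM; have iF := bounded_integrable mA mF FM.
have iM : P.-integrable A (EFin \o cst M) by exact: finite_measure_integrable_cst.
rewrite /Rint; under eq_integral do rewrite EFinD.
rewrite (integralD_EFin mA iF iM) fineD; try exact: integrable_fin_num.
rewrite (integral_cst P mA M%:E : \int[P]_(w in A) (EFin \o cst M) w = _)%E.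
by rewrite fineM// fin_num_measure.
Qed.

End Shift.

Lemma nnfun_shift (R : realType) (f : (R -> R) -> R) (M : R) : bounded_cont_functional f ->
  (forall g, `|f g| <= M) -> nnfun (fun g => f g + M) (2 * M).
Proof.
move=> bf fM; have h g : - M <= f g <= M by rewrite -ler_norml.
split; last by move=> g; have /andP[h1 h2] := h g; apply/andP; split; lra.
split.
  by exists (2 * M) => g; have /andP[h1 h2] := h g; rewrite ger0_norm; lra.
move=> g cg e e0; have [del del0 hd] := bf.2 g cg e e0; exists del => // k ck hk.
rewrite (_ : _ - _ = f g - f k); first exact: hd.
by ring.
Qed.

(** * The conditional limit on the canonical space *)

Section Conclusion.
Context {R : realType} {dT : measure_display} {T : measurableType dT}.
Local Notation E := (canon R T).
Variable lam : probability E R.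
Hypothesis lam_iid : iid_law lam.
Variable K : nat -> T -> R -> bool.
Hypothesis mK : forall i, measurable [set p : T * R | K i p.1 p.2].
Local Notation AA := (AA K).
Variables (c gam : R).
Hypotheses (c0 : 0 < c) (gam0 : 0 < gam) (gam1 : gam < 1).
Hypothesis C1 : forall y k,
  (lam [set e | ole (Tk cX y k e) (tau cX cU K y e)] <= (c * gam ^+ k)%:E)%E.
Variable CF : R.
Hypothesis CF0 : 0 <= CF.
Hypothesis survival : forall n y, (0 < n)%N ->
  (lam [set e | olt n (Tk cX y 1 e)] <= (CF * (1 + `|y|) / Num.sqrt n%:R)%:E)%E.
Variables (x Ca : R).
Hypothesis Ca0 : 0 <= Ca.
Hypothesis meanS : forall k,
  (\int[lam]_(e in AA x k) (1 + absSk x k e)%:E <= (Ca * gam ^+ k)%:E)%E.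
Context {d' : measure_display} {Om' : measurableType d'}.
Variables (Q : probability Om' R) (Wp Wm : Om' -> R -> R) (sigma : R) (u : R -> R).
Hypothesis sigma0 : 0 < sigma.
Hypotheses (cWp : cont_process Wp) (cWm : cont_process Wm).
Hypothesis C2 : cond_C2 lam cX cU K u.
Hypothesis C4 : forall y, 0 < u y -> weak_conv
  (fun n f => cond_expect lam (fun e => f (hat_walk cX sigma y n e))
     [set e | olt n (tau cX cU K y e) /\ olt n (Tk cX y 1 e)])
  (fun f => expect Q (fun w => f (if 0 <= y then Wp w else Wm w))).
Hypothesis C3 : cond_C3 lam cX cU K x.
Local Notation limQ := (limk lam K x Q Wp Wm u).
Local Notation hw n e := (hat_walk cX sigma x n e).
Local Notation rt n := (Num.sqrt n%:R : R).
Local Notation surv n := [set e : E | olt n (tau cX cU K x e)].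
Local Open Scope ereal_scope.

Let mAA := measurable_AA mK.
Let u0 y : (0 <= u y)%R := u_ge0 C2 y.
Let mu : measurable_fun setT u := measurable_u mK C2.
Let mS k : measurable_fun setT (Sk x k : E -> R) := measurable_Sk x k.
Let muS k : measurable_fun setT (fun e : E => (u (Sk x k e))%:E).
Proof. by apply/measurable_EFinP; exact: (measurableT_comp mu (mS k)). Qed.

Definition pos_part k : set E := AA x k `&` [set e | (0 <= Sk x k e)%R].
Definition neg_part k : set E := AA x k `&` [set e | (Sk x k e < 0)%R].
Definition vp k : \bar R := \int[lam]_(e in pos_part k) (u (Sk x k e))%:E.
Definition vm k : \bar R := \int[lam]_(e in neg_part k) (u (Sk x k e))%:E.

Lemma measurable_pos_part k : measurable (pos_part k).
Proof.
apply: measurableI; first exact: mAA.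
by rewrite -[X in measurable X]setTI; apply: measurable_fun_le => //; exact: mS.
Qed.

Lemma measurable_neg_part k : measurable (neg_part k).
Proof.
apply: measurableI; first exact: mAA.
rewrite (_ : [set e | _] = ~` [set e | (0 <= Sk x k e)%R]).
  apply: measurableC; rewrite -[X in measurable X]setTI.
  by apply: measurable_fun_le => //; exact: mS.
by apply/seteqP; split=> e /=; rewrite ltNge => /negP.
Qed.

Lemma parts_union k : AA x k = pos_part k `|` neg_part k.
Proof.
apply/seteqP; split=> [e Ae|e [[]|[]]//].
by case: (leP 0%R (Sk x k e)) => h; [left|right].
Qed.

Lemma parts_disj k : [disjoint pos_part k & neg_part k].
Proof.
apply/disj_setPS => e [[_ h1] [_ h2]].
by move: h2; rewrite /= ltNge (h1 : (0 <= Sk x k e)%R).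
Qed.

Lemma vp_ge0 k : 0 <= vp k.
Proof. by apply: integral_ge0 => e _; rewrite lee_fin. Qed.

Lemma vm_ge0 k : 0 <= vm k.
Proof. by apply: integral_ge0 => e _; rewrite lee_fin. Qed.

Lemma Vterm_set (b : bool) k : [set e : E | exists t, Tk cX x k e = Some t /\
    ole (Some t) (tau cX cU K x e) /\ (b -> (0 <= walk cX x e t)%R)] =
  if b then pos_part k else AA x k.
Proof.
case: b; apply/seteqP; split=> e /=.
- move=> [t [h1 [h2 h3]]]; have Ae : Al K x k t e by [].
  by split; [exists t|rewrite /= (AlSk Ae); exact: h3].
- by move=> [[t _ Ae] h]; exists t; case: (Ae) => h1 h2; split=> //; split=> // _; rewrite -(AlSk Ae).
- by move=> [t [h1 [h2 _]]]; exists t.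
- by move=> [t _ [h1 h2]]; exists t; split.
Qed.

Lemma Vterm_true k : Vterm lam cX cU K u true x k = vp k.
Proof. by rewrite /Vterm Vterm_set. Qed.

Lemma Vterm_false k : Vterm lam cX cU K u false x k = vp k + vm k.
Proof.
rewrite /Vterm Vterm_set /vp /vm.
rewrite parts_union ge0_integral_setU//.
- exact: measurable_pos_part.
- exact: measurable_neg_part.
- by apply: measurable_funTS; exact: muS.
- by move=> e _; rewrite lee_fin.
- exact: parts_disj.
Qed.

(** The limit law of an excursion depends on its starting point only through the sign, so it factors
    out on each of the two parts. *)
Lemma limkE f M k : nnfun f M -> limQ f k =
  (expect Q (fun w => f (Wp w)))%:E * vp k + (expect Q (fun w => f (Wm w)))%:E * vm k.
Proof.
move=> nf.
have /andP[wp0 _] := wlim_ge0 Q cWp cWm 0%R nf; rewrite /wlim lexx in wp0.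
have /andP[wm0 _] := wlim_ge0 Q cWp cWm (-1)%R nf; rewrite /wlim lerNr oppr0 ler10 in wm0.
have mlim : measurable_fun setT (fun e : E => (u (Sk x k e) * wlim Q Wp Wm f (Sk x k e))%:E).
  apply/measurable_EFinP; apply: measurable_funM; first exact: (measurableT_comp mu (mS k)).
  rewrite (_ : (fun e : E => wlim Q Wp Wm f (Sk x k e)) = (fun e => if (0 <= Sk x k e)%R
      then expect Q (fun w => f (Wp w)) else expect Q (fun w => f (Wm w)))); last first.
    by apply/funext => e; rewrite /wlim; case: (0 <= Sk x k e)%R.
  apply: measurable_fun_ifT => //.
  by apply: measurable_fun_ler => //; exact: mS.
rewrite /limk parts_union ge0_integral_setU//; first last.
- exact: parts_disj.
- by move=> e _; rewrite lee_fin mulr_ge0//; have /andP[] := wlim_ge0 Q cWp cWm (Sk x k e) nf.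
- exact: measurable_funTS.
- exact: measurable_neg_part.
- exact: measurable_pos_part.
congr (_ + _).
  rewrite -ge0_integralZl//; first last.
  - by move=> e _; rewrite lee_fin.
  - exact: measurable_funTS.
  - exact: measurable_pos_part.
  apply: eq_integral => e; rewrite inE => -[_ h].
  by rewrite /wlim (h : (0 <= Sk x k e)%R) mulrC EFinM.
rewrite -ge0_integralZl//; first last.
- by move=> e _; rewrite lee_fin.
- exact: measurable_funTS.
- exact: measurable_neg_part.
apply: eq_integral => e; rewrite inE => -[_ h].
by rewrite /wlim leNgt (h : (Sk x k e < 0)%R) /= mulrC EFinM.
Qed.

Lemma limk1 k : limQ (fun=> 1%R) k = vp k + vm k.
Proof.
by rewrite (limkE k nnfun1) /expect !integral_cst//= probability_setT mule1 !mul1e.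
Qed.

Definition sp : \bar R := \sum_(0 <= k <oo) vp k.
Definition sm : \bar R := \sum_(0 <= k <oo) vm k.

Lemma VfunE : Vfun lam cX cU K u x = sp + sm.
Proof.
rewrite /Vfun (eq_eseriesr (g := fun k => vp k + vm k)); last by move=> k _; exact: Vterm_false.
by apply: nneseriesD => *; [exact: vp_ge0|exact: vm_ge0].
Qed.

Lemma sp_ge0 : 0 <= sp. Proof. by apply: nneseries_ge0 => k _ _; exact: vp_ge0. Qed.
Lemma sm_ge0 : 0 <= sm. Proof. by apply: nneseries_ge0 => k _ _; exact: vm_ge0. Qed.

Lemma spm_lt : sp + sm < +oo.
Proof.
rewrite -VfunE /Vfun (eq_eseriesr (g := limQ (fun=> 1%R))); last first.
  by move=> k _; rewrite Vterm_false limk1.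
have lb k := limk_bounds mK CF0 survival meanS Q cWp cWm C2 nnfun1 k.
apply: (@le_lt_trans _ _ (CF * Ca * (1 - gam)^-1)%:E); last exact: ltry.
apply: nneseries_le_bound; first by move=> k; have /andP[] := lb k.
move=> N; apply: (@le_trans _ _ (\sum_(0 <= k < N) (CF * Ca * gam ^+ k)%:E)).
  by apply: lee_sum => k _; have /andP[_] := lb k; rewrite mul1r mulrA.
rewrite sumEFin lee_fin -mulr_sumr ler_wpM2l ?mulr_ge0//.
by apply: geometric_sum_le; rewrite ltW.
Qed.

Lemma sp_fin : sp \is a fin_num.
Proof. by rewrite ge0_fin_numE ?sp_ge0//; apply: le_lt_trans spm_lt; rewrite leeDl// sm_ge0. Qed.

Lemma sm_fin : sm \is a fin_num.
Proof. by rewrite ge0_fin_numE ?sm_ge0//; apply: le_lt_trans spm_lt; rewrite leeDr// sp_ge0. Qed.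

Lemma measurable_surv n : measurable (surv n).
Proof. exact: measurable_olt_tau. Qed.

Lemma survival_limit_real f M : nnfun f M ->
  (fun n => rt n * Rint lam (surv n) (fun e => f (hw n e)))%R @ \oo -->
  (expect Q (fun w => f (Wp w)) * fine sp + expect Q (fun w => f (Wm w)) * fine sm)%R.
Proof.
move=> nf; have /fine_cvgP[_] : (fun n => (rt n)%:E * \int[lam]_(e in surv n) (f (hw n e))%:E) @ \oo -->
    (expect Q (fun w => f (Wp w)) * fine sp + expect Q (fun w => f (Wm w)) * fine sm)%:E.
  have -> : (expect Q (fun w => f (Wp w)) * fine sp + expect Q (fun w => f (Wm w)) * fine sm)%:E =
      \sum_(0 <= k <oo) limQ f k.
    have /andP[wp0 _] := wlim_ge0 Q cWp cWm 0%R nf; rewrite /wlim lexx in wp0.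
    have /andP[wm0 _] := wlim_ge0 Q cWp cWm (-1)%R nf; rewrite /wlim lerNr oppr0 ler10 in wm0.
    rewrite [RHS](eq_eseriesr (g := fun k => (expect Q (fun w => f (Wp w)))%:E * vp k +
      (expect Q (fun w => f (Wm w)))%:E * vm k)); last by move=> k _; exact: limkE nf.
    rewrite nneseriesD; first last.
    - by move=> k _; rewrite mule_ge0 ?vm_ge0// lee_fin.
    - by move=> k _; rewrite mule_ge0 ?vp_ge0// lee_fin.
    rewrite !nneseriesZl; [|by move=> k _; exact: vm_ge0|by move=> k _; exact: vp_ge0].
    by rewrite EFinD !EFinM (fineK sp_fin) (fineK sm_fin).
  exact: (survival_limit lam_iid mK c0 gam0 gam1 C1 CF0 survival Ca0 meanS sigma0 cWp cWm C2 C4 nf).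
move=> h; apply: (cvg_seq_eq _ h) => n /=.
have mf : measurable_fun setT (fun e : E => f (hw n e)) := measurable_hat_walk sigma x n nf.1.
have [fi _] := Rint_bound lam (measurable_surv n) mf (fun e => nf.2 _).
by rewrite fineM.
Qed.

Lemma mass_limit : (fun n => rt n * fine (lam (surv n)))%R @ \oo --> (fine sp + fine sm)%R.
Proof.
have := survival_limit_real nnfun1; rewrite /expect !integral_cst//= probability_setT mule1 /= !mul1r.
move=> h; apply: (cvg_seq_eq _ h) => n; rewrite /Rint integral_cst ?mul1e//; exact: measurable_surv.
Qed.

Lemma surv_pos n : (0 < n)%N -> (0 < fine (lam (surv n)))%R.
Proof.
move=> n0; have [c3 [c30 h3]] := C3; have := h3 n n0.
rewrite -(fineK (fin_num_measure lam _ (measurable_surv n))) lee_fin; apply: lt_le_trans.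
by rewrite mulr_gt0// invr_gt0// sqrtr_gt0 ltr0n.
Qed.

(** The limit of [sqrt n] times the survival probability is [V(x)], and (C3) keeps it away from
    zero. *)
Lemma V_pos : (0 < fine sp + fine sm)%R.
Proof.
have [c3 [c30 h3]] := C3; apply: (@lt_le_trans _ _ c3^-1%R); first by rewrite invr_gt0.
rewrite -(cvg_lim _ mass_limit)//; apply: limr_ge.
  by apply/cvg_ex; exists (fine sp + fine sm)%R; exact: mass_limit.
exists 1%N => // n /= n0; have := h3 n n0.
rewrite -(fineK (fin_num_measure lam _ (measurable_surv n))) lee_fin.
by rewrite ler_pdivrMr ?sqrtr_gt0 ?ltr0n// mulrC.
Qed.

Lemma cond_limit f M : nnfun f M ->
  (fun n => cond_expect lam (fun e => f (hw n e)) (surv n)) @ \oo -->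
  ((expect Q (fun w => f (Wp w)) * fine sp + expect Q (fun w => f (Wm w)) * fine sm) /
   (fine sp + fine sm))%R.
Proof.
move=> nf; have V0 : (fine sp + fine sm != 0)%R by rewrite gt_eqF// V_pos.
have h : (fun n => (rt n * Rint lam (surv n) (fun e => f (hw n e))) / (rt n * fine (lam (surv n))))%R
    @ \oo --> ((expect Q (fun w => f (Wp w)) * fine sp + expect Q (fun w => f (Wm w)) * fine sm) /
   (fine sp + fine sm))%R.
  by apply: cvgM; [exact: (survival_limit_real nf)|apply: cvgV => //; exact: mass_limit].
apply: (@cvg_seq_near _ _ _ _ 1%N _ h) => n n0 /=.
have s0 : (rt n != 0)%R by rewrite gt_eqF// sqrtr_gt0 ltr0n.
by rewrite /cond_expect -/(Rint lam (surv n) (fun e => f (hw n e))) -mulf_div mulfV// mul1r.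
Qed.

Lemma canonical_limit : 0 < Vfun lam cX cU K u x /\ Vfun lam cX cU K u x < +oo /\
  0 <= rho_prob lam cX cU K u x <= 1 /\
  forall rho : Om' -> R, measurable_fun setT rho ->
    (forall w, rho w = 0%R \/ rho w = 1%R) ->
    indep2 Q (preimg_sets rho) (process_sigma Wp Wm) ->
    Q [set w | rho w = 1%R] = rho_prob lam cX cU K u x ->
    weak_conv (fun n f => cond_expect lam (fun e => f (hw n e)) (surv n))
      (fun f => expect Q (fun w => f (fun t => rho w * Wp w t + (1 - rho w) * Wm w t)%R)).
Proof.
have V0 := V_pos.
have VE : Vfun lam cX cU K u x = (fine sp + fine sm)%:E.
  by rewrite VfunE EFinD !fineK ?sp_fin ?sm_fin.
have rE : rho_prob lam cX cU K u x = (fine sp / (fine sp + fine sm))%:E.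
  rewrite /rho_prob VE (eq_eseriesr (g := vp)); last by move=> k _; exact: Vterm_true.
  by rewrite inver gt_eqF// EFinM fineK ?sp_fin.
have a0 : (0 <= fine sp)%R by rewrite fine_ge0// sp_ge0.
have b0 : (0 <= fine sm)%R by rewrite fine_ge0// sm_ge0.
split; first by rewrite VE lte_fin.
split; first by rewrite VE ltry.
split.
  by rewrite rE !lee_fin divr_ge0 ?addr_ge0//= ler_pdivrMr// mul1r lerDl.
move=> rho mrho rho01 ind Qrho f bf.
have [M fM] := bf.1; have nf := nnfun_shift bf fM.
have mixc := cont_process_mixture cWp cWm mrho rho01.
have h := cond_limit nf.
have emix := expect_mixture cWp cWm mrho rho01 ind nf.
have sh := Rint_shift Q measurableT (measurable_functional mixc bf) (fun w => fM _).
rewrite probability_setT /= mulr1 in sh.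
have -> : expect Q (fun w => f (fun t => rho w * Wp w t + (1 - rho w) * Wm w t)%R) =
   ((expect Q (fun w => (f (Wp w) + M)%R) * fine sp + expect Q (fun w => (f (Wm w) + M)%R) * fine sm) /
   (fine sp + fine sm) - M)%R.
  apply: (@addIr _ M); rewrite subrK; transitivity (expect Q (fun w => f (fun t => rho w * Wp w t + (1 - rho w) * Wm w t) + M))%R.
    exact/esym/sh.
  rewrite emix Qrho rE /=; move: V0; set a := fine sp; set b := fine sm => V0; field.
  by rewrite gt_eqF.
(* Undoing the shift by [M] in a conditional expectation requires a conditioning event of positive
   probability, which (C3) gives for [n >= 1]. *)
apply: (@cvg_seq_near _ _ _ _ 1%N _ (cvgB h (cvg_cst M))) => n n0 /=.
have p0 := surv_pos n0.
have := Rint_shift lam (measurable_surv n) (measurable_hat_walk sigma x n bf) (fun e => fM _).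
move=> sh2; transitivity (Rint lam (surv n) (fun e => f (hw n e) + M) / fine (lam (surv n)) - M)%R => //.
by rewrite sh2 mulrDl mulfK ?gt_eqF// addrK.
Qed.

End Conclusion.

(** * Transfer to the canonical space *)

Section Transfer.
Context {R : realType} {d : measure_display} {Omega : measurableType d}.
Variable P : probability Omega R.
Context {dT : measure_display} {T : measurableType dT}.
Variables (X : nat -> Omega -> R) (U : nat -> Omega -> T).
Hypothesis mX : forall i, measurable_fun setT (X i).
Hypothesis mU : forall k, measurable_fun setT (U k).
Local Notation E := (canon R T).

Definition path_map (w : Omega) : E := (fun i => X i w, fun k => U k w).

Lemma measurable_path_map : measurable_fun setT path_map.
Proof. exact: measurable_to_canon. Qed.

Definition path_mfun : {mfun Omega >-> E} :=
  HB.pack path_map (isMeasurableFun.Build _ _ _ _ path_map measurable_path_map).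

Definition path_law : probability E R := distribution P path_mfun.

Lemma path_law_iid :
  mutual_indep P (fun i : nat + nat =>
    match i with inl j => preimg_sets (X j) | inr k => preimg_sets (U k) end) ->
  (forall i (B : set R), measurable B -> P (X i @^-1` B) = P (X 0%N @^-1` B)) ->
  (forall k (B : set T), measurable B -> P (U k @^-1` B) = P (U 0%N @^-1` B)) ->
  iid_law path_law.
Proof.
move=> ind idX idU N M A B mA mB AN BM.
pose C (i : nat + nat) := match i with inl j => X j @^-1` A j | inr k => U k @^-1` B k end.
(* All constrained steps and marks in one list, for a single use of mutual independence. *)
pose J : seq (nat + nat) := map inl (iota 0 N) ++ map inr (iota 0 M).
have J1 i : (inl i \in J) = (i < N)%N.
  rewrite mem_cat mem_map; last by move=> ? ? [].
  rewrite mem_iota /= add0n; case: (i < N)%N => //=.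
  by apply/negbTE/negP => /mapP[].
have J2 i : (inr i \in J) = (i < M)%N.
  rewrite mem_cat orbC mem_map; last by move=> ? ? [].
  rewrite mem_iota /= add0n; case: (i < M)%N => //=.
  by apply/negbTE/negP => /mapP[].
have uJ : uniq J.
  rewrite cat_uniq !map_inj_uniq ?iota_uniq; try by move=> ? ? [].
  by rewrite /= andbT; apply/hasPn => _ /mapP[k _ ->]; apply/negP => /mapP[].
have := ind J C uJ; rewrite big_cat !big_map/= => h.
transitivity (P (\bigcap_(i in [set i | i \in J]) C i)).
  change (P (path_map @^-1` cyl A B) = P (\bigcap_(i in [set i | i \in J]) C i)).
  congr (P _); apply/seteqP; split=> w.
    by move=> [h1 h2] [i|i] _; [exact: h1|exact: h2].
  move=> hw; split=> i.
    by have [Ni|iN] := leqP N i; [rewrite AN|apply: (hw (inl i)); rewrite /= J1].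
  by have [Mi|iM] := leqP M i; [rewrite BM|apply: (hw (inr i)); rewrite /= J2].
rewrite h; last by move=> [i|i] _; [exists (A i)|exists (B i)].
congr (_ * _)%E.
  rewrite (_ : iota 0 N = index_iota 0 N) ?big_mkord; last by rewrite /index_iota subn0.
  by apply: eq_bigr => i _; exact: idX.
rewrite (_ : iota 0 M = index_iota 0 M) ?big_mkord; last by rewrite /index_iota subn0.
by apply: eq_bigr => i _; exact: idU.
Qed.

Lemma cond_expect_path_law (F : E -> R) (M : R) (A : set E) : measurable A ->
  measurable_fun setT F -> (forall e, `|F e| <= M) ->
  cond_expect path_law F A = cond_expect P (F \o path_map) (path_map @^-1` A).
Proof.
move=> mA mF FM; rewrite /cond_expect; congr (fine _ / _).
have mFE : measurable_fun setT (EFin \o F) by exact/measurable_EFinP.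
have mA' : measurable (path_map @^-1` A).
  by rewrite -[X in measurable X]setTI; exact: measurable_path_map.
have iF : P.-integrable (path_map @^-1` A) (EFin \o (F \o path_map)).
  apply: (bounded_integrable P (M := M)) => //.
  - exact: (measurableT_comp mF measurable_path_map).
  - by move=> w; exact: FM.
exact: (integral_pushforward measurable_path_map mFE iF mA).
Qed.

Lemma integral_path_law (A : set E) (F : E -> \bar R) : measurable A ->
  measurable_fun setT F -> (forall e, 0 <= F e)%E ->
  (\int[path_law]_(e in A) F e = \int[P]_(w in path_map @^-1` A) F (path_map w))%E.
Proof.
move=> mA mF F0; apply: (ge0_integral_pushforward measurable_path_map P mA).
  exact: measurable_funTS.
by move=> e _; exact: F0.
Qed.

End Transfer.

Unset Implicit Arguments. Set Strict Implicit.

Theorem theorem2 (R : realType)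
  (d : measure_display) (Omega : measurableType d) (P : probability Omega R)
  (X : nat -> Omega -> R) (sigma : R)
  (dT : measure_display) (T : measurableType dT) (U : nat -> Omega -> T)
  (K : nat -> T -> R -> bool) (u : R -> R)
  (d' : measure_display) (Omega' : measurableType d') (Q : probability Omega' R)
  (Wp Wm : Omega' -> R -> R) (x : R) :
  (* the walk increments X_1, X_2, ... (= X 0, X 1, ...) and U_0, U_1, ... *)
  (forall i, measurable_fun setT (X i)) ->
  (forall k, measurable_fun setT (U k)) ->
  (* X_1, X_2, ..., U_0, U_1, ... are mutually independent *)
  mutual_indep P (fun i : nat + nat =>
    match i with inl j => preimg_sets (X j) | inr k => preimg_sets (U k) end) ->
  (* X_i identically distributed, U_k identically distributed *)
  (forall i (B : set R), measurable B -> P (X i @^-1` B) = P (X 0%N @^-1` B)) ->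
  (forall k (B : set T), measurable B -> P (U k @^-1` B) = P (U 0%N @^-1` B)) ->
  (* E[X_1] = 0, Var(X_1) = sigma^2 in (0, oo) *)
  P.-integrable setT (EFin \o X 0%N) ->
  (\int[P]_w (X 0%N w)%:E = 0)%E ->
  0 < sigma ->
  (\int[P]_w ((X 0%N w - fine (\int[P]_v (X 0%N v)%:E)) ^+ 2)%:E = (sigma ^+ 2)%:E)%E ->
  (* the K_i are measurable *)
  (forall i, measurable [set p : T * R | K i p.1 p.2]) ->
  (* (C1) *)
  cond_C1 P X U K ->
  (* (C2) *)
  cond_C2 P X U K u ->
  (* (C4), with W_+ = Wp, W_- = Wm continuous processes *)
  cont_process Wp -> cont_process Wm ->
  (forall y, 0 < u y ->
     weak_conv
       (fun n f => cond_expect P (fun w => f (hat_walk X sigma y n w))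
                     [set w | olt n (tau X U K y w) /\ olt n (Tk X y 1 w)])
       (fun f => expect Q (fun w => f (if 0 <= y then Wp w else Wm w)))) ->
  (* (C3) at x *)
  cond_C3 P X U K x ->
  (* conclusion *)
  (0 < Vfun P X U K u x)%E /\ (Vfun P X U K u x < +oo)%E /\
  (0 <= rho_prob P X U K u x <= 1)%E /\
  forall rho : Omega' -> R,
    measurable_fun setT rho ->
    (forall w, rho w = 0 \/ rho w = 1) ->
    indep2 Q (preimg_sets rho) (process_sigma Wp Wm) ->
    Q [set w | rho w = 1] = rho_prob P X U K u x ->
    weak_conv
      (fun n f => cond_expect P (fun w => f (hat_walk X sigma x n w))
                    [set w | olt n (tau X U K x w)])
      (fun f => expect Q (fun w => f (fun t => rho w * Wp w t + (1 - rho w) * Wm w t))).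
Proof.
move=> mX mU ind idX idU iX EX sigma0 varX mK c1 c2 cWp cWm c4 c3.
pose lam : probability (canon R T) R := path_law P mX mU.
have lam_iid : iid_law lam by exact: path_law_iid.
have mc0 : measurable_fun setT (fun e : canon R T => (e.1 0%N)%:E).
  by apply/measurable_EFinP; exact: measurable_coord1.
have iX' : lam.-integrable setT (fun e => (e.1 0%N)%:E).
  exact: (integrable_pushforward (measurable_path_map mX mU) mc0 iX measurableT).
have EX' : (\int[lam]_e (e.1 0%N)%:E = 0)%E.
  rewrite -[RHS]EX.
  exact: (integral_pushforward (measurable_path_map mX mU) mc0 iX measurableT).
have X2E : (\int[lam]_e (e.1 0%N ^+ 2)%:E = (sigma ^+ 2)%:E)%E.
  rewrite (integral_path_law P mX mU measurableT); first last.
  - by move=> e; rewrite lee_fin sqr_ge0.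
  - apply/measurable_EFinP; apply: (measurable_funX 2); exact: measurable_coord1.
  by rewrite preimage_setT -varX EX /=; apply: eq_integral => w _ /=; rewrite subr0.
have X2 : (\int[lam]_e (e.1 0%N ^+ 2)%:E < +oo)%E by rewrite X2E ltry.
have X2n0 : (\int[lam]_e (e.1 0%N ^+ 2)%:E != 0)%E.
  by rewrite X2E eqe gt_eqF// exprn_gt0.
have [c [gam [c0 [/andP[gam0 gam1] C1]]]] := c1.
(* Along [path_map] the canonical walk, marks and [tau] are the original ones by computation, and
   [lam] measures preimages; (C1), (C2) and (C3) therefore transfer by conversion. *)
have C1' : forall y k,
    (lam [set e | ole (Tk cX y k e) (tau cX cU K y e)] <= (c * gam ^+ k)%:E)%E := C1.
have [CF CF0 stay] := stay_prob_bound lam_iid iX' EX' X2 X2n0.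
have survival n y : (0 < n)%N ->
    (lam [set e | olt n (Tk cX y 1 e)] <= (CF * (1 + `|y|) / Num.sqrt n%:R)%:E)%E.
  move=> n0; apply: le_trans (stay (0 <= y) n y n0 erefl).
  rewrite stay_probE le_eqVlt; apply/orP; left; apply/eqP; congr (lam _).
  by apply/seteqP; split=> e /=; rewrite /Tk olt_cross1 /side walk0.
have [Ca Ca0 meanS] := crossing_mean lam_iid mK c0 gam0 C1'
  (fun eps eps0 => exit_mean_bound lam_iid iX' EX' X2 X2n0 eps0) x.
have C2' : cond_C2 lam cX cU K u := c2.
have C3' : cond_C3 lam cX cU K x := c3.
have C4' y : 0 < u y -> weak_conv
    (fun n f => cond_expect lam (fun e => f (hat_walk cX sigma y n e))
       [set e | olt n (tau cX cU K y e) /\ olt n (Tk cX y 1 e)])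
    (fun f => expect Q (fun w => f (if 0 <= y then Wp w else Wm w))).
  move=> uy f bf; have [M fM] := bf.1.
  apply: cvg_seq_eq (c4 y uy f bf) => n.
  apply: (cond_expect_path_law P mX mU (M := M)) => //.
  - exact: (measurable_ev mK y n).
  - exact: measurable_hat_walk.
have [V0 [V1 [r01 lim]]] := canonical_limit lam_iid mK c0 gam0 gam1 C1' CF0 survival Ca0 meanS
  sigma0 cWp cWm C2' C4' C3'.
have u0 := u_ge0 C2'.
have VE b k : Vterm lam cX cU K u b x k = Vterm P X U K u b x k.
  rewrite /Vterm; apply: (integral_path_law P mX mU).
  - rewrite Vterm_set; case: b; [exact: measurable_pos_part|exact: measurable_AA].
  - apply/measurable_EFinP.
    exact: (measurableT_comp (measurable_u mK C2') (measurable_Sk x k)).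
  - by move=> e; rewrite lee_fin.
have VfE : Vfun lam cX cU K u x = Vfun P X U K u x.
  by apply: eq_eseriesr => k _; exact: VE.
have rE : rho_prob lam cX cU K u x = rho_prob P X U K u x.
  by rewrite /rho_prob VfE; congr (_ / _)%E; apply: eq_eseriesr => k _; exact: VE.
rewrite -VfE -rE; split=> //; split=> //; split=> //.
move=> rho mrho rho01 indr Qr f bf; have [M fM] := bf.1.
apply: cvg_seq_eq (lim rho mrho rho01 indr Qr f bf) => n.
apply/esym/(cond_expect_path_law P mX mU (M := M)) => //.
- exact: (measurable_olt_tau mK x n).
- exact: measurable_hat_walk.
Qed.
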